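(* Let $\overline{M}$ be a smooth manifold of dimension $n+1$ with boundary $\partial M$ and interior $M$. Suppose that $\overline{M}$ is endowed with a projective structure and that $\nabla$ is a connection in (the restriction of) the projective class on $M$ which is the Levi-Civita connection of a non-Ricci-flat Einstein metric or, equivalently, satisfies: - $\nabla$ is special, i.e. it preserves a non-zero section $\kappa$ of $\mathrm{vol}(M)$; - $\nabla\mathrm{Ric}^\nabla=0$, and $\mathrm{Ric}^\nabla$ is non-degenerate. Suppose further that $\nabla$ does not smoothly extend to any neighborhood of a boundary point. Then $\nabla$ is projectively compact of order $\alpha=2$, the section $\tau:=\kappa^{-2/(n+2)}\in\Gamma(\mathcal{E}(2)|_M)$ smoothly extends by zero to a defining density for $\partial M$, and this extension is a normal solution of the first BGG equation on $\mathcal{E}(2)$ on $\overline{M}$, i.e. $L(\tau)$ is a parallel section of $S^2\mathcal{T}^*$ over $\overline{M}$.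
   Context: All affine connections are torsion free; smooth means $C^\infty$. For a one-form $\Upsilon$, write $\hat\nabla=\nabla+\Upsilon$ for $\hat\nabla_\xi\eta=\nabla_\xi\eta+\Upsilon(\xi)\eta+\Upsilon(\eta)\xi$; connections so related are projectively equivalent, and a projective structure is an equivalence class. Einstein means that the Ricci curvature is a constant multiple of the metric (of arbitrary signature). A local defining function for $\partial M$ is a smooth $\rho:U\to\mathbb{R}_{\ge0}$, $U\subset\overline{M}$ open, with $\rho^{-1}(\{0\})=U\cap\partial M$ and $d\rho\neq0$ along $U\cap\partial M$. $\nabla$ on $M$ is projectively compact of order $\alpha>0$ if near each boundary point there is a defining function $\rho$ such that $\nabla+\frac{d\rho}{\alpha\rho}$ extends smoothly to the boundary. Densities: $\mathrm{vol}(N)$ is the (trivializable) bundle of volume densities and $\mathcal{E}(w)=\mathrm{vol}(N)^{-w/(n+2)}$ for $\dim N=n+1$. A connection is special if it preserves a non-zero (nowhere vanishing; without restriction positive) section of $\mathrm{vol}$. A defining density is a section of a density bundle over $\overline M$ with zero locus $\partial M$ that in local trivializations around boundary points is represented (up to sign) by a defining function. Tractors (abstract indices, $\mathcal{E}_a=T^*N$, ''$(w)$'' means tensoring with $\mathcal{E}(w)$, $\dim N=n+1\ge2$): the cotractor bundle is $\mathcal{T}^*=J^1(\mathcal{E}(1))$. A connection $\tilde\nabla$ in the class gives $\mathcal{T}^*\cong\mathcal{E}(1)\oplus\mathcal{E}_a(1)$, elements $\binom{\sigma}{\mu_a}$, changing to $\binom{\sigma}{\mu_a+\Upsilon_a\sigma}$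 when passing to $\tilde\nabla+\Upsilon$. The tractor connection is $\nabla^{\mathcal{T}^*}_a\binom{\sigma}{\mu_b}=\binom{\tilde\nabla_a\sigma-\mu_a}{\tilde\nabla_a\mu_b+\tilde{\mathsf P}_{ab}\sigma}$, with $\tilde{\mathsf P}_{ab}=\frac1n\widetilde{\mathrm{Ric}}_{ab}$ (symmetric) for special $\tilde\nabla$. Correspondingly $S^2\mathcal{T}^*\cong\mathcal{E}(2)\oplus\mathcal{E}_a(2)\oplus\mathcal{E}_{(ab)}(2)$ with elements $(\tau,\nu_a,\rho_{ab})$ and induced connection $$\nabla^{S^2\mathcal{T}^*}_a(\tau,\nu_b,\rho_{bc})=(\tilde\nabla_a\tau-2\nu_a,\ \tilde\nabla_a\nu_b+\tilde{\mathsf P}_{ab}\tau-\rho_{ab},\ \tilde\nabla_a\rho_{bc}+2\tilde{\mathsf P}_{a(b}\nu_{c)}).$$ Splitting operator: $L(\tau)=(\tau,\frac12\tilde\nabla_a\tau,\frac12\tilde\nabla_{(a}\tilde\nabla_{b)}\tau+\tilde{\mathsf P}_{(ab)}\tau)$, independent of $\tilde\nabla$. The first BGG operator on $\mathcal{E}(2)$ sends $\tau$ to the complete symmetrization in $\Gamma(\mathcal{E}_{(abc)}(2))$ of the third slot of $\nabla^{S^2\mathcal{T}^*}L(\tau)$ (computed with a special connection in the class). A solution is normal if $\nabla^{S^2\mathcal{T}^*}L(\tau)=0$. *)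

(* Defs.v *)
From mathcomp Require Import all_boot all_order all_algebra.
From mathcomp Require Import all_classical all_reals all_analysis.

Set Implicit Arguments.
Unset Strict Implicit.
Unset Printing Implicit Defensive.

Import Order.TTheory GRing.Theory Num.Theory.
Import numFieldNormedType.Exports.
Local Open Scope classical_set_scope.
Local Open Scope ring_scope.

(* The model space is R^(n+1); the half-space is given by its coordinate of
   index 0.  All tensor calculus is done on coordinate representatives: a
   geometric object on a manifold is a family, indexed by the charts of an
   atlas, of functions of the coordinates that obeys the transformation law of
   the object.  Representatives are total functions, but only their values on
   the relevant part of the chart image are ever constrained or used. *)
Section LocalCalculus.
Context {R : realType} {n : nat}.

Definition coord_space := 'rV[R]_n.+1.
Definition tensor0 := coord_space -> R.
Definition tensor1 := coord_space -> 'I_n.+1 -> R.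
Definition tensor2 := coord_space -> 'I_n.+1 -> 'I_n.+1 -> R.
Definition tensor3 := coord_space -> 'I_n.+1 -> 'I_n.+1 -> 'I_n.+1 -> R.

Definition halfspace : set coord_space := [set x | 0 <= x ord0 ord0].

Definition dquot (a : 'I_n.+1) (f : tensor0) (x : coord_space) (h : R) : R :=
  h^-1 * (f (x + h *: delta_mx ord0 a) - f x).

(* Increments are restricted to those that remain in the half-space: at points
   with x_0 = 0 the derivative in direction 0 is one-sided, and in all other
   cases this is the usual two-sided partial derivative. *)
Definition admissible (a : 'I_n.+1) (x : coord_space) : set R :=
  [set h | halfspace (x + h *: delta_mx ord0 a)].

Definition pd (a : 'I_n.+1) (f : tensor0) : tensor0 :=
  fun x => lim (dquot a f x @ within (admissible a x) (0 : R)^').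

Fixpoint Ck (k : nat) (A : set coord_space) (f : tensor0) : Prop :=
  {within A, continuous f} /\
  (if k is k'.+1 then
     forall a, (forall x, A x -> cvg (dquot a f x @ within (admissible a x) (0 : R)^')) /\
               Ck k' A (pd a f)
   else True).

(* For A relatively open in the half-space: smoothness up to the boundary. *)
Definition smooth (A : set coord_space) (f : tensor0) : Prop := forall k, Ck k A f.

(* [G x a b c] is the Christoffel symbol with lower indices a, b and upper
   index c, i.e. the d_c-component of the covariant derivative of d_b along
   d_a. *)
Definition trG (G : tensor3) : tensor1 := fun x a => \sum_c G x a c c.

(* Covariant derivatives of sections of E(w), E_a(w) and E_ab(w), the density
   bundle E(w) = vol^(-w/(n+2)) being trivialized by the coordinate volume; the
   index of the derivative comes first. *)
Definition nabla0 (w : R) (G : tensor3) (f : tensor0) : tensor1 :=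
  fun x a => pd a f x + w / n.+2%:R * trG G x a * f x.

Definition nabla1 (w : R) (G : tensor3) (u : tensor1) : tensor2 :=
  fun x a b => pd a (fun y => u y b) x - \sum_e G x a b e * u x e
               + w / n.+2%:R * trG G x a * u x b.

Definition nabla2 (w : R) (G : tensor3) (t : tensor2) : tensor3 :=
  fun x a b c => pd a (fun y => t y b c) x
               - \sum_e G x a b e * t x e c - \sum_e G x a c e * t x b e
               + w / n.+2%:R * trG G x a * t x b c.

(* Ric_bd is the trace over a, c of the curvature R_ab^c_d. *)
Definition ricci (G : tensor3) : tensor2 :=
  fun x b d => \sum_a pd a (fun y => G y b d a) x - pd b (fun y => trG G y d) x
    + \sum_a \sum_e (G x a e a * G x b d e - G x b e a * G x a d e).

(* Only the right tensor for special connections, whose Ricci curvature is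
   symmetric. *)
Definition schouten (G : tensor3) : tensor2 :=
  fun x a b => n%:R^-1 * ricci G x a b.

Definition matrix_of (t : tensor2) (x : coord_space) : 'M[R]_n.+1 :=
  \matrix_(a, b) t x a b.

Definition proj_change (G : tensor3) (u : tensor1) : tensor3 :=
  fun x a b c => G x a b c + u x a *+ (b == c) + u x b *+ (a == c).

Definition sym2 (t : tensor2) : tensor2 :=
  fun x a b => 2^-1 * (t x a b + t x b a).

Definition sym3 (t : tensor3) : tensor3 :=
  fun x a b c => 6^-1 * (t x a b c + t x a c b + t x b a c
                         + t x b c a + t x c a b + t x c b a).

(* Sections of S^2 T^*, in the splitting given by a connection of the class. *)
Record s2tractor := S2Tractor {
  top_slot : tensor0;
  mid_slot : tensor1;
  bot_slot : tensor2
}.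

Definition nablaS2_top (G : tensor3) (s : s2tractor) : tensor1 :=
  fun x a => nabla0 2 G (top_slot s) x a - 2 * mid_slot s x a.

Definition nablaS2_mid (G : tensor3) (s : s2tractor) : tensor2 :=
  fun x a b => nabla1 2 G (mid_slot s) x a b
               + schouten G x a b * top_slot s x - bot_slot s x a b.

Definition nablaS2_bot (G : tensor3) (s : s2tractor) : tensor3 :=
  fun x a b c => nabla2 2 G (bot_slot s) x a b c
               + schouten G x a b * mid_slot s x c
               + schouten G x a c * mid_slot s x b.

Definition splittingL (G : tensor3) (f : tensor0) : s2tractor :=
  S2Tractor f
    (fun x a => 2^-1 * nabla0 2 G f x a)
    (fun x a b => 2^-1 * sym2 (nabla1 2 G (nabla0 2 G f)) x a b
                  + sym2 (schouten G) x a b * f x).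

End LocalCalculus.

Arguments coord_space : clear implicits.
Arguments tensor0 : clear implicits.
Arguments tensor1 : clear implicits.
Arguments tensor2 : clear implicits.
Arguments tensor3 : clear implicits.

Record chart (R : realType) (n : nat) (T : topologicalType) := Chart {
  cdom : set T;
  cmap : T -> coord_space R n;
  cinv : coord_space R n -> T;
  cdom_open : open cdom;
  cmap_image : exists2 O : set (coord_space R n), open O & cmap @` cdom = O `&` halfspace;
  cmapK : forall p, cdom p -> cinv (cmap p) = p;
  cmap_continuous : {within cdom, continuous cmap};
  cinv_continuous : {within cmap @` cdom, continuous cinv}
}.

(* Smooth manifolds of dimension n+1 with (possibly empty) boundary. *)
Record bmanifold (R : realType) (n : nat) := BManifold {
  carrier :> topologicalType;
  carrier_hausdorff : hausdorff_space carrier;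
  carrier_second_countable : @second_countable carrier;
  atlas_index : Type;
  charts : atlas_index -> chart R n carrier;
  charts_cover : forall p : carrier, exists i, cdom (charts i) p;
  charts_smooth : forall i j (b : 'I_n.+1),
    smooth (cmap (charts i) @` (cdom (charts i) `&` cdom (charts j)))
           (fun y => cmap (charts j) (cinv (charts i) y) ord0 b)
}.

Section Geometry.
Context {R : realType} {n : nat} (M : bmanifold R n).
Implicit Types (W U : set M) (i j : atlas_index M).

Definition chart_im i W : set (coord_space R n) :=
  cmap (charts i) @` (cdom (charts i) `&` W).

Definition transition i j (x : coord_space R n) : coord_space R n :=
  cmap (charts j) (cinv (charts i) x).

Definition overlap i j W : set (coord_space R n) := chart_im i (cdom (charts j) `&` W).

(* [jac i j x a b] is the derivative of the b-th new coordinate along the a-th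
   old one. *)
Definition jac i j (x : coord_space R n) : 'M[R]_n.+1 :=
  \matrix_(a, b) pd a (fun y => transition i j y ord0 b) x.

Definition bdry : set M :=
  [set p | exists2 i, cdom (charts i) p & cmap (charts i) p ord0 ord0 = 0].

Definition inner : set M := ~` bdry.

Definition is_connection W (G : atlas_index M -> tensor3 R n) : Prop :=
  [/\ forall i a b c, smooth (chart_im i W) (fun x => G i x a b c),
      forall i x, chart_im i W x -> forall a b c, G i x a b c = G i x b a c
    & forall i j x, overlap i j W x -> forall a b k,
        \sum_c G i x a b c * jac i j x c k =
        pd a (pd b (fun y => transition i j y ord0 k)) x
        + \sum_l \sum_m G j (transition i j x) l m k * jac i j x a l * jac i j x b m].

Definition is_oneform W (u : atlas_index M -> tensor1 R n) : Prop :=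
  (forall i a, smooth (chart_im i W) (fun x => u i x a)) /\
  (forall i j x, overlap i j W x -> forall a,
     u i x a = \sum_b u j (transition i j x) b * jac i j x a b).

Definition is_density W (w : R) (s : atlas_index M -> tensor0 R n) : Prop :=
  (forall i, smooth (chart_im i W) (s i)) /\
  (forall i j x, overlap i j W x ->
     s i x = s j (transition i j x) * `|\det (jac i j x)| `^ (- w / n.+2%:R)).

Definition conn_eq W (G G' : atlas_index M -> tensor3 R n) : Prop :=
  forall i x, chart_im i W x -> forall a b c, G i x a b c = G' i x a b c.

Definition proj_equiv W (G G' : atlas_index M -> tensor3 R n) : Prop :=
  exists2 u, is_oneform W u & conn_eq W G' (fun i => proj_change (G i) (u i)).

Definition is_projective_structure (P : set (atlas_index M -> tensor3 R n)) : Prop :=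
  exists2 G0, is_connection setT G0 &
    P = [set G | is_connection setT G /\ proj_equiv setT G0 G].

Definition in_class_on (P : set (atlas_index M -> tensor3 R n)) W G : Prop :=
  is_connection W G /\ exists2 G0, P G0 & proj_equiv W G0 G.

Definition preserves_volume W G (kappa : atlas_index M -> tensor0 R n) : Prop :=
  (* vol = E(-(n+2)) *)
  [/\ is_density W (- n.+2%:R) kappa,
      forall i x, chart_im i W x -> 0 < kappa i x
    & forall i x, chart_im i W x -> forall a, nabla0 (- n.+2%:R) (G i) (kappa i) x a = 0].

Definition is_special W G : Prop := exists kappa, preserves_volume W G kappa.

Definition ricci_parallel W (G : atlas_index M -> tensor3 R n) : Prop :=
  forall i x, chart_im i W x -> forall a b c, nabla2 0 (G i) (ricci (G i)) x a b c = 0.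

Definition ricci_nondegenerate W (G : atlas_index M -> tensor3 R n) : Prop :=
  forall i x, chart_im i W x -> \det (matrix_of (ricci (G i)) x) != 0.

(* Pseudo-Riemannian, of arbitrary signature. *)
Definition is_metric W (g : atlas_index M -> tensor2 R n) : Prop :=
  [/\ forall i a b, smooth (chart_im i W) (fun x => g i x a b),
      forall i x, chart_im i W x -> forall a b, g i x a b = g i x b a,
      forall i x, chart_im i W x -> \det (matrix_of (g i) x) != 0
    & forall i j x, overlap i j W x -> forall a b,
        g i x a b = \sum_k \sum_l
          g j (transition i j x) k l * jac i j x a k * jac i j x b l].

(* To be used for torsion-free connections. *)
Definition is_levi_civita W (g : atlas_index M -> tensor2 R n) (G : atlas_index M -> tensor3 R n) : Prop :=
  forall i x, chart_im i W x -> forall a b c, nabla2 0 (G i) (g i) x a b c = 0.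

(* An Einstein metric is Ricci-flat if and only if its Einstein constant
   vanishes. *)
Definition is_nonflat_einstein_connection W (G : atlas_index M -> tensor3 R n) : Prop :=
  exists g lambda,
    [/\ is_metric W g, is_levi_civita W g G, lambda != 0
      & forall i x, chart_im i W x -> forall a b, ricci (G i) x a b = lambda * g i x a b].

Definition extends_to W (G : atlas_index M -> tensor3 R n) : Prop :=
  exists2 G', is_connection W G' & conn_eq (W `&` inner) G G'.

Definition nowhere_extendible (G : atlas_index M -> tensor3 R n) : Prop :=
  forall p W, bdry p -> open W -> W p -> ~ extends_to W G.

Definition is_defining_function U (rho : M -> R) : Prop :=
  [/\ open U,
      forall i, smooth (chart_im i U) (rho \o cinv (charts i)),
      forall p, U p -> 0 <= rho p,
      forall p, U p -> (rho p = 0 <-> bdry p)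
    & forall i p, U p -> bdry p -> cdom (charts i) p ->
        exists a, pd a (rho \o cinv (charts i)) (cmap (charts i) p) != 0].

Definition projectively_compact (alpha : R) (G : atlas_index M -> tensor3 R n) : Prop :=
  0 < alpha /\
  forall p, bdry p -> exists U rho,
    [/\ U p, is_defining_function U rho
      & extends_to U (fun i => proj_change (G i)
          (fun x a => pd a (rho \o cinv (charts i)) x
                      / (alpha * rho (cinv (charts i) x))))].

Definition is_defining_density (w : R) (s : atlas_index M -> tensor0 R n) : Prop :=
  [/\ is_density setT w s,
      forall i p, cdom (charts i) p -> (s i (cmap (charts i) p) = 0 <-> bdry p)
    & forall i p, bdry p -> cdom (charts i) p -> exists U (eps : R),
        [/\ U p, U `<=` cdom (charts i), eps = 1 \/ eps = -1
          & is_defining_function U (fun q => eps * s i (cmap (charts i) q))]].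

(* L, the tractor connection and the BGG operator do not depend on the special
   connection of the class; locally such connections always exist (e.g. the
   one preserving the coordinate volume of a chart), so these quantifications
   over all of them, on all open subsets, are not vacuous. *)
Definition is_bgg_solution (P : set (atlas_index M -> tensor3 R n))
    (tau : atlas_index M -> tensor0 R n) : Prop :=
  forall W G, open W -> in_class_on P W G -> is_special W G ->
  forall i x, chart_im i W x -> forall a b c,
    sym3 (nablaS2_bot (G i) (splittingL (G i) (tau i))) x a b c = 0.

Definition is_parallel_L (P : set (atlas_index M -> tensor3 R n))
    (tau : atlas_index M -> tensor0 R n) : Prop :=
  forall W G, open W -> in_class_on P W G -> is_special W G ->
  forall i x, chart_im i W x ->
  [/\ forall a, nablaS2_top (G i) (splittingL (G i) (tau i)) x a = 0,
      forall a b, nablaS2_mid (G i) (splittingL (G i) (tau i)) x a b = 0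
    & forall a b c, nablaS2_bot (G i) (splittingL (G i) (tau i)) x a b c = 0].

Definition is_normal_solution P tau : Prop :=
  is_bgg_solution P tau /\ is_parallel_L P tau.

End Geometry.

Arguments bdry {R n} M.
Arguments inner {R n} M.

(* Main.v *)
Require Import Defs.
From mathcomp Require Import all_boot all_order all_algebra.
From mathcomp Require Import all_classical all_reals all_analysis.
From mathcomp Require Import perm.
From mathcomp Require Import ring lra.
Set Implicit Arguments.
Unset Strict Implicit.
Unset Printing Implicit Defensive.
Import Order.TTheory GRing.Theory Num.Theory.
Import numFieldNormedType.Exports.
Local Open Scope classical_set_scope.
Local Open Scope ring_scope.

(** Write nab = G + th with G in the projective class and smooth up to the boundary.  In the
    splitting of nab the tractor L(tau) is (tau, 0, P tau), which is parallel because tau and Ric are,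
    so in the splitting of G its components solve a linear first order system with coefficients
    smooth up to the boundary, and they extend smoothly.  If the extension of tau were non-zero at a
    boundary point, nab = G - d tau / (2 tau), for G preserving the coordinate volume, would extend
    there.  So tau vanishes on the boundary; as the determinant of the bilinear form L(tau) is a
    non-zero constant, its first row (tau, d tau / 2) cannot vanish, whence d tau is non-zero.
    The identities of the tractor connection pass from the interior to the boundary by continuity. *)

(** * Calculus on relatively open subsets of the half-space *)

Section HalfspaceCalculus.
Context {R : realType} {n : nat}.
Local Notation X := (coord_space R n).
Implicit Types (A B : set X) (f g : tensor0 R n) (x y z : X) (a b c : 'I_n.+1).

(** The difference between [nab] and a representative of the class may a priori behave wildly at the
    boundary, and nothing is assumed about its growth. The tractor turns the problem into finitely
    many unknowns whose derivatives are linear combinations of themselves with coefficients bounded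
    near the boundary; this a priori bound replaces any control of the metric. In each chart the
    representative is normalized to have zero Christoffel trace: the weight terms disappear and a
    density becomes a plain function of the coordinates. The price is chart dependence, so one-forms
    found in one chart are carried over to the others. The order 2 reflects the weight 2 of tau: up
    to a form smooth at the boundary, [nab] differs from the class by - d tau / (2 tau), the term
    that projective compactness of order 2 compensates. The determinant of L(tau) is tau^(n+2) det
    P, that is n^-(n+1) kappa^-2 det Ric; it is constant because the determinant of a parallel
    bilinear form scales like the square of a parallel volume. Partial derivatives are one-sided on
    the boundary face, so the chain rule and the symmetry of second derivatives are established
    relative to the half-space, with steps in positive directions. *)

Definition evec a : X := delta_mx ord0 a.

Lemma evecE a b : evec a ord0 b = (a == b)%:R.
Proof. by rewrite mxE eqxx eq_sym. Qed.

Lemma coord_le_norm x a : `|x ord0 a| <= `|x|.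
Proof.
rewrite [leRHS]/Num.Def.normr/= mx_normrE.
by apply/bigmax_geP; right => /=; exists (ord0, a).
Qed.

Lemma norm_le_coord x (r : R) : 0 <= r -> (forall a, `|x ord0 a| <= r) -> `|x| <= r.
Proof.
move=> r0 H; rewrite [leLHS]/Num.Def.normr/= mx_normrE.
by apply/bigmax_leP; split => // -[i j] _ /=; rewrite (ord1 i).
Qed.

Lemma norm_lt_coord x (r : R) : 0 < r -> (forall a, `|x ord0 a| < r) -> `|x| < r.
Proof.
move=> r0 H; rewrite [ltLHS]/Num.Def.normr/= mx_normrE.
by apply/bigmax_ltP; split => // -[i j] _ /=; rewrite (ord1 i).
Qed.

Lemma norm_scale_evec (h : R) a : `|h *: evec a| = `|h|.
Proof.
apply/eqP; rewrite eq_le; apply/andP; split.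
  apply: norm_le_coord => // b; rewrite mxE evecE.
  by case: (a == b); rewrite ?mulr1 ?mulr0 ?normr0.
by have := coord_le_norm (h *: evec a) a; rewrite mxE evecE eqxx mulr1.
Qed.

Definition relopen A :=
  A `<=` halfspace /\
  forall x, A x -> exists2 r : R, 0 < r & forall y, halfspace y -> `|y - x| < r -> A y.

Definition pdfilter a x : set_system R := within (admissible a x) (0 : R)^'.

Global Instance pdfilter_filter a x : Filter (pdfilter a x).
Proof. exact: within_filter. Qed.

Lemma pdfilterP a x (P : set R) : pdfilter a x P <->
  exists2 d : R, 0 < d & forall h, h != 0 -> `|h| < d -> halfspace (x + h *: evec a) -> P h.
Proof.
split.
  rewrite /pdfilter /within /= => /nbhs_ballP[d d0 H]; exists d => // h h0 hd hh.
  by apply: (H h) => //; rewrite /ball /= sub0r normrN.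
move=> [d d0 H]; apply/nbhs_ballP; exists d => // h.
by rewrite /ball /= sub0r normrN => hd h0 hh; exact: H.
Qed.

Lemma halfspace_step x (h : R) a : halfspace x -> 0 <= h -> halfspace (x + h *: evec a).
Proof.
rewrite /halfspace /= !mxE => hx h0; case: (_ == a); last by rewrite mulr0 addr0.
by rewrite mulr1 addr_ge0.
Qed.

(** Positive increments never leave the half-space, so limits of difference quotients are unique
    even where only one side is available. *)
Lemma pdfilter_proper a x : halfspace x -> ProperFilter (pdfilter a x).
Proof.
move=> hx; split; last exact: pdfilter_filter.
move=> /pdfilterP[d d0 H]; apply: (H (d / 2)).
- by rewrite gt_eqF// divr_gt0.
- by rewrite ger0_norm ?divr_ge0 ?ltW// ltr_pdivrMr// mulr2n mulrDr mulr1 ltrDl.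
- by apply: halfspace_step => //; rewrite divr_ge0// ltW.
Qed.

(** Relational form of [pd], which as a [lim] has an arbitrary value when no limit exists. The rules
    of calculus are proved for this relation and returned to [pd] by [has_pdE]. *)
Definition has_pd a f x (l : R) := dquot a f x @ pdfilter a x --> l.

Lemma has_pdE a f x l : halfspace x -> has_pd a f x l -> pd a f x = l.
Proof.
move=> hx H; have PF := pdfilter_proper a hx.
exact: (@cvg_lim _ _ _ _ PF).
Qed.

Lemma has_pdP a f x l : has_pd a f x l <->
  forall e : R, 0 < e -> exists2 d : R, 0 < d & forall h, `|h| < d ->
    halfspace (x + h *: evec a) -> `|f (x + h *: evec a) - f x - h * l| <= e * `|h|.
Proof.
have key h : h != 0 -> `|f (x + h *: evec a) - f x - h * l| = `|l - dquot a f x h| * `|h|.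
  move=> h0; rewrite -normrM -[in LHS]normrN opprB mulrBl /dquot -/(evec a); congr `|_|.
  by field.
rewrite /has_pd; split.
  move=> /cvgrPdist_le H e e0.
  have /pdfilterP[d d0 Hd] := H e e0; exists d => // h hd hh.
  have [->|h0] := eqVneq h 0.
    by rewrite scale0r addr0 subrr mul0r subr0 normr0 mulr0.
  by rewrite key//; apply: ler_wpM2r => //; exact: Hd.
move=> H; apply/cvgrPdist_le => e e0; have [d d0 Hd] := H e e0.
apply/pdfilterP; exists d => // h h0 hd hh.
by have := Hd h hd hh; rewrite key// ler_pM2r// normr_gt0.
Qed.

Lemma has_pd_cst a x (k : R) : has_pd a (fun=> k) x 0.
Proof.
apply/has_pdP => e e0; exists 1 => // h _ _.
by rewrite subrr mulr0 subr0 normr0 mulr_ge0// ltW.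
Qed.

Lemma has_pdD a f g x l m : has_pd a f x l -> has_pd a g x m ->
  has_pd a (fun y => f y + g y) x (l + m).
Proof.
rewrite /has_pd => Hf Hg.
have -> : dquot a (fun y => f y + g y) x = (dquot a f x \+ dquot a g x).
  by apply/funext => h; rewrite /dquot /= -mulrDr; congr (_ * _); ring.
exact: cvgD.
Qed.

Lemma has_pd_cvg a f x l : has_pd a f x l -> f (x + h *: evec a) @[h --> pdfilter a x] --> f x.
Proof.
move=> /has_pdP H; apply/cvgrPdist_le => e e0.
have [d d0 Hd] := H 1 ltr01.
have K : 0 < 1 + `|l| by rewrite ltr_pwDl.
apply/pdfilterP; exists (Num.min d (e / (1 + `|l|))).
  by rewrite lt_min d0 divr_gt0.
move=> h h0; rewrite lt_min => /andP[hd he] hh; have := Hd h hd hh; rewrite mul1r => {}Hd.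
rewrite distrC.
have -> : f (x + h *: evec a) - f x = (f (x + h *: evec a) - f x - h * l) + h * l by ring.
apply: (le_trans (ler_normD _ _)); rewrite normrM.
apply: (@le_trans _ _ (`|h| * (1 + `|l|))); first by rewrite mulrDr mulr1 lerD2r.
by rewrite -ler_pdivlMr// ltW.
Qed.

Lemma has_pdM a f g x l m : has_pd a f x l -> has_pd a g x m ->
  has_pd a (fun y => f y * g y) x (l * g x + f x * m).
Proof.
move=> Hf Hg; have cg := has_pd_cvg Hg; rewrite /has_pd.
have -> : dquot a (fun y => f y * g y) x =
    (fun h => dquot a f x h * g (x + h *: evec a) + f x * dquot a g x h).
  by apply/funext => h; rewrite /dquot /= -/(evec a); ring.
by apply: cvgD; apply: cvgM => //; exact: cvg_cst.
Qed.

Lemma has_pdZ a f x l (k : R) : has_pd a f x l -> has_pd a (fun y => k * f y) x (k * l).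
Proof. by move=> H; have := has_pdM (has_pd_cst a x k) H; rewrite mul0r add0r. Qed.

Lemma has_pdN a f x l : has_pd a f x l -> has_pd a (fun y => - f y) x (- l).
Proof.
move=> /(has_pdZ (k := -1)); rewrite mulN1r.
by congr has_pd; apply/funext => y; rewrite mulN1r.
Qed.

Lemma has_pdB a f g x l m : has_pd a f x l -> has_pd a g x m ->
  has_pd a (fun y => f y - g y) x (l - m).
Proof. by move=> Hf /has_pdN Hg; exact: has_pdD. Qed.

Lemma has_pd_sum (I : Type) (s : seq I) (P : pred I) a (F : I -> tensor0 R n) x (l : I -> R) :
  (forall i, P i -> has_pd a (F i) x (l i)) ->
  has_pd a (fun y => \sum_(i <- s | P i) F i y) x (\sum_(i <- s | P i) l i).
Proof.
move=> H; elim: s => [|i s IH].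
  rewrite big_nil; have := has_pd_cst a x 0; congr has_pd.
  by apply/funext => y; rewrite big_nil.
have [Pi|nPi] := boolP (P i).
  have := has_pdD (H i Pi) IH; rewrite big_cons Pi; congr has_pd.
  by apply/funext => y; rewrite big_cons Pi.
move: IH; rewrite big_cons (negPf nPi); congr has_pd.
by apply/funext => y; rewrite big_cons (negPf nPi).
Qed.

(** Caratheodory's form of the derivative avoids division by an increment of [f], which may
    vanish. *)
Lemma has_pd_comp1 (H : R -> R) (dH : R) a f x l :
  is_derive (f x) 1 H dH -> has_pd a f x l -> has_pd a (fun y => H (f y)) x (dH * l).
Proof.
move=> /is_derive1_caratheodory[g [Hg cg <-]] Hf; rewrite /has_pd.
have -> : dquot a (fun y => H (f y)) x =
    (fun h => g (f (x + h *: evec a)) * dquot a f x h).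
  by apply/funext => h; rewrite /dquot /= -/(evec a) Hg; ring.
apply: cvgM => //.
exact: (cvg_comp _ _ (has_pd_cvg Hf) cg).
Qed.

Lemma has_pd_local A a f g x l : relopen A -> A x -> (forall y, A y -> f y = g y) ->
  has_pd a f x l -> has_pd a g x l.
Proof.
move=> [_ oA] Ax fg /has_pdP H; apply/has_pdP => e e0.
have [d d0 Hd] := H e e0; have [r r0 Hr] := oA x Ax.
exists (Num.min d r); first by rewrite lt_min d0.
move=> h; rewrite lt_min => /andP[hd hr] hh.
rewrite -!fg//; first exact: Hd.
by apply: Hr => //; rewrite addrC addKr norm_scale_evec.
Qed.

(** The difference quotients agree for small increments, so they have the same image filter, and
    [lim] of it is the same whether or not the limit exists. *)
Lemma pd_local A a f g x : relopen A -> A x -> (forall y, A y -> f y = g y) ->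
  pd a f x = pd a g x.
Proof.
move=> oA Ax fg; have [[_ oA'] hx] := (oA, (proj1 oA) x Ax).
have [r r0 Hr] := oA' x Ax.
have E h : `|h| < r -> halfspace (x + h *: evec a) -> dquot a f x h = dquot a g x h.
  move=> hr hh; rewrite /dquot -/(evec a) !fg//.
  by apply: Hr => //; rewrite addrC addKr norm_scale_evec.
rewrite /pd; congr (lim _); rewrite eqEsubset; split => P /=;
  move=> /pdfilterP[d d0 Hd]; apply/pdfilterP; exists (Num.min d r); rewrite ?lt_min ?d0//;
  move=> h h0; rewrite lt_min => /andP[hd hr] hh; [rewrite /= -E//|rewrite /= E//]; exact: Hd.
Qed.

(** * Continuity, mean values and the chain rule relative to the half-space *)

Definition cont_on A f := forall x, A x -> forall e : R, 0 < e ->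
  exists2 d : R, 0 < d & forall y, A y -> `|y - x| < d -> `|f y - f x| <= e.

Lemma cont_onP A f : {within A, continuous f} <-> cont_on A f.
Proof.
rewrite (@subspace_continuousP _ A); split => H x Ax.
  move=> e e0; have /cvgrPdist_le/(_ e e0) := H x Ax.
  rewrite near_withinE => /nbhs_ballP[d /= d0 Hd]; exists d => // y Ay yx.
  by rewrite distrC; apply: Hd => //; rewrite -ball_normE /ball_ /= distrC.
apply/cvgrPdist_le => e e0; have [d d0 Hd] := H x Ax e e0.
rewrite near_withinE; apply/nbhs_ballP; exists d => //= y.
by rewrite -ball_normE /ball_ /= distrC => yx Ay; rewrite distrC; exact: Hd.
Qed.


(** Bridge to the derivative of one real variable. That derivative is two-sided, so the direction
    must be tangent to the boundary face or the point must lie off the face. *)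
Lemma has_pd_derive a f x (h t l : R) : halfspace (x + (t * h) *: evec a) -> (a != ord0 \/ 0 < (x + (t * h) *: evec a) ord0 ord0) ->
  has_pd a f (x + (t * h) *: evec a) l ->
  is_derive t 1 (fun s => f (x + (s * h) *: evec a)) (h * l).
Proof.
move=> hx adm /has_pdP H.
suff C : (fun s : R => s^-1 *: (f (x + ((s *: 1 + t) * h) *: evec a) - f (x + (t * h) *: evec a)))
     @ 0^' --> h * l.
  by apply: DeriveDef; [exact: cvgP C|exact: cvg_lim C].
apply/cvgrPdist_le => e e0.
have K : 0 < 1 + `|h| by rewrite ltr_pwDl.
have [d d0 Hd] := H (e / (1 + `|h|)) (divr_gt0 e0 K).
(* Tangential increments do not change the 0-th coordinate; in the normal direction the distance to
   the face bounds the admissible ones. *)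
have [d' d'0 adm'] : exists2 d' : R, 0 < d' & forall v : R, `|v| < d' ->
    halfspace (x + (t * h) *: evec a + v *: evec a).
  case: adm => [a0|x0].
    exists 1 => // v _; rewrite /halfspace /= mxE [X in _ + X]mxE evecE (negPf a0) mulr0 addr0.
    exact: hx.
  exists ((x + (t * h) *: evec a) ord0 ord0) => // v vd.
  rewrite /halfspace /= mxE [X in _ + X]mxE evecE.
  case: (a == ord0); rewrite ?mulr1 ?mulr0 ?addr0; last exact: ltW.
  have : - v <= `|v| by rewrite -normrN ler_norm.
  by move=> ?; lra.
apply/nbhs_ballP; exists (Num.min d d' / (1 + `|h|)) => /=; first by rewrite divr_gt0// lt_min d0.
move=> s; rewrite /ball /= sub0r normrN => sd s0.
have shd : `|s * h| < Num.min d d'.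
  move: sd; rewrite ltr_pdivlMr// => sd; apply: le_lt_trans sd; rewrite normrM.
  by rewrite ler_wpM2l// lerDr.
move: shd; rewrite lt_min => /andP[s1 s2].
have := Hd _ s1 (adm' _ s2).
have -> : x + (t * h) *: evec a + (s * h) *: evec a = x + ((s *: 1 + t) * h) *: evec a.
  by rewrite -addrA -scalerDl; congr (_ + _ *: _); rewrite /GRing.scale /=; ring.
set u := f _ - f _ => Hu.
have -> : h * l - s^-1 *: u = - (s^-1 * (u - s * h * l)) by rewrite /GRing.scale /=; field.
rewrite normrN normrM normfV ler_pdivrMl ?normr_gt0//; apply: (le_trans Hu).
rewrite normrM mulrCA ler_wpM2l// -mulrA ger_pMr// mulrC ler_pdivrMr// mul1r lerDr//.
Qed.


Lemma cont_on_sub A B f : B `<=` A -> cont_on A f -> cont_on B f.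
Proof.
move=> BA H x Bx e e0; have [d d0 Hd] := H x (BA _ Bx) e e0.
by exists d => // y By; apply: Hd; exact: BA.
Qed.

(** The step [h] may have either sign. Derivatives are used only at inner points of the segment,
    which may touch the face at its ends. *)
Lemma pd_MVT A a f g x (h : R) : A `<=` halfspace -> cont_on A f ->
  (forall t : R, 0 <= t <= 1 -> A (x + (t * h) *: evec a)) ->
  (forall t : R, 0 < t < 1 -> has_pd a f (x + (t * h) *: evec a) (g (x + (t * h) *: evec a))) ->
  exists2 t : R, 0 < t < 1 & f (x + h *: evec a) - f x = h * g (x + (t * h) *: evec a).
Proof.
move=> Ah cf Aseg df.
have [->|h0] := eqVneq h 0.
  exists 2^-1; first by apply/andP; split; lra.
  by rewrite scale0r addr0 subrr mul0r.
have D (t : R) : t \in `]0, 1[%R -> is_derive t 1 (fun s => f (x + (s * h) *: evec a))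
    (h * g (x + (t * h) *: evec a)).
  rewrite in_itv /= => /andP[t0 t1].
  apply: has_pd_derive; [by apply/Ah/Aseg; rewrite !ltW| |by apply: df; rewrite t0].
  (* In the normal direction both ends have non-negative 0-th coordinate and differ, so this
     coordinate is positive strictly between them. *)
  have [Ea|] := eqVneq a ord0; [right|by left].
  rewrite mxE [X in _ + X]mxE evecE Ea eqxx mulr1.
  have := Ah _ (Aseg 0 _); have := Ah _ (Aseg 1 _).
  rewrite !lexx !ler01 /halfspace /= => /(_ isT) + /(_ isT).
  rewrite mxE [X in _ + X]mxE evecE mul0r scale0r addr0 mul1r Ea eqxx.
  rewrite mulr1 => xh x0.
  have [x0p|] := boolP (0 < x ord0 ord0); first by nra.
  rewrite -leNgt => x0n; have E : x ord0 ord0 = 0 by apply/le_anti; rewrite x0n x0.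
  rewrite E add0r in xh; rewrite E add0r mulr_gt0// lt_neqAle eq_sym h0; exact: xh.
have C : {within `[(0:R), 1], continuous (fun s => f (x + (s * h) *: evec a))}.
  apply/(@subspace_continuousP _ `[(0:R), 1]) => t.
  rewrite /= in_itv /= => t01.
  apply/cvgrPdist_le => e e0; have [d d0 Hd] := cf _ (Aseg t t01) e e0.
  rewrite near_withinE; apply/nbhs_ballP; exists (d / `|h|) => /=.
    by rewrite divr_gt0// normr_gt0.
  move=> s; rewrite /ball /= in_itv /= => ts s01; rewrite distrC; apply: Hd; first exact: Aseg.
  rewrite opprD addrACA subrr add0r -scalerBl -mulrBl norm_scale_evec normrM.
  by rewrite -ltr_pdivlMr ?normr_gt0// distrC.
have [t + E] := MVT ltr01 D C.
rewrite in_itv /= => t01; exists t => //.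
by move: E; rewrite mul1r mul0r scale0r addr0 subr0 mulr1.
Qed.

(* Coordinatewise convexity, so that a path along the axes between two points of [Q] stays in [Q]. *)
Definition boxy (Q : set X) := forall x y z, Q x -> Q y ->
  (forall b, exists2 t : R, 0 <= t <= 1 & z ord0 b = x ord0 b + t * (y ord0 b - x ord0 b)) -> Q z.

Definition mix x y (j : nat) : X := \row_i (if (i < j)%N then y ord0 i else x ord0 i).

(** The path from [x] to [y] through the vertices [mix x y j] changes one coordinate at a time; the
    mean value theorem holds on each edge and the increments telescope. *)
Lemma boxy_incr (Q : set X) f (g : 'I_n.+1 -> tensor0 R n) x y : Q `<=` halfspace -> boxy Q ->
  cont_on Q f -> (forall a z, Q z -> has_pd a f z (g a z)) -> Q x -> Q y ->
  exists2 xi : 'I_n.+1 -> X, (forall a, Q (xi a)) &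
    f y - f x = \sum_a (y ord0 a - x ord0 a) * g a (xi a).
Proof.
move=> Qh bQ cf df Qx Qy.
have mix0 : mix x y 0 = x by apply/rowP => i; rewrite mxE ltn0.
have mixn : mix x y n.+1 = y by apply/rowP => i; rewrite mxE ltn_ord.
have mixS (a : 'I_n.+1) : mix x y a.+1 = mix x y a + (y ord0 a - x ord0 a) *: evec a.
  apply/rowP => i; rewrite !mxE ltnS leq_eqVlt eqxx /=.
  have [->|ne] := eqVneq i a; first by rewrite eqxx ltnn /= mulr1 addrCA subrr addr0.
  by rewrite (negPf (_ : nat_of_ord i != a))//= mulr0 addr0.
have Qs (a : 'I_n.+1) (t : R) : 0 <= t <= 1 ->
    Q (mix x y a + (t * (y ord0 a - x ord0 a)) *: evec a).
  move=> t01; apply: (bQ x y) => // b; rewrite !mxE eqxx /=.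
  have [->|ne] := eqVneq b a; first by exists t => //; rewrite ltnn /= mulr1.
  rewrite mulr0 addr0; case: ifP => _.
    by exists 1; rewrite ?lexx ?ler01// mul1r addrCA subrr addr0.
  by exists 0; rewrite ?lexx ?ler01// mul0r addr0.
have M (a : 'I_n.+1) : exists z, Q z /\
    f (mix x y a.+1) - f (mix x y a) = (y ord0 a - x ord0 a) * g a z.
  have [t t01 E] := @pd_MVT Q a f (g a) _ _ Qh cf (Qs a)
    (fun t t01 => df a _ (Qs a t (introT andP (conj (ltW (proj1 (andP t01))) (ltW (proj2 (andP t01))))))).
  exists (mix x y a + (t * (y ord0 a - x ord0 a)) *: evec a); rewrite mixS E; split => //.
  by apply: Qs; case/andP: t01 => ? ?; rewrite !ltW.
have /choice[xi Hxi] := M.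
exists xi => [a|]; first by case: (Hxi a).
rewrite -[in LHS]mixn -[in X in _ - X]mix0 -(@telescope_sumr _ 0 n.+1 (fun j => f (mix x y j)))//.
by rewrite big_mkord; apply: eq_bigr => a _; case: (Hxi a).
Qed.

Definition hball x (r : R) : set X := [set y | halfspace y /\ `|y - x| < r].

(** The norm of row vectors is the maximum norm, so balls are coordinate boxes. *)
Lemma boxy_hball x (r : R) : boxy (hball x r).
Proof.
move=> u v z [hu ur] [hv vr] H; split.
  rewrite /halfspace /=; have [t /andP[t0 t1] ->] := H ord0.
  by rewrite /halfspace /= in hu hv; nra.
have r0 : 0 < r by apply: le_lt_trans ur.
apply: norm_lt_coord => // b; rewrite !mxE; have [t /andP[t0 t1] ->] := H b.
have := le_lt_trans (coord_le_norm _ b) ur; have := le_lt_trans (coord_le_norm _ b) vr.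
rewrite !mxE !ltr_norml => /andP[? ?] /andP[? ?].
have [->|tn] := eqVneq t 0; first by rewrite mul0r addr0; apply/andP.
have tp : 0 < t by rewrite lt_neqAle eq_sym tn.
have : 0 <= 1 - t by rewrite subr_ge0.
by move=> ?; apply/andP; split; nra.
Qed.

Lemma boxy_hball_pos x (r : R) : boxy (hball x r `&` [set y | 0 < y ord0 ord0]).
Proof.
move=> u v z [Qu u0] [Qv v0] H; split; first exact: boxy_hball H.
rewrite /=; have [t /andP[t0 t1] ->] := H ord0.
by rewrite /= in u0 v0; nra.
Qed.

Lemma boxy_lipschitz (Q : set X) f (g : 'I_n.+1 -> tensor0 R n) (L : R) :
  Q `<=` halfspace -> boxy Q -> cont_on Q f -> (forall a z, Q z -> has_pd a f z (g a z)) ->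
  (forall a z, Q z -> `|g a z| <= L) ->
  forall x y, Q x -> Q y -> `|f y - f x| <= n.+1%:R * L * `|y - x|.
Proof.
move=> Qh bQ cf df gL x y Qx Qy; have [xi Qxi ->] := boxy_incr Qh bQ cf df Qx Qy.
apply: (le_trans (ler_norm_sum _ _ _)).
apply: (@le_trans _ _ (\sum_(a < n.+1) L * `|y - x|)); last first.
  by rewrite sumr_const card_ord -[leLHS]mulr_natl mulrA.
apply: ler_sum => a _; rewrite normrM mulrC; apply: ler_pM => //; first exact: gL.
by have := coord_le_norm (y - x) a; rewrite !mxE.
Qed.

(** Continuous partial derivatives give Frechet differentiability, at boundary points too: in a
    small half-ball all the intermediate points of [boxy_incr] are close to [x]. *)
Lemma has_pd_frechet A f (g : 'I_n.+1 -> tensor0 R n) x : relopen A -> A x ->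
  cont_on A f -> (forall a z, A z -> has_pd a f z (g a z)) -> (forall a, cont_on A (g a)) ->
  forall e : R, 0 < e -> exists2 d : R, 0 < d & forall y, halfspace y -> `|y - x| < d ->
    `|f y - f x - \sum_a (y ord0 a - x ord0 a) * g a x| <= e * `|y - x|.
Proof.
move=> [Ah oA] Ax cf df cg e e0.
have [r r0 Hr] := oA x Ax.
have e'0 : 0 < e / n.+1%:R by rewrite divr_gt0.
have : forall a, exists d : R, 0 < d /\ forall y, A y -> `|y - x| < d -> `|g a y - g a x| <= e / n.+1%:R.
  by move=> a; have [d d0 Hd] := cg a x Ax _ e'0; exists d.
move=> /choice[dd Hdd].
pose d := \big[Num.min/r]_a dd a.
have d0 : 0 < d by apply: lt_bigmin => // a _; case: (Hdd a).
exists d => // y hy yd.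
have QA : hball x d `<=` A.
  by move=> z [hz zd]; apply: Hr => //; apply: lt_le_trans zd _; exact: bigmin_le_id.
have hx := Ah _ Ax.
have Qx : hball x d x by split=> //; rewrite subrr normr0.
have [xi Qxi ->] := @boxy_incr (hball x d) f g x y (fun z Hz => proj1 Hz) (@boxy_hball x d)
   (cont_on_sub QA cf) (fun a z Qz => df a z (QA _ Qz)) Qx (conj hy yd).
rewrite -sumrB; apply: (le_trans (ler_norm_sum _ _ _)).
apply: (@le_trans _ _ (\sum_(a < n.+1) e / n.+1%:R * `|y - x|)); last first.
  by rewrite sumr_const card_ord -[leLHS]mulr_natl mulrA mulrCA divff ?pnatr_eq0// mulr1.
apply: ler_sum => a _; rewrite -mulrBr normrM mulrC; apply: ler_pM => //.
  have [_ Ha] := Hdd a; apply: Ha; first exact: QA.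
  by apply: lt_le_trans (proj2 (Qxi a)) _; exact: bigmin_le_cond.
by have := coord_le_norm (y - x) a; rewrite !mxE.
Qed.

(** The image under [phi] of an axis-parallel step is a general displacement, so the Frechet
    estimate for [f] is needed. That estimate covers only half-space points, hence the condition
    that [phi] keep nearby points in the half-space. *)
Lemma has_pd_comp A f (g : 'I_n.+1 -> tensor0 R n) (phi : X -> X) a x (l : 'I_n.+1 -> R) :
  relopen A -> A (phi x) -> cont_on A f -> (forall b z, A z -> has_pd b f z (g b z)) ->
  (forall b, cont_on A (g b)) -> halfspace x ->
  (exists2 r : R, 0 < r & forall h, `|h| < r -> halfspace (x + h *: evec a) ->
     halfspace (phi (x + h *: evec a))) ->
  (forall b, has_pd a (fun y => phi y ord0 b) x (l b)) ->
  has_pd a (fun y => f (phi y)) x (\sum_b l b * g b (phi x)).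
Proof.
move=> oA Aphi cf df cg hx [r r0 Hr] dphi.
have PF := pdfilter_proper a hx.
pose L := \sum_b `|l b|.
have L0 : 0 <= L by apply: sumr_ge0.
have near1 (e : R) : 0 < e -> \forall h \near pdfilter a x, forall b,
    `|phi (x + h *: evec a) ord0 b - phi x ord0 b - h * l b| <= e * `|h|.
  move=> e0; apply: filter_forall => b; apply/pdfilterP.
  have /has_pdP/(_ e e0)[d d0 Hd] := dphi b; exists d => // h _ hd hh; exact: Hd.
apply/has_pdP => e e0.
(* Half of the error goes to the remainder of [f], scaled by the growth [L + 1] of [phi], and half
   to the errors of [phi], weighted by the gradient of [f]. The added 1 keeps both denominators
   positive. *)
have K : 0 < 2 * (L + 1) by rewrite mulr_gt0// ltr_wpDl.
have K2 : 0 < 2 * (\sum_b `|g b (phi x)| + 1) by rewrite mulr_gt0// ltr_wpDl// sumr_ge0.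
have [d d0 Hd] := has_pd_frechet oA Aphi cf df cg (divr_gt0 e0 K).
have /pdfilterP[d1 d10 Hd1] := near1 _ (divr_gt0 e0 K2).
have /pdfilterP[d2 d20 Hd2] := near1 1 ltr01.
exists (Num.min (Num.min d1 d2) (Num.min r (d / (L + 1)))).
  by rewrite !lt_min d10 d20 r0 divr_gt0// ltr_wpDl.
move=> h; rewrite !lt_min => /andP[/andP[h1 h2] /andP[hr hd]] hh.
have [->|h0] := eqVneq h 0; first by rewrite scale0r addr0 subrr mul0r subr0 !normr0 mulr0.
have {}Hd1 := Hd1 h h0 h1 hh; have {}Hd2 := Hd2 h h0 h2 hh.
set y := phi (x + h *: evec a).
have yn : `|y - phi x| <= (L + 1) * `|h|.
  apply: norm_le_coord => [|b]; first by rewrite mulr_ge0// addr_ge0.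
  rewrite !mxE.
  have -> : y ord0 b - phi x ord0 b = (y ord0 b - phi x ord0 b - h * l b) + h * l b by ring.
  apply: (le_trans (ler_normD _ _)); rewrite mulrDl addrC; apply: lerD; last exact: Hd2.
  rewrite normrM mulrC ler_wpM2r// /L (bigD1 b)//= lerDl; exact: sumr_ge0.
have yd : `|y - phi x| < d.
  by apply: le_lt_trans yn _; rewrite mulrC -ltr_pdivlMr// ltr_wpDl.
have {}Hd := Hd y (Hr h hr hh) yd.
have -> : f y - f (phi x) - h * \sum_b l b * g b (phi x) =
    (f y - f (phi x) - \sum_b (y ord0 b - phi x ord0 b) * g b (phi x)) +
    \sum_b (y ord0 b - phi x ord0 b - h * l b) * g b (phi x).
  have -> : \sum_b (y ord0 b - phi x ord0 b - h * l b) * g b (phi x) =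
    \sum_b (y ord0 b - phi x ord0 b) * g b (phi x) - h * \sum_b l b * g b (phi x).
    by rewrite mulr_sumr -sumrB; apply: eq_bigr => b _; ring.
  by ring.
apply: (le_trans (ler_normD _ _)).
have -> : e * `|h| = e / 2 * `|h| + e / 2 * `|h| by rewrite -mulrDl; congr (_ * _); field.
apply: lerD.
  apply: (le_trans Hd); apply: (le_trans (ler_wpM2l _ yn)); first by rewrite divr_ge0// ltW.
  rewrite mulrA ler_wpM2r// le_eqVlt; apply/orP; left; apply/eqP; field.
  by rewrite gt_eqF// ltr_wpDl.
apply: (le_trans (ler_norm_sum _ _ _)).
apply: (@le_trans _ _ (\sum_b e / (2 * (\sum_b `|g b (phi x)| + 1)) * `|h| * `|g b (phi x)|)).
  by apply: ler_sum => b _; rewrite normrM ler_wpM2r//; exact: Hd1.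
rewrite -mulr_sumr; set S := \sum_b _; have S0 : 0 <= S by exact: sumr_ge0.
rewrite mulrAC ler_wpM2r//.
have -> : e / (2 * (S + 1)) * S = e / 2 * (S / (S + 1)) by field; rewrite gt_eqF// ltr_wpDl.
rewrite ler_piMr//; first by rewrite divr_ge0// ltW.
by rewrite ler_pdivrMr ?ltr_wpDl// mul1r lerDl.
Qed.


Lemma cont_on_comp A B f (phi : X -> X) : (forall x, A x -> B (phi x)) -> cont_on B f ->
  (forall b, cont_on A (fun x => phi x ord0 b)) -> cont_on A (fun x => f (phi x)).
Proof.
move=> AB cf cphi x Ax e e0; have [d d0 Hd] := cf _ (AB _ Ax) e e0.
have d20 : 0 < d / 2 by rewrite divr_gt0.
have : forall b, exists r : R, 0 < r /\
    forall y, A y -> `|y - x| < r -> `|phi y ord0 b - phi x ord0 b| <= d / 2.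
  by move=> b; have [r r0 Hr] := cphi b x Ax _ d20; exists r.
move=> /choice[r Hr]; exists (\big[Num.min/1]_b r b).
  by apply: lt_bigmin => // b _; case: (Hr b).
move=> y Ay yx; apply: Hd; first exact: AB.
apply: (@le_lt_trans _ _ (d / 2)); last by rewrite ltr_pdivrMr// mulr2n mulrDr mulr1 ltrDl.
apply: norm_le_coord => [|b]; first exact: ltW.
rewrite !mxE; apply: (proj2 (Hr b)) => //.
by apply: lt_le_trans yx _; exact: bigmin_le_cond.
Qed.

(** * Functions of class C^k up to the boundary *)

Lemma Ck_cont k A f : Ck k A f -> cont_on A f.
Proof. by case: k => [|k] [/cont_onP]. Qed.

Lemma Ck_has_pd k A f a x : Ck k.+1 A f -> A x -> has_pd a f x (pd a f x).
Proof. by move=> [_ /(_ a)[H _]] Ax; exact: H. Qed.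

Lemma Ck_pd k A f a : Ck k.+1 A f -> Ck k A (pd a f).
Proof. by move=> [_ /(_ a)[_]]. Qed.

Lemma CkS k A f : Ck k.+1 A f -> Ck k A f.
Proof.
elim: k f => [|k IH] f; first by case.
move=> [cf H]; split=> // a; have [H1 H2] := H a; split=> //; exact: IH.
Qed.

Lemma Ck_eq k A f g : relopen A -> (forall y, A y -> f y = g y) -> Ck k A f -> Ck k A g.
Proof.
move=> oA; have oA' := proj1 oA; elim: k f g => [|k IH] f g fg H.
  split=> //; apply/cont_onP => x Ax e e0; have [d d0 Hd] := Ck_cont H Ax e0.
  by exists d => // y Ay; rewrite -!fg//; exact: Hd.
split.
  apply/cont_onP => x Ax e e0; have [d d0 Hd] := Ck_cont H Ax e0.
  by exists d => // y Ay; rewrite -!fg//; exact: Hd.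
move=> a; split => [x Ax|].
  have K := has_pd_local oA Ax fg (Ck_has_pd (a := a) H Ax).
  by have := K; rewrite -(has_pdE (oA' _ Ax) K).
by apply: (IH (pd a f)); [move=> y Ay; exact: pd_local oA Ay fg|exact: Ck_pd].
Qed.

(** Raises the class by one from explicit formulas for the partial derivatives; the closure
    properties below are inductions on [k] by means of such formulas. *)
Lemma Ck_build k A f (g : 'I_n.+1 -> tensor0 R n) : relopen A -> cont_on A f ->
  (forall a x, A x -> has_pd a f x (g a x)) -> (forall a, Ck k A (g a)) -> Ck k.+1 A f.
Proof.
move=> oA cf df cg; have oA' := proj1 oA; split; first exact/cont_onP.
move=> a; split => [x Ax|].
  by have := df a x Ax; rewrite /has_pd -{1}(has_pdE (oA' _ Ax) (df a x Ax)).
by apply: Ck_eq (cg a) => // y Ay; rewrite (has_pdE (oA' _ Ay) (df a y Ay)).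
Qed.

Lemma cont_onF A f : cont_on A f <-> forall x, A x -> f y @[y --> within A (nbhs x)] --> f x.
Proof. by rewrite -cont_onP (@subspace_continuousP _ A). Qed.

Lemma cont_on_cst A (c : R) : cont_on A (fun=> c).
Proof. by move=> x _ e e0; exists 1 => // y _ _; rewrite subrr normr0 ltW. Qed.

Lemma cont_onD A f g : cont_on A f -> cont_on A g -> cont_on A (fun x => f x + g x).
Proof. by move=> /cont_onF H /cont_onF K; apply/cont_onF => x Ax; apply: cvgD; auto. Qed.

Lemma cont_onM A f g : cont_on A f -> cont_on A g -> cont_on A (fun x => f x * g x).
Proof. by move=> /cont_onF H /cont_onF K; apply/cont_onF => x Ax; apply: cvgM; auto. Qed.

Lemma cont_on_comp1 A f (H : R -> R) : (forall x, A x -> {for f x, continuous H}) ->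
  cont_on A f -> cont_on A (fun x => H (f x)).
Proof.
move=> cH /cont_onF K; apply/cont_onF => x Ax.
exact: (cvg_comp _ _ (K x Ax) (cH x Ax)).
Qed.

Lemma Ck_cst k A (c : R) : relopen A -> Ck k A (fun=> c).
Proof.
move=> oA; elim: k c => [|k IH] c; first by split=> //; apply/cont_onP; exact: cont_on_cst.
apply: (@Ck_build k A _ (fun _ _ => 0)) => //; first exact: cont_on_cst.
by move=> a x _; exact: has_pd_cst.
Qed.

Lemma CkD k A f g : relopen A -> Ck k A f -> Ck k A g -> Ck k A (fun x => f x + g x).
Proof.
move=> oA; elim: k f g => [|k IH] f g Hf Hg.
  by split=> //; apply/cont_onP; apply: cont_onD; exact: (@Ck_cont 0).
apply: (@Ck_build k A _ (fun a x => pd a f x + pd a g x)) => //.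
- by apply: cont_onD; exact: (@Ck_cont k.+1).
- by move=> a x Ax; apply: has_pdD; apply: Ck_has_pd; eassumption.
- by move=> a; apply: IH; exact: Ck_pd.
Qed.

Lemma CkM k A f g : relopen A -> Ck k A f -> Ck k A g -> Ck k A (fun x => f x * g x).
Proof.
move=> oA; elim: k f g => [|k IH] f g Hf Hg.
  by split=> //; apply/cont_onP; apply: cont_onM; exact: (@Ck_cont 0).
apply: (@Ck_build k A _ (fun a x => pd a f x * g x + f x * pd a g x)) => //.
- by apply: cont_onM; exact: (@Ck_cont k.+1).
- by move=> a x Ax; apply: has_pdM; apply: Ck_has_pd; eassumption.
- by move=> a; apply: CkD => //; apply: IH; (try exact: Ck_pd); exact: CkS.
Qed.

Lemma Ck_powR k A f (p : R) : relopen A -> (forall x, A x -> 0 < f x) ->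
  Ck k A f -> Ck k A (fun x => f x `^ p).
Proof.
move=> oA f0; elim: k p f f0 => [|k IH] p f f0 Hf.
  split=> //; apply/cont_onP; refine (@cont_on_comp1 A f (fun t => t `^ p) _ (Ck_cont Hf)).
  move=> x Ax; apply: differentiable_continuous; apply/derivable1_diffP.
  by have [] := is_derive1_powR p (f0 x Ax).
apply: (@Ck_build k A _ (fun a x => p * f x `^ (p - 1) * pd a f x)) => //.
- apply: (@cont_on_comp1 A f (fun t => t `^ p)); last exact: (@Ck_cont k.+1).
  move=> x Ax; apply: differentiable_continuous; apply/derivable1_diffP.
  by have [] := is_derive1_powR p (f0 x Ax).
- move=> a x Ax; apply: (@has_pd_comp1 (fun t => t `^ p)); last by apply: Ck_has_pd; eassumption.
  exact/is_derive1_powR/f0.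
- move=> a; apply: CkM => //; last exact: Ck_pd.
  apply: CkM => //; first exact: Ck_cst.
  by apply: IH => //; exact: CkS.
Qed.

Lemma Ck_sum k A (I : Type) (s : seq I) (P : pred I) (F : I -> tensor0 R n) : relopen A ->
  (forall i, P i -> Ck k A (F i)) -> Ck k A (fun x => \sum_(i <- s | P i) F i x).
Proof.
move=> oA H; elim: s => [|i s IH].
  by apply: Ck_eq (Ck_cst k 0 oA) => // y _; rewrite big_nil.
have [Pi|nPi] := boolP (P i).
  by apply: Ck_eq (CkD oA (H i Pi) IH) => // y _; rewrite big_cons Pi.
by apply: Ck_eq IH => // y _; rewrite big_cons (negPf nPi).
Qed.

Lemma Ck_comp k A B f (phi : X -> X) : relopen A -> relopen B -> (forall x, A x -> B (phi x)) ->
  Ck k B f -> (forall b, Ck k A (fun x => phi x ord0 b)) -> Ck k A (fun x => f (phi x)).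
Proof.
move=> oA oB AB; elim: k f => [|k IH] f Hf Hphi.
  split=> //; apply/cont_onP; apply: (@cont_on_comp A B) => //; first exact: (@Ck_cont 0).
  by move=> b; exact: (@Ck_cont 0).
apply: (@Ck_build k A _ (fun a x => \sum_b pd a (fun y => phi y ord0 b) x * pd b f (phi x))) => //.
- apply: (@cont_on_comp A B) => //; first exact: (@Ck_cont k.+1).
  by move=> b; exact: (@Ck_cont k.+1).
- move=> a x Ax; apply: (@has_pd_comp B _ (fun b => pd b f)) => //; first exact: AB.
  + exact: (@Ck_cont k.+1).
  + by move=> b z Bz; apply: Ck_has_pd; eassumption.
  + by move=> b; apply: (@Ck_cont k); exact: Ck_pd.
  + exact: (proj1 oA).
  + have [r r0 Hr] := proj2 oA x Ax; exists r => // h hr hh.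
    by apply: (proj1 oB); apply: AB; apply: Hr => //; rewrite addrC addKr norm_scale_evec.
  + by move=> b; apply: Ck_has_pd; eauto.
- move=> a; apply: Ck_sum => // b _; apply: CkM => //; first exact: (Ck_pd a (Hphi b)).
  by apply: IH; [exact: Ck_pd|move=> c; exact: CkS].
Qed.

Lemma Ck_local k A f : A `<=` halfspace ->
  (forall x, A x -> exists B, [/\ relopen B, B x & Ck k B f]) -> Ck k A f.
Proof.
move=> Ah; have C f' : (forall x, A x -> exists B, [/\ relopen B, B x & cont_on B f']) ->
    {within A, continuous f'}.
  move=> H; apply/cont_onP => x Ax e e0; have [B [oB Bx Hf]] := H x Ax.
  have [d d0 Hd] := Hf x Bx e e0; have [r r0 Hr] := proj2 oB x Bx.
  exists (Num.min d r); first by rewrite lt_min d0.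
  move=> y Ay; rewrite lt_min => /andP[yd yr]; apply: Hd => //; apply: Hr => //; exact: Ah.
elim: k f => [|k IH] f H.
  by split=> //; apply: C => x /H[B [? ? /Ck_cont ?]]; exists B.
split; first by apply: C => x /H[B [? ? /Ck_cont ?]]; exists B.
move=> a; split=> [x /H[B [oB Bx Hf]]|]; first exact: (Ck_has_pd Hf).
by apply: IH => x /H[B [oB Bx Hf]]; exists B; split=> //; exact: Ck_pd.
Qed.

Opaque pd.

Lemma has_pd_shift a f x v l : (forall h : R, halfspace (x + h *: evec a) ->
    halfspace (x + v + h *: evec a)) ->
  has_pd a f (x + v) l -> has_pd a (fun z => f (z + v)) x l.
Proof.
move=> hv /has_pdP H; apply/has_pdP => e e0; have [d d0 Hd] := H e e0.
exists d => // h hd hh; have -> : x + h *: evec a + v = x + v + h *: evec a by rewrite addrAC.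
exact/Hd/hv.
Qed.

(** The second difference over a small square spanned by positive steps from [x], which therefore
    lies in the half-space, is h^2 times either mixed derivative at some point of the square.
    Continuity of both at [x] concludes. *)
Lemma Ck_pdC A f a b x : relopen A -> Ck 2 A f -> A x -> pd a (pd b f) x = pd b (pd a f) x.
Proof.
move=> oA Hf Ax; have [Ah oA'] := oA.
suff H (e : R) : 0 < e -> `|pd a (pd b f) x - pd b (pd a f) x| <= e + e.
  apply/eqP; rewrite -subr_eq0 -normr_le0; apply/ler_addgt0Pl => e e0; rewrite addr0.
  by have := H (e / 2); rewrite -splitr; apply; rewrite divr_gt0.
move=> e0; have cab := Ck_cont (Ck_pd a (Ck_pd b Hf)); have cba := Ck_cont (Ck_pd b (Ck_pd a Hf)).
have [d1 d10 H1] := cab x Ax e e0; have [d2 d20 H2] := cba x Ax e e0.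
have [r r0 Hr] := oA' x Ax.
have [d [d0 dr dd1 dd2]] : exists d, [/\ 0 < d, d <= r, d <= d1 & d <= d2].
  exists (Num.min r (Num.min d1 d2)); split; first by rewrite !lt_min r0 d10 d20.
  - by rewrite ge_min lexx.
  - by rewrite !ge_min lexx orbT.
  - by rewrite !ge_min lexx !orbT.
have [h h0 hd] : exists2 h : R, 0 < h & h + h < d by exists (d / 4); lra.
have seg (t : R) : 0 <= t <= 1 -> 0 <= t * h <= h.
  by move=> /andP[t0 t1]; rewrite mulr_ge0 ?(ltW h0)//= ger_pMl.
have seg' (t : R) : 0 < t < 1 -> 0 <= t * h <= h.
  by move=> /andP[t0 t1]; rewrite seg// !ltW.
have near s t : 0 <= s <= h -> 0 <= t <= h ->
    forall y, y = x + s *: evec a + t *: evec b -> A y /\ `|y - x| < d.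
  move=> /andP[s0 sh] /andP[t0 th] y ->; have yd : `|x + s *: evec a + t *: evec b - x| < d.
    rewrite -[X in X - x]addrA [X in X - x]addrC addrK; apply: (le_lt_trans (ler_normD _ _)).
    rewrite !norm_scale_evec !ger0_norm//; apply: le_lt_trans hd; exact: lerD.
  split=> //; apply: Hr; last by apply: lt_le_trans yd _.
  by apply: halfspace_step => //; apply: halfspace_step => //; exact: Ah.
(* Two mean values: along [p] for the difference of [f] over a step in direction [q], then along [q]
   for the [p]-derivative of [f]. Exchanging [p] and [q] only exchanges the corners [v] and [w],
   which leaves the second difference unchanged. *)
have D (p q : 'I_n.+1) : (forall s t, 0 <= s <= h -> 0 <= t <= h ->
      A (x + s *: evec p + t *: evec q)) ->
    forall u v w, u = x + h *: evec p + h *: evec q -> v = x + h *: evec p ->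
      w = x + h *: evec q ->
    exists s t z, [/\ 0 <= s <= h, 0 <= t <= h, z = x + s *: evec p + t *: evec q &
     f u - f v - (f w - f x) = h * (h * pd q (pd p f) z)].
  move=> Apq u v w -> -> ->; pose F y := f (y + h *: evec q) - f y.
  pose S := [set y : X | A y /\ A (y + h *: evec q)].
  have Sseg (t : R) : 0 <= t <= 1 -> S (x + (t * h) *: evec p).
    move=> /seg th; split; last by apply: Apq => //; rewrite lexx ltW.
    by have := Apq _ 0 th; rewrite scale0r addr0 lexx ltW//; apply.
  have [t t01 E] : exists2 t : R, 0 < t < 1 & F (x + h *: evec p) - F x =
     h * (pd p f (x + (t * h) *: evec p + h *: evec q) - pd p f (x + (t * h) *: evec p)).
    apply: (@pd_MVT S p F (fun y => pd p f (y + h *: evec q) - pd p f y)).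
    - by move=> y [/Ah].
    - move=> y [Ay1 Ay2] e' e'0.
      have e2 : 0 < e' / 2 by rewrite divr_gt0.
      have [r1 r10 K1] := Ck_cont Hf Ay1 e2; have [r2 r20 K2] := Ck_cont Hf Ay2 e2.
      exists (Num.min r1 r2); first by rewrite lt_min r10.
      move=> z [Az1 Az2]; rewrite lt_min => /andP[z1 z2].
      have -> : F z - F y = (f (z + h *: evec q) - f (y + h *: evec q)) - (f z - f y).
        by rewrite /F; ring.
      apply: (le_trans (ler_normB _ _)); rewrite (splitr e'); apply: lerD; last exact: K1.
      by apply: K2 => //; rewrite opprD addrACA subrr addr0.
    - exact: Sseg.
    - move=> t /andP[t0 t1]; have [S1 S2] := Sseg t (introT andP (conj (ltW t0) (ltW t1))).
      apply: has_pdB; last by apply: Ck_has_pd; eassumption.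
      apply: has_pd_shift; last by apply: Ck_has_pd; eassumption.
      by move=> s hs; rewrite addrAC; apply: halfspace_step => //; exact: ltW.
  have th := seg' t t01.
  have [s s01 E2] := @pd_MVT A q (pd p f) (pd q (pd p f)) (x + (t * h) *: evec p) h Ah
     (Ck_cont (Ck_pd p Hf)) (fun s s01 => Apq _ _ th (seg s s01))
     (fun s s01 => Ck_has_pd (Ck_pd p Hf) (Apq _ _ th (seg' s s01))).
  exists (t * h), (s * h); eexists; split; [exact: th|exact: seg'|reflexivity|].
  by rewrite -E2 -E /F.
have [u Eu] : exists u, u = x + h *: evec a + h *: evec b by eexists.
have [v Ev] : exists v, v = x + h *: evec a by eexists.
have [w Ew] : exists w, w = x + h *: evec b by eexists.
have [s [t [z [sh th /(near _ _ sh th)[Az zd] E1]]]] :=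
  D a b (fun s t hs ht => proj1 (near s t hs ht _ erefl)) u v w Eu Ev Ew.
have [s' [t' [z' [sh' th' Ez' E2]]]] :=
  D b a (fun s t hs ht => proj1 (near t s ht hs _ (addrAC _ _ _))) u w v (etrans Eu (addrAC _ _ _)) Ew Ev.
have [Az' z'd] := near _ _ th' sh' _ (etrans Ez' (addrAC _ _ _)).
have E : pd b (pd a f) z = pd a (pd b f) z'.
  apply: (mulfI (lt0r_neq0 h0)); apply: (mulfI (lt0r_neq0 h0)).
  apply: etrans (esym E1) _; apply: etrans _ E2; ring.
have := H1 z' Az' (lt_le_trans z'd dd1); have := H2 z Az (lt_le_trans zd dd2); rewrite E.
move: (pd a (pd b f) z') (pd a (pd b f) x) (pd b (pd a f) x) => p q r' pr pq.
have -> : q - r' = - (p - q) + (p - r') by ring.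
by apply: (le_trans (ler_normD _ _)); rewrite normrN; exact: lerD.
Qed.

End HalfspaceCalculus.

(** * Linear systems up to the boundary *)

Section Smooth.
Context {R : realType} {n : nat}.
Local Notation X := (coord_space R n).
Implicit Types (A B : set X) (f g : tensor0 R n) (x y : X) (a b c : 'I_n.+1).

Lemma smooth_has_pd A f a x : smooth A f -> A x -> has_pd a f x (pd a f x).
Proof. by move=> H; apply: Ck_has_pd (H 1%N). Qed.

Lemma smooth_pd A f a : smooth A f -> smooth A (pd a f).
Proof. by move=> H k; apply: Ck_pd (H k.+1). Qed.

Lemma smooth_cont A f : smooth A f -> cont_on A f.
Proof. by move=> H; apply: Ck_cont (H 0%N). Qed.

Lemma smooth_eq A f g : relopen A -> (forall y, A y -> f y = g y) -> smooth A f -> smooth A g.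
Proof. by move=> oA fg H k; apply: Ck_eq (H k). Qed.

Lemma smooth_cst A (c : R) : relopen A -> smooth A (fun=> c).
Proof. by move=> oA k; apply: Ck_cst. Qed.

Lemma smoothD A f g : relopen A -> smooth A f -> smooth A g -> smooth A (fun x => f x + g x).
Proof. by move=> oA H K k; apply: CkD. Qed.

Lemma smoothM A f g : relopen A -> smooth A f -> smooth A g -> smooth A (fun x => f x * g x).
Proof. by move=> oA H K k; apply: CkM. Qed.

Lemma smoothN A f : relopen A -> smooth A f -> smooth A (fun x => - f x).
Proof.
move=> oA H; apply: (smooth_eq oA) (smoothM oA (smooth_cst (-1) oA) H) => y _ /=.
by rewrite mulN1r.
Qed.

Lemma smoothB A f g : relopen A -> smooth A f -> smooth A g -> smooth A (fun x => f x - g x).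
Proof. by move=> oA H K; apply: smoothD => //; apply: smoothN. Qed.

Lemma smooth_sum A (I : Type) (s : seq I) (P : pred I) (F : I -> tensor0 R n) : relopen A ->
  (forall i, P i -> smooth A (F i)) -> smooth A (fun x => \sum_(i <- s | P i) F i x).
Proof. by move=> oA H k; apply: Ck_sum => // i Pi; exact: H. Qed.

Lemma smooth_prod A (I : Type) (s : seq I) (F : I -> tensor0 R n) : relopen A ->
  (forall i, smooth A (F i)) -> smooth A (fun x => \prod_(i <- s) F i x).
Proof.
move=> oA H; elim: s => [|i s IH].
  by apply: smooth_eq (smooth_cst 1 oA) => // y _; rewrite big_nil.
by apply: smooth_eq (smoothM oA (H i) IH) => // y _; rewrite big_cons.
Qed.

Lemma smooth_det A m (F : X -> 'M[R]_m) : relopen A ->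
  (forall i j, smooth A (fun x => F x i j)) -> smooth A (fun x => \det (F x)).
Proof.
move=> oA H; apply: smooth_sum => // s _; apply: smoothM => //; first exact: smooth_cst.
by apply: smooth_prod => // i; exact: H.
Qed.

Lemma smooth_powR A f (p : R) : relopen A -> (forall x, A x -> 0 < f x) ->
  smooth A f -> smooth A (fun x => f x `^ p).
Proof. by move=> oA f0 H k; apply: Ck_powR. Qed.

Lemma smooth_inv A f : relopen A -> (forall x, A x -> 0 < f x) ->
  smooth A f -> smooth A (fun x => (f x)^-1).
Proof.
move=> oA f0 H; apply: smooth_eq (smooth_powR (-1) oA f0 H) => // y Ay.
by rewrite powR_inv1// ltW// f0.
Qed.

Lemma smooth_comp A B f (phi : X -> X) : relopen A -> relopen B -> (forall x, A x -> B (phi x)) ->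
  smooth B f -> (forall b, smooth A (fun x => phi x ord0 b)) -> smooth A (fun x => f (phi x)).
Proof. by move=> oA oB AB H K k; apply: (Ck_comp (B := B)) => // b; exact: K. Qed.

Lemma smooth_local A f : A `<=` halfspace ->
  (forall x, A x -> exists B, [/\ relopen B, B x & smooth B f]) -> smooth A f.
Proof. by move=> Ah H k; apply: Ck_local => // x /H[B [? ? ?]]; exists B. Qed.

Lemma smooth_sub A B f : relopen A -> B `<=` A -> smooth A f -> smooth B f.
Proof.
move=> oA BA H; apply: smooth_local => [x /BA Ax|x /BA Ax]; last by exists A.
exact: (proj1 oA).
Qed.

Lemma smooth_pdC A f a b x : relopen A -> smooth A f -> A x ->
  pd a (pd b f) x = pd b (pd a f) x.
Proof. by move=> oA H Ax; apply: Ck_pdC (H 2%N) Ax. Qed.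

Lemma relopenI A B : relopen A -> relopen B -> relopen (A `&` B).
Proof.
move=> [Ah oA] [Bh oB]; split=> [x [/Ah]//|x [Ax Bx]].
have [r r0 Hr] := oA x Ax; have [s s0 Hs] := oB x Bx.
exists (Num.min r s); first by rewrite lt_min r0.
by move=> y hy; rewrite lt_min => /andP[? ?]; split; [exact: Hr|exact: Hs].
Qed.

Definition pos_part : set X := [set x | 0 < x ord0 ord0].

Lemma relopen_pos : relopen pos_part.
Proof.
split=> [x /ltW//|x x0]; exists (x ord0 ord0) => // y _.
move=> /(le_lt_trans (coord_le_norm _ ord0)); rewrite !mxE ltr_norml => /andP[? _].
by rewrite /pos_part /=; lra.
Qed.

Lemma relopen_hball p (r : R) : @relopen R n (hball p r).
Proof.
split=> [x []//|x [hx xr]]; exists (r - `|x - p|); first by rewrite subr_gt0.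
move=> y hy yx; split=> //; rewrite -(subrKA x); apply: le_lt_trans (ler_normD _ _) _.
by rewrite -ltrBrDr.
Qed.

(** * Extension of functions and of derivative formulas to the boundary *)

Lemma finite_min (I : finType) (P : I -> R -> Prop) :
  (forall i, exists2 d : R, 0 < d & P i d) -> (forall i d e, d <= e -> P i e -> P i d) ->
  exists2 d : R, 0 < d & forall i, P i d.
Proof.
move=> H mono.
have : forall i, exists d : R, 0 < d /\ P i d by move=> i; have [d d0 Pd] := H i; exists d.
move=> /choice[d Hd]; exists (\big[Num.min/1]_i d i).
  by apply: lt_bigmin => // i _; case: (Hd i).
by move=> i; apply: mono (proj2 (Hd i)); exact: bigmin_le_cond.
Qed.

Lemma norm_mul_self (t : R) : `|t| * `|t| = t * t.
Proof. by rewrite -normrM ger0_norm// -expr2 sqr_ge0. Qed.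

(** McShane's formula, the supremum over [Q] of f y - L |y - x|. It extends a Lipschitz function
    continuously from an open half-ball across the face without constructing boundary limits. *)
Lemma mcshane (Q : set X) f (L : R) : 0 <= L -> Q !=set0 ->
  (forall x y, Q x -> Q y -> `|f y - f x| <= L * `|y - x|) ->
  exists2 g : tensor0 R n, (forall x, Q x -> g x = f x) &
    forall x y, `|g y - g x| <= L * `|y - x|.
Proof.
move=> L0 [q Qq] Lf.
pose S x := [set f y - L * `|y - x| | y in Q].
have S0 x : S x !=set0 by exists (f q - L * `|q - x|); exists q.
have Lq x y : Q y -> f y - L * `|y - x| <= f q + L * `|q - x|.
  move=> Qy; have := Lf _ _ Qq Qy; rewrite ler_norml => /andP[_ ?].
  have : L * `|y - q| <= L * `|y - x| + L * `|q - x|.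
    rewrite -mulrDr ler_wpM2l// [`|q - x|]distrC -(subrKA x); exact: ler_normD.
  by lra.
have S1 x : has_ubound (S x) by exists (f q + L * `|q - x|) => _ [y Qy <-]; exact: Lq.
pose g x := sup (S x).
have gL x y : g y - g x <= L * `|y - x|.
  rewrite lerBlDr; apply: sup_le_ub => // _ [z Qz <-].
  have : f z - L * `|z - x| <= g x by apply: ub_le_sup => //; exists z.
  have : L * `|z - x| <= L * `|z - y| + L * `|y - x|.
    by rewrite -mulrDr ler_wpM2l// -(subrKA y); exact: ler_normD.
  by lra.
exists g => [x Qx|x y].
  apply/eqP; rewrite eq_le; apply/andP; split.
    apply: sup_le_ub => // _ [z Qz <-].
    by have := Lf _ _ Qx Qz; rewrite ler_norml => /andP[_ ?]; lra.
  by apply: ub_le_sup => //; exists x => //; rewrite subrr normr0 mulr0 subr0.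
by rewrite ler_norml gL andbT lerNl opprB distrC; exact: gL.
Qed.

Lemma lipschitz_cont_on A f (L : R) : 0 <= L ->
  (forall x y, `|f y - f x| <= L * `|y - x|) -> cont_on A f.
Proof.
move=> L0 H x Ax e e0; have K : 0 < L + 1 by rewrite ltr_wpDl.
exists (e / (L + 1)); first by rewrite divr_gt0.
move=> y _; rewrite ltr_pdivlMr// => yx; apply: (le_trans (H _ _)); apply: le_trans (ltW yx).
by rewrite mulrC ler_wpM2l// lerDl.
Qed.

(** A segment that may lie in the face is pushed inwards by a small [t] along the normal. There the
    mean value theorem applies; [f] moves by little under the push, and [g] is continuous at [x]. *)
Lemma has_pd_boundary p (r : R) f g a : cont_on (hball p r) f -> cont_on (hball p r) g ->
  (forall x, hball p r x -> pos_part x -> has_pd a f x (g x)) ->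
  forall x, hball p r x -> has_pd a f x (g x).
Proof.
move=> cf cg H x Qx; apply/has_pdP => e e0.
have [d1 d10 H1] := cg x Qx e e0; have [d2 d20 H2] := proj2 (relopen_hball p r) x Qx.
have [d [d0 dd1 dd2]] : exists d, [/\ 0 < d, d <= d1 & d <= d2].
  by exists (Num.min d1 d2); rewrite lt_min d10 d20 !ge_min !lexx ?orbT.
have Qn y : halfspace y -> `|y - x| < d -> hball p r y.
  by move=> hy yd; apply: H2 => //; exact: lt_le_trans dd2.
exists (d / 2) => [|h hd hh]; first by rewrite divr_gt0.
have near (t s : R) : 0 < t -> t < d / 2 -> 0 <= s <= 1 ->
   [/\ hball p r (x + t *: evec ord0 + (s * h) *: evec a),
       pos_part (x + t *: evec ord0 + (s * h) *: evec a)
     & `|x + t *: evec ord0 + (s * h) *: evec a - x| < d].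
  move=> t0 td /andP[s0 s1].
  have N : `|x + t *: evec ord0 + (s * h) *: evec a - x| < d.
    rewrite -[X in X - x]addrA [X in X - x]addrC addrK.
    apply: (le_lt_trans (ler_normD _ _)); rewrite !norm_scale_evec normrM (gtr0_norm t0) (ger0_norm s0).
    have : s * `|h| <= `|h| by rewrite ler_piMl.
    by move=> ?; lra.
  have P : pos_part (x + t *: evec ord0 + (s * h) *: evec a).
    have := proj1 Qx; have := hh; rewrite /pos_part /halfspace /= !mxE !eqxx /=.
    by case: (ord0 == a); rewrite ?mulr1 ?mulr0 => *; nra.
  by split=> //; apply: Qn => //; exact: ltW.
have Qh : hball p r (x + h *: evec a).
  apply: Qn => //; rewrite addrC addKr norm_scale_evec; lra.
(* [eta] pays for replacing both ends of the segment by their pushed copies; [t] is chosen after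
   it. *)
apply/ler_addgt0Pr => eta eta0; have eta2 : 0 < eta / 2 by rewrite divr_gt0.
have [u1 u10 K1] := cf _ Qx _ eta2; have [u2 u20 K2] := cf _ Qh _ eta2.
have [t [t0 td tu1 tu2]] : exists t : R, [/\ 0 < t, t < d / 2, t < u1 & t < u2].
  pose m := Num.min (d / 2) (Num.min u1 u2).
  have m0 : 0 < m by rewrite !lt_min u10 u20 divr_gt0.
  have : m / 2 < m by rewrite ltr_pdivrMr// mulr2n mulrDr mulr1 ltrDl.
  by rewrite [in X in _ < X]/m !lt_min => /and3P[? ? ?]; exists (m / 2); rewrite divr_gt0.
have [z [Qz Pz zd E]] : exists z, [/\ hball p r z, pos_part z, `|z - x| < d &
    f (x + t *: evec ord0 + h *: evec a) - f (x + t *: evec ord0) = h * g z].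
  have [s /andP[s0 s1] E] := @pd_MVT R n (hball p r) a f g (x + t *: evec ord0) h
     (proj1 (relopen_hball p r)) cf
     (fun s s01 => let: And3 q _ _ := near t s t0 td s01 in q)
     (fun s s01 => let: And3 q q' _ :=
        near t s t0 td (introT andP (conj (ltW (proj1 (andP s01))) (ltW (proj2 (andP s01))))) in H _ q q').
  have [? ? ?] := near t s t0 td (introT andP (conj (ltW s0) (ltW s1))).
  by eexists; split; last exact: E.
have Qt : hball p r (x + t *: evec ord0).
  by have [] := near t 0 t0 td; rewrite ?lexx ?ler01// mul0r scale0r addr0.
have Qth : hball p r (x + t *: evec ord0 + h *: evec a).
  by have [] := near t 1 t0 td; rewrite ?lexx ?ler01// mul1r.
have B1 : `|f (x + t *: evec ord0) - f x| <= eta / 2.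
  by apply: K1 => //; rewrite addrC addKr norm_scale_evec gtr0_norm.
have B2 : `|f (x + t *: evec ord0 + h *: evec a) - f (x + h *: evec a)| <= eta / 2.
  apply: K2 => //; rewrite [X in X - _]addrAC [X in X - _]addrC addrK norm_scale_evec gtr0_norm//.
have B3 : `|g z - g x| <= e by apply: H1 => //; exact: lt_le_trans dd1.
move: E B1 B2 B3.
move: (f (x + t *: evec ord0 + h *: evec a)) (f (x + t *: evec ord0)) (f (x + h *: evec a))
  (f x) (g z) (g x) => f1 f2 f4 f3 g1 g2 E B1 B2 B3.
have -> : f4 - f3 - h * g2 = (f2 - f3) - (f1 - f4) + h * (g1 - g2) by lra.
rewrite addrC; apply: (le_trans (ler_normD _ _)); apply: lerD.
  by rewrite normrM mulrC ler_wpM2r.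
rewrite (splitr eta).
by apply: (le_trans (ler_normB _ _)); exact: lerD.
Qed.


(* The equation makes ln (sum s_k^2) Lipschitz on a half-ball, since its gradient is bounded; so s is
   bounded, hence Lipschitz, and extends continuously.  The extension still solves the system, and
   smoothness follows by bootstrapping.  The component [k0] only serves to make the sum positive. *)
Lemma linear_system_extension (K : finType) (A : set X) (p : X) (s : K -> tensor0 R n)
    (B : 'I_n.+1 -> K -> K -> tensor0 R n) (k0 : K) :
  relopen A -> A p -> (forall a k l, smooth A (B a k l)) ->
  (forall k, smooth (A `&` pos_part) (s k)) ->
  (forall a k x, A x -> pos_part x -> pd a (s k) x = \sum_l B a k l x * s l x) ->
  (forall x, A x -> pos_part x -> s k0 x != 0) ->
  exists (r : R) (sb : K -> tensor0 R n),
    [/\ 0 < r, hball p r `<=` A, forall k, smooth (hball p r) (sb k),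
        forall k x, hball p r x -> pos_part x -> sb k x = s k x
      & forall a k x, hball p r x -> pd a (sb k) x = \sum_l B a k l x * sb l x].
Proof.
move=> oA Ap sB ss ds s0.
(* Near [p] each coefficient stays within 1 of its value at [p], so this number bounds all of
   them. *)
pose C := \sum_(i : 'I_n.+1 * K * K) `|B i.1.1 i.1.2 i.2 p| + 1.
have C0 : 0 <= C by rewrite addr_ge0// sumr_ge0.
have [r r0 [QA BC]] : exists2 r : R, 0 < r & hball p r `<=` A /\
    forall a k l x, hball p r x -> `|B a k l x| <= C.
  have [r1 r10 H1] := proj2 oA p Ap.
  have [r2 r20 H2] : exists2 d : R, 0 < d & forall i : 'I_n.+1 * K * K,
      forall y, A y -> `|y - p| < d -> `|B i.1.1 i.1.2 i.2 y - B i.1.1 i.1.2 i.2 p| <= 1.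
    apply: finite_min => [[[a k] l]|i d e de H y Ay yd]; last by apply: H => //; exact: lt_le_trans de.
    exact: (smooth_cont (sB a k l) Ap ltr01).
  exists (Num.min r1 r2); first by rewrite lt_min r10.
  have QA : hball p (Num.min r1 r2) `<=` A.
    by move=> y [hy]; rewrite lt_min => /andP[? _]; exact: H1.
  split=> // a k l x Qx; have Ax := QA _ Qx; case: Qx => _; rewrite lt_min => /andP[_ xr].
  have := H2 (a, k, l) x Ax xr; rewrite /= => Hx.
  have -> : B a k l x = (B a k l x - B a k l p) + B a k l p by rewrite subrK.
  apply: (le_trans (ler_normD _ _)); rewrite addrC; apply: lerD => //.
  by rewrite (bigD1 (a, k, l))//= lerDl sumr_ge0.
pose Qp := hball p r `&` pos_part.
have oQp : relopen Qp by apply: relopenI; [exact: relopen_hball|exact: relopen_pos].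
have bQp : boxy Qp by exact: boxy_hball_pos.
have QpA : Qp `<=` A `&` pos_part by move=> x [/QA].
have oAp : relopen (A `&` pos_part) by apply: relopenI => //; exact: relopen_pos.
have ssp k : smooth Qp (s k) by exact: smooth_sub oAp QpA (ss k).
have dsp a k x : Qp x -> has_pd a (s k) x (\sum_l B a k l x * s l x).
  move=> Qx; rewrite -ds; [exact: smooth_has_pd (ssp k) Qx|by case/QpA: Qx|by case: Qx].
pose E (x : X) := \sum_k s k x * s k x.
have E0 x : Qp x -> 0 < E x.
  move=> /QpA[Ax px]; rewrite /E (bigD1 k0)//= ltr_pwDl//.
    by rewrite -expr2 lt_neqAle sqr_ge0 eq_sym sqrf_eq0 s0.
  by apply: sumr_ge0 => k _; rewrite -expr2 sqr_ge0.
pose dE a (x : X) := \sum_k ((\sum_l B a k l x * s l x) * s k x + s k x * (\sum_l B a k l x * s l x)).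
have HdE a x : Qp x -> has_pd a E x (dE a x).
  by move=> Qx; apply: has_pd_sum => k _; apply: has_pdM; exact: dsp.
pose N : R := #|K|%:R.
(* By 2 |s_k s_l| <= s_k^2 + s_l^2; summed over both indices the right-hand side is 2 N copies of
   [E]. *)
have dE_le a x : Qp x -> `|dE a x| <= (2 * C * N) * E x.
  move=> Qx; apply: (le_trans (ler_norm_sum _ _ _)).
  apply: (@le_trans _ _ (\sum_(k : K) \sum_(l : K) C * (s k x * s k x + s l x * s l x))).
    apply: ler_sum => k _; rewrite [s k x * (\sum_l _)]mulrC -mulr2n -mulr_natl !mulr_suml mulr_sumr.
    apply: (le_trans (ler_norm_sum _ _ _)); apply: ler_sum => l _.
    rewrite !normrM (ger0_norm (ler0n _ 2)).
    have H1 : 2 * (`|s l x| * `|s k x|) <= s k x * s k x + s l x * s l x.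
      have := sqr_ge0 (`|s l x| - `|s k x|); rewrite -(norm_mul_self (s k x)) -(norm_mul_self (s l x)) => ?.
      by nra.
    rewrite -mulrA mulrCA; apply: ler_pM => //; last exact: BC (proj1 Qx).
  rewrite le_eqVlt; apply/orP; left; apply/eqP.
  under eq_bigr do rewrite -mulr_sumr big_split /= sumr_const -mulr_natl.
  by rewrite -mulr_sumr big_split /= sumr_const -mulr_sumr -mulr_natl -/(E x) /N; ring.
have cE : cont_on Qp (fun x => ln (E x)).
  apply: (@cont_on_comp1 _ _ Qp E (@ln R)) => [x Qx|]; first exact: continuous_ln (E0 x Qx).
  by apply: smooth_cont; apply: smooth_sum => // k _; apply: smoothM.
have [q Qq] : Qp !=set0.
  have hp := proj1 oA p Ap; exists (p + (r / 2) *: evec ord0); have r2 : 0 < r / 2 by rewrite divr_gt0.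
  split; last by rewrite /pos_part /= !mxE !eqxx /= mulr1 ltr_wpDl.
  split; first by apply: halfspace_step => //; exact: ltW.
  by rewrite addrC addKr norm_scale_evec gtr0_norm//; lra.
have [S S0 sS] : exists2 S : R, 0 <= S & forall k x, Qp x -> `|s k x| <= S.
  pose F := ln (E q) + n.+1%:R * (2 * C * N) * (r + r).
  (* s_k^2 <= exp F implies |s_k| <= exp F + 1, which spares a square root. *)
  exists (expR F + 1) => [|k x Qx]; first by rewrite addr_ge0// expR_ge0.
  have HL : `|ln (E x) - ln (E q)| <= n.+1%:R * (2 * C * N) * `|x - q|.
    apply: (@boxy_lipschitz _ _ Qp (fun x => ln (E x)) (fun a x => (E x)^-1 * dE a x)) => //.
    - exact: (proj1 oQp).
    - move=> a z Qz; apply: has_pd_comp1; last exact: HdE.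
      exact/is_derive1_ln/E0.
    - move=> a z Qz; have Ez := E0 z Qz; rewrite normrM normfV (gtr0_norm Ez).
      by rewrite mulrC ler_pdivrMr//; exact: dE_le.
  have L0 : 0 <= n.+1%:R * (2 * C * N) by rewrite !mulr_ge0.
  have : n.+1%:R * (2 * C * N) * `|x - q| <= n.+1%:R * (2 * C * N) * (r + r).
    rewrite ler_wpM2l// -(subrKA p); apply: (le_trans (ler_normD _ _)).
    by apply: lerD; [|rewrite distrC]; apply: ltW; [case: Qx => -[]|case: Qq => -[]].
  move: HL; rewrite ler_norml => /andP[_ HL] HL2.
  have {HL HL2} : ln (E x) <= F by rewrite /F; lra.
  rewrite -[ln _ <= _]ler_expR lnK ?posrE ?E0// => HE.
  have : s k x * s k x <= expR F.
    apply: le_trans HE; rewrite /E (bigD1 k)//= lerDl; apply: sumr_ge0 => l _.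
    by rewrite -expr2 sqr_ge0.
  rewrite -norm_mul_self => Hs; have := expR_ge0 F; have := normr_ge0 (s k x).
  by move=> ? ?; nra.
pose L := n.+1%:R * (N * (C * S)).
have L0 : 0 <= L by rewrite !mulr_ge0.
have Ls k x y : Qp x -> Qp y -> `|s k y - s k x| <= L * `|y - x|.
  apply: (@boxy_lipschitz _ _ Qp (s k) (fun a x => \sum_l B a k l x * s l x)) => //.
  - exact: (proj1 oQp).
  - exact: smooth_cont.
  - by move=> a z; exact: dsp.
  - move=> a z Qz; apply: (le_trans (ler_norm_sum _ _ _)).
    apply: (@le_trans _ _ (\sum_(l : K) C * S)); last by rewrite sumr_const -mulr_natl.
    by apply: ler_sum => l _; rewrite normrM; apply: ler_pM => //; [exact: BC (proj1 Qz)|exact: sS].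
have Qne : Qp !=set0 by exists q.
have : forall k, exists g : tensor0 R n, (forall x, Qp x -> g x = s k x) /\
    forall x y, `|g y - g x| <= L * `|y - x|.
  by move=> k; have [g g1 g2] := mcshane L0 Qne (Ls k); exists g.
move=> /choice[sb Hsb].
have csb k (D : set X) : cont_on D (sb k) := lipschitz_cont_on L0 (proj2 (Hsb k)).
have oQ : @relopen R n (hball p r) := relopen_hball p r.
have sBQ a k l : smooth (hball p r) (B a k l) by exact: smooth_sub oA QA (sB a k l).
have cG a k : cont_on (hball p r) (fun x => \sum_l B a k l x * sb l x).
  have : forall (ls : seq K), cont_on (hball p r) (fun x => \sum_(l <- ls) B a k l x * sb l x).
    elim=> [|l ls IH].
      by rewrite (_ : (fun _ => _) = fun=> 0); [exact: cont_on_cst|apply/funext => x; rewrite big_nil].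
    rewrite (_ : (fun _ => _) = fun x => B a k l x * sb l x + \sum_(l <- ls) B a k l x * sb l x).
      by apply: cont_onD => //; apply: cont_onM => //; exact: smooth_cont.
    by apply/funext => x; rewrite big_cons.
  exact.
have dsb a k x : hball p r x -> has_pd a (sb k) x (\sum_l B a k l x * sb l x).
  move: x; apply: has_pd_boundary => // x Qx px; have Qpx : Qp x by [].
  have -> : \sum_l B a k l x * sb l x = \sum_l B a k l x * s l x.
    by apply: eq_bigr => l _; rewrite (proj1 (Hsb l)).
  by apply: (has_pd_local oQp Qpx) (dsp a k x Qpx) => y Qy; rewrite (proj1 (Hsb k)).
have ssb m k : Ck m (hball p r) (sb k).
  elim: m k => [|m IH] k; first by split=> //; exact/cont_onP.
  apply: (Ck_build oQ _ (g := fun a x => \sum_l B a k l x * sb l x)) => //; first by move=> a x; exact: dsb.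
  by move=> a; apply: Ck_sum => // l _; apply: CkM => //; exact: sBQ.
exists r, sb; split=> //.
- by move=> k m.
- by move=> k x Qx px; rewrite (proj1 (Hsb k)).
- by move=> a k x Qx; apply: has_pdE (dsb a k x Qx); exact: (proj1 oQ).
Qed.

End Smooth.

(** * Projective changes and the tractor of a density *)

Section Tensors.
Context {R : realType} {n : nat}.
Local Notation X := (coord_space R n).
Implicit Types (A B : set X) (f g : tensor0 R n) (x y : X) (a b c d e : 'I_n.+1).
Implicit Types (G H : tensor3 R n) (u th : tensor1 R n) (t : tensor2 R n).

Definition smooth1 A u := forall a, smooth A (fun x => u x a).
Definition smooth2 A t := forall a b, smooth A (fun x => t x a b).
Definition smooth3 A G := forall a b c, smooth A (fun x => G x a b c).
Definition torsion_free A G := forall x, A x -> forall a b c, G x a b c = G x b a c.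
(** For [u = trG G], the connection form on densities, this is flatness of the induced connection on
    density bundles. *)
Definition closed1 A u := forall x, A x ->
  forall a b, pd a (fun y => u y b) x = pd b (fun y => u y a) x.

Lemma sum_delta (F : 'I_n.+1 -> R) d : \sum_e F e * (d == e)%:R = F d.
Proof.
rewrite (bigD1 d)//= eqxx mulr1 big1 ?addr0// => e /negPf.
by rewrite eq_sym => ->; rewrite mulr0.
Qed.

Lemma sum_delta' (F : 'I_n.+1 -> R) d : \sum_e F e * (e == d)%:R = F d.
Proof. by under eq_bigr do rewrite eq_sym; exact: sum_delta. Qed.

Lemma sum_delta_id (k : R) : \sum_(a < n.+1) k * (a == a)%:R = n.+1%:R * k.
Proof. by under eq_bigr do rewrite eqxx mulr1; rewrite sumr_const card_ord mulr_natl. Qed.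

Lemma proj_changeE G u x a b c :
  proj_change G u x a b c = G x a b c + u x a * (b == c)%:R + u x b * (a == c)%:R.
Proof. by rewrite /proj_change !mulr_natr. Qed.

Lemma trG_proj_change G u x a : trG (proj_change G u) x a = trG G x a + n.+2%:R * u x a.
Proof.
rewrite /trG; under eq_bigr do rewrite proj_changeE.
rewrite !big_split /= sum_delta sum_delta_id -addrA; congr (_ + _).
by rewrite -[n.+2]addn1 natrD; ring.
Qed.

(** The Christoffel trace is the connection form on densities, so this is the representative
    preserving the coordinate volume of the chart. *)
Lemma proj_change_trace_free G x a :
  trG (proj_change G (fun x a => - n.+2%:R^-1 * trG G x a)) x a = 0.
Proof. by rewrite trG_proj_change mulNr mulrN mulVKf ?pnatr_eq0// subrr. Qed.

Lemma smooth_trG A G : relopen A -> smooth3 A G -> smooth1 A (trG G).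
Proof. by move=> oA sG a; apply: smooth_sum => // c _; exact: sG. Qed.

Lemma smooth_proj_change A G u : relopen A -> smooth3 A G -> smooth1 A u ->
  smooth3 A (proj_change G u).
Proof.
move=> oA sG su a b c.
apply: (smooth_eq oA (f := fun x => G x a b c + u x a * (b == c)%:R + u x b * (a == c)%:R)).
  by move=> y _; rewrite proj_changeE.
by do !apply: smoothD => //; try apply: smoothM => //; try exact: smooth_cst.
Qed.

Lemma smooth_ricci A G : relopen A -> smooth3 A G -> smooth2 A (ricci G).
Proof.
move=> oA sG b d; apply: smoothD => //.
  apply: smoothB => //; last by apply: smooth_pd; exact: smooth_trG.
  by apply: smooth_sum => // a _; exact: smooth_pd.
apply: smooth_sum => // a _; apply: smooth_sum => // e _.
by apply: smoothB => //; apply: smoothM.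
Qed.

Lemma smooth_schouten A G : relopen A -> smooth3 A G -> smooth2 A (schouten G).
Proof.
by move=> oA sG b d; apply: smoothM => //; [exact: smooth_cst|exact: smooth_ricci].
Qed.

Lemma ricci_local A G H x : relopen A -> A x ->
  (forall y, A y -> forall a b c, G y a b c = H y a b c) ->
  forall b d, ricci G x b d = ricci H x b d.
Proof.
move=> oA Ax GH b d; rewrite /ricci; congr (_ - _ + _).
- by apply: eq_bigr => a _; apply: pd_local oA Ax _ => y Ay; exact: GH.
- by apply: pd_local oA Ax _ => y Ay; apply: eq_bigr => c _; exact: GH.
- by apply: eq_bigr => a _; apply: eq_bigr => e _; rewrite !GH.
Qed.

Lemma pd_trG A G x a b : relopen A -> smooth3 A G -> A x ->
  pd a (fun y => trG G y b) x = \sum_c pd a (fun y => G y b c c) x.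
Proof.
move=> oA sG Ax; apply: has_pdE; first exact: (proj1 oA).
by apply: has_pd_sum => c _; exact: smooth_has_pd (sG b c c) Ax.
Qed.

(** The term with factor n is the covariant derivative of [u] minus its square; the other is the
    exterior derivative of [u]. For closed [u] only the former remains, and division by n gives the
    transformation of the Schouten tensor. *)
Lemma ricci_proj_change A G u x b d : relopen A -> smooth3 A G -> torsion_free A G ->
  smooth1 A u -> A x ->
  ricci (proj_change G u) x b d = ricci G x b d +
    (pd d (fun y => u y b) x - pd b (fun y => u y d) x)
    - n%:R * (pd b (fun y => u y d) x - \sum_e G x b d e * u x e - u x b * u x d).
Proof.
move=> oA sG tG su Ax; have hx := proj1 oA _ Ax.
have E1 : \sum_a pd a (fun y => proj_change G u y b d a) x =
    \sum_a pd a (fun y => G y b d a) x + pd d (fun y => u y b) x + pd b (fun y => u y d) x.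
  rewrite -(sum_delta (fun a => pd a (fun y => u y b) x)) -(sum_delta (fun a => pd a (fun y => u y d) x)).
  rewrite -!big_split /=; apply: eq_bigr => a _.
  rewrite (_ : (fun y => _) = fun y => G y b d a + (d == a)%:R * u y b + (b == a)%:R * u y d); last first.
    by apply/funext => y; rewrite proj_changeE; ring.
  rewrite [X in _ + X + _]mulrC [X in _ + X]mulrC; apply: has_pdE => //.
  apply: has_pdD; first apply: has_pdD.
  - exact: smooth_has_pd (sG _ _ _) Ax.
  - by apply: has_pdZ; exact: smooth_has_pd (su _) Ax.
  - by apply: has_pdZ; exact: smooth_has_pd (su _) Ax.
have E2 : pd b (fun y => trG (proj_change G u) y d) x =
    pd b (fun y => trG G y d) x + n.+2%:R * pd b (fun y => u y d) x.
  rewrite (_ : (fun y => _) = fun y => trG G y d + n.+2%:R * u y d); last first.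
    by apply/funext => y; rewrite trG_proj_change.
  apply: has_pdE => //; apply: has_pdD; first exact: smooth_has_pd (smooth_trG oA sG d) Ax.
  by apply: has_pdZ; exact: smooth_has_pd (su _) Ax.
have e1 : n.+1%:R = n%:R + 1 :> R by rewrite -addn1 natrD.
have e2 : n.+2%:R = n%:R + 2 :> R by rewrite -addn2 natrD.
have e4 : n.+4%:R = n%:R + 4 :> R by rewrite -addn4 natrD.
have tr e : \sum_a G x a e a = trG G x e by apply: eq_bigr => a _; exact: tG.
(* The coefficient of u_b u_d is 2(n+2) here and n+4 in [E4]; their difference is the n of the
   statement. *)
have E3 : \sum_a \sum_e proj_change G u x a e a * proj_change G u x b d e =
    \sum_a \sum_e G x a e a * G x b d e + n.+2%:R * (\sum_e G x b d e * u x e)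
    + u x b * trG G x d + u x d * trG G x b + 2 * n.+2%:R * u x b * u x d.
  rewrite exchange_big [in RHS]exchange_big /=.
  have -> : \sum_e \sum_a G x a e a * G x b d e = \sum_e trG G x e * G x b d e.
    by apply: eq_bigr => e _; rewrite -mulr_suml tr.
  transitivity (\sum_e (trG G x e + n.+2%:R * u x e) *
     (G x b d e + u x b * (d == e)%:R + u x d * (b == e)%:R)).
    apply: eq_bigr => e _; rewrite -mulr_suml proj_changeE; congr (_ * _).
    under eq_bigr do rewrite proj_changeE.
    rewrite !big_split /= tr sum_delta sum_delta_id -addrA; congr (_ + _).
    by rewrite -[n.+2]addn1 natrD; ring.
  transitivity (\sum_e (trG G x e * G x b d e + n.+2%:R * (G x b d e * u x e)
     + (u x b * (trG G x e + n.+2%:R * u x e)) * (d == e)%:R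
     + (u x d * (trG G x e + n.+2%:R * u x e)) * (b == e)%:R)).
    by apply: eq_bigr => e _; ring.
  rewrite !big_split /= !sum_delta -mulr_sumr; ring.
have E4 : \sum_a \sum_e proj_change G u x b e a * proj_change G u x a d e =
    \sum_a \sum_e G x b e a * G x a d e + 2 * (\sum_e G x b d e * u x e)
    + u x b * trG G x d + u x d * trG G x b + n.+4%:R * u x b * u x d.
  transitivity (\sum_a (\sum_e (G x b e a * G x a d e) + G x b d a * u x a
     + u x d * G x b a a + u x b * G x a d a + (u x b * u x a) * (d == a)%:R
     + (u x b * u x d) * (a == a)%:R
     + (\sum_e G x a d e * u x e) * (b == a)%:R
     + (u x d * u x a) * (b == a)%:R + (u x a * u x d) * (b == a)%:R)).
    apply: eq_bigr => a _.
    transitivity (\sum_e (G x b e a * G x a d e + G x b e a * u x a * (d == e)%:R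
     + (u x d * G x b e a) * (a == e)%:R + (u x b * G x a d e) * (a == e)%:R
     + (u x b * u x a * (e == a)%:R) * (d == e)%:R
     + (u x b * u x d * (e == a)%:R) * (a == e)%:R
     + (G x a d e * u x e) * (b == a)%:R
     + (u x e * (b == a)%:R * u x a) * (d == e)%:R
     + (u x e * (b == a)%:R * u x d) * (a == e)%:R)).
      by apply: eq_bigr => e _; rewrite !proj_changeE (eq_sym e a); ring.
    rewrite !big_split /= !sum_delta -mulr_suml; ring.
  rewrite !big_split /= !sum_delta sum_delta_id -!mulr_sumr -/(trG G x b) tr.
  rewrite e4 e1; ring.
rewrite /ricci E1 E2.
have split_quad (H : tensor3 R n) : \sum_a \sum_e (H x a e a * H x b d e - H x b e a * H x a d e) =
    \sum_a \sum_e H x a e a * H x b d e - \sum_a \sum_e H x b e a * H x a d e.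
  by rewrite -sumrB; apply: eq_bigr => a _; rewrite sumrB.
rewrite !split_quad E3 E4.
rewrite e4 e2; ring.
Qed.

(** The only part of the coordinate formula that is not symmetric by torsion-freeness is the
    derivative of the Christoffel trace. *)
Lemma ricci_sym A G x b d : relopen A -> torsion_free A G -> closed1 A (trG G) -> A x ->
  ricci G x b d = ricci G x d b.
Proof.
move=> oA tG cG Ax; rewrite /ricci (cG x Ax b d); congr (_ - _ + _).
  by apply: eq_bigr => a _; apply: pd_local oA Ax _ => y Ay; exact: tG.
have sq b' d' : \sum_a \sum_e (G x a e a * G x b' d' e - G x b' e a * G x a d' e) =
    \sum_a \sum_e G x a e a * G x b' d' e - \sum_a \sum_e G x b' e a * G x a d' e.
  by rewrite -sumrB; apply: eq_bigr => a _; rewrite sumrB.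
rewrite !sq; congr (_ - _).
  by apply: eq_bigr => a _; apply: eq_bigr => e _; rewrite (tG x Ax b d).
rewrite exchange_big; apply: eq_bigr => a _; apply: eq_bigr => e _ /=.
by rewrite mulrC (tG x Ax b a) (tG x Ax e d).
Qed.


Lemma proj_change_contract G u x a b (F : 'I_n.+1 -> R) :
  \sum_e proj_change G u x a b e * F e = \sum_e G x a b e * F e + u x a * F b + u x b * F a.
Proof.
transitivity (\sum_e (G x a b e * F e + u x a * F e * (b == e)%:R + u x b * F e * (a == e)%:R)).
  by apply: eq_bigr => e _; rewrite proj_changeE; ring.
by rewrite !big_split /= !sum_delta.
Qed.

(* If [H = G + th] preserves its Ricci tensor and [tau] is an [H]-parallel density of weight 2,
   then in the splitting of [H] one has L(tau) = (tau, 0, P^H tau); the first two conclusions are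
   this tractor in the splitting of [G]. *)
Lemma parallel_splittingL A G H th (tau : tensor0 R n) :
  (0 < n)%N -> relopen A -> smooth3 A G -> torsion_free A G -> closed1 A (trG G) ->
  smooth1 A th -> closed1 A th ->
  (forall x, A x -> forall a b c, H x a b c = proj_change G th x a b c) ->
  smooth A tau -> (forall x, A x -> forall a, nabla0 2 G tau x a = - 2 * th x a * tau x) ->
  (forall x, A x -> forall a b c, nabla2 0 H (ricci H) x a b c = 0) ->
  forall x, A x ->
  [/\ forall b, mid_slot (splittingL G tau) x b = - th x b * tau x,
      forall b c, bot_slot (splittingL G tau) x b c =
         tau x * (schouten H x b c + th x b * th x c),
      forall a, nablaS2_top G (splittingL G tau) x a = 0,
      forall a b, nablaS2_mid G (splittingL G tau) x a b = 0
    & forall a b c, nablaS2_bot G (splittingL G tau) x a b c = 0].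
Proof.
move=> n0 oA sG tG cG sth cth HG stau dtau pR x0 Ax0.
have Ah := proj1 oA; have n0' : n%:R != 0 :> R by rewrite pnatr_eq0 -lt0n.
pose k : R := 2 / n.+2%:R.
have dt x a : A x -> pd a tau x = - 2 * th x a * tau x - k * trG G x a * tau x.
  by move=> Ax; rewrite -(dtau x Ax) /nabla0 -/k addrK.
have RH x b d : A x -> schouten H x b d = schouten G x b d
    - (pd b (fun y => th y d) x - \sum_e G x b d e * th x e - th x b * th x d).
  move=> Ax; rewrite /schouten (ricci_local oA Ax HG) (ricci_proj_change b d oA sG tG sth Ax).
  by rewrite (cth x Ax d b) subrr addr0 mulrBr mulKf.
have symG x b d : A x -> schouten G x b d = schouten G x d b.
  by move=> Ax; rewrite /schouten (ricci_sym b d oA tG cG Ax).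
have symGt x b d : A x -> \sum_e G x b d e * th x e = \sum_e G x d b e * th x e.
  by move=> Ax; apply: eq_bigr => e _; rewrite tG.
have symH x b d : A x -> schouten H x b d = schouten H x d b.
  move=> Ax; rewrite !RH// (symG x b d Ax) (symGt x b d Ax) (cth x Ax b d); ring.
have mid y b : A y -> mid_slot (splittingL G tau) y b = - th y b * tau y.
  by move=> Ay; rewrite /= dtau//; field.
have hth x a b : A x -> has_pd a (fun y => th y b) x (pd a (fun y => th y b) x).
  by move=> Ax; exact: smooth_has_pd (sth b) Ax.
have htau x a : A x -> has_pd a tau x (pd a tau x) by move=> Ax; exact: smooth_has_pd stau Ax.
have n1 x a b : A x -> nabla1 2 G (nabla0 2 G tau) x a b =
    2 * (tau x * (schouten H x a b - schouten G x a b + th x a * th x b)).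
  move=> Ax; rewrite /nabla1 -/k.
  have -> : pd a (fun y => nabla0 2 G tau y b) x =
      - 2 * pd a (fun y => th y b) x * tau x + - 2 * th x b * pd a tau x.
    rewrite (pd_local (g := fun y => - 2 * th y b * tau y) a oA Ax); last by move=> y Ay; exact: dtau.
    apply: has_pdE; first exact: Ah.
    by apply: has_pdM; [apply: has_pdZ; exact: hth|exact: htau].
  have -> : \sum_e G x a b e * nabla0 2 G tau x e = - 2 * tau x * \sum_e G x a b e * th x e.
    by rewrite mulr_sumr; apply: eq_bigr => e _; rewrite dtau//; ring.
  rewrite dtau// dt// RH//; ring.
have bot x b c : A x -> bot_slot (splittingL G tau) x b c =
    tau x * (schouten H x b c + th x b * th x c).
  move=> Ax; by rewrite /= /sym2 !n1// (symH x c b Ax) (symG x c b Ax); field.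
(* P^H is [H]-parallel because Ric^H is; the derivative is then expressed through [G] and [th]. *)
have dP x a b c : A x -> has_pd a (fun y => schouten H y b c) x
    (\sum_e G x a b e * schouten H x e c + \sum_e G x a c e * schouten H x b e
     + 2 * th x a * schouten H x b c + th x b * schouten H x a c + th x c * schouten H x b a).
  move=> Ax.
  have sH : smooth2 A (schouten H).
    move=> p q; apply: (smooth_eq oA) (_ : smooth A (fun y => n%:R^-1 * ricci (proj_change G th) y p q)).
      by move=> y Ay; rewrite /schouten (ricci_local oA Ay HG).
    by apply: smooth_schouten => //; exact: smooth_proj_change.
  have := smooth_has_pd (a := a) (sH b c) Ax; congr (has_pd a _ x).
  have -> : pd a (fun y => schouten H y b c) x = n%:R^-1 * pd a (fun y => ricci H y b c) x.
    apply: has_pdE; [exact: Ah|apply: has_pdZ].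
    apply: (smooth_has_pd (A := A)) => //.
    apply: (smooth_eq oA) (smooth_ricci oA (smooth_proj_change oA sG sth) b c) => y Ay.
    by rewrite -(ricci_local oA Ay HG).
  have := pR x Ax a b c; rewrite /nabla2 !mul0r addr0 => /eqP.
  rewrite subr_eq0 subr_eq => /eqP ->.
  have E (F : 'I_n.+1 -> R) p : \sum_e H x a p e * F e =
      \sum_e G x a p e * F e + th x a * F p + th x p * F a.
    by rewrite -proj_change_contract; apply: eq_bigr => e _; rewrite HG.
  rewrite mulrDr !mulr_sumr.
  rewrite (eq_bigr (fun e => H x a c e * schouten H x b e)); last by move=> e _; rewrite /schouten; ring.
  rewrite [X in _ + X](eq_bigr (fun e => H x a b e * schouten H x e c)); last first.
    by move=> e _; rewrite /schouten; ring.
  rewrite !E (symH x b a Ax); ring.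
split.
- by move=> b; exact: mid.
- by move=> b c; exact: bot.
- by move=> a; rewrite /nablaS2_top /=; field.
- move=> a b; rewrite /nablaS2_mid bot//.
  have -> : nabla1 2 G (mid_slot (splittingL G tau)) x0 a b = 2^-1 * nabla1 2 G (nabla0 2 G tau) x0 a b.
    rewrite /nabla1 /=.
    have -> : pd a (fun y => 2^-1 * nabla0 2 G tau y b) x0 = 2^-1 * pd a (fun y => nabla0 2 G tau y b) x0.
      apply: has_pdE; [exact: Ah|apply: has_pdZ].
      apply: (smooth_has_pd (A := A)) => //.
      apply: smoothD => //; first exact: smooth_pd.
      by apply: smoothM => //; apply: smoothM => //; [exact: smooth_cst|exact: smooth_trG].
    have -> : \sum_e G x0 a b e * (2^-1 * nabla0 2 G tau x0 e) = 2^-1 * \sum_e G x0 a b e * nabla0 2 G tau x0 e.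
      by rewrite mulr_sumr; apply: eq_bigr => e _; ring.
    by ring.
  by rewrite n1//=; field.
- move=> a b c; rewrite /nablaS2_bot /nabla2 -/k !mid//.
  have -> : pd a (fun y => bot_slot (splittingL G tau) y b c) x0 =
     pd a tau x0 * (schouten H x0 b c + th x0 b * th x0 c) + tau x0 *
      ((\sum_e G x0 a b e * schouten H x0 e c + \sum_e G x0 a c e * schouten H x0 b e
     + 2 * th x0 a * schouten H x0 b c + th x0 b * schouten H x0 a c + th x0 c * schouten H x0 b a)
     + (pd a (fun y => th y b) x0 * th x0 c + th x0 b * pd a (fun y => th y c) x0)).
    rewrite (pd_local (g := fun y => tau y * (schouten H y b c + th y b * th y c)) a oA Ax0).
      apply: has_pdE; first exact: Ah.
      by apply: has_pdM; [exact: htau|apply: has_pdD; [exact: dP|apply: has_pdM; exact: hth]].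
    by move=> y Ay; exact: bot.
  have -> : \sum_e G x0 a b e * bot_slot (splittingL G tau) x0 e c =
      tau x0 * (\sum_e G x0 a b e * schouten H x0 e c + (\sum_e G x0 a b e * th x0 e) * th x0 c).
    under eq_bigr do rewrite bot//.
    by rewrite mulr_suml -big_split mulr_sumr /=; apply: eq_bigr => e _; ring.
  have -> : \sum_e G x0 a c e * bot_slot (splittingL G tau) x0 b e =
      tau x0 * (\sum_e G x0 a c e * schouten H x0 b e + (\sum_e G x0 a c e * th x0 e) * th x0 b).
    under eq_bigr do rewrite bot//.
    by rewrite mulr_suml -big_split mulr_sumr /=; apply: eq_bigr => e _; ring.
  rewrite bot// dt//.
  (* Once P^G is eliminated in favour of P^H, all terms cancel by pure algebra. *)
  have Eab : schouten G x0 a b = schouten H x0 a b +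
      (pd a (fun y => th y b) x0 - \sum_e G x0 a b e * th x0 e - th x0 a * th x0 b).
    by rewrite RH//; ring.
  have Eac : schouten G x0 a c = schouten H x0 a c +
      (pd a (fun y => th y c) x0 - \sum_e G x0 a c e * th x0 e - th x0 a * th x0 c).
    by rewrite RH//; ring.
  rewrite Eab Eac (symH x0 b a Ax0); ring.
Qed.

(** * Derivatives of determinants *)

Lemma has_pd_prod (I : eqType) (s : seq I) a (F : I -> tensor0 R n) x (l : I -> R) : uniq s ->
  (forall i, has_pd a (F i) x (l i)) ->
  has_pd a (fun y => \prod_(i <- s) F i y) x
    (\sum_(i <- s) \prod_(j <- s) (if j == i then l j else F j x)).
Proof.
move=> us H; elim: s us => [|i s IH] /=.
  move=> _; rewrite big_nil; have := has_pd_cst a x 1; congr has_pd.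
  by apply/funext => y; rewrite big_nil.
move=> /andP[nis us]; have := has_pdM (H i) (IH us).
have -> : (fun y => F i y * \prod_(j <- s) F j y) = (fun y => \prod_(j <- i :: s) F j y).
  by apply/funext => y; rewrite big_cons.
congr has_pd; rewrite big_cons big_cons eqxx; congr (_ * _ + _).
  by apply: eq_big_seq => j js; case: eqP => // ji; rewrite -ji js in nis.
rewrite mulr_sumr; apply: eq_big_seq => j js; rewrite big_cons.
by case: eqP => // ij; rewrite ij js in nis.
Qed.

(** Jacobi's formula: the product rule differentiates one row at a time, and expansion along that
    row produces the adjugate. *)
Lemma has_pd_det m a (F : X -> 'M[R]_m) (dF : 'M[R]_m) x :
  (forall i j, has_pd a (fun y => F y i j) x (dF i j)) ->
  has_pd a (fun y => \det (F y)) x (\tr (dF *m \adj (F x))).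
Proof.
move=> H.
pose Fi i : 'M[R]_m := \matrix_(k, l) if k == i then dF k l else F x k l.
have -> : \tr (dF *m \adj (F x)) = \sum_i \det (Fi i).
  rewrite /mxtrace; apply: eq_bigr => i _; rewrite (expand_det_row _ i) mxE.
  apply: eq_bigr => j _; rewrite !mxE eqxx; congr (_ * _); congr (_ * \det _).
  by apply/matrixP => k l; rewrite !mxE eq_sym (negPf (neq_lift i k)).
rewrite /determinant exchange_big /=; apply: has_pd_sum => s _.
rewrite -mulr_sumr; apply: has_pdZ.
have := has_pd_prod (index_enum_uniq _) (fun i => H i (s i)); congr has_pd.
apply: eq_bigr => i _; apply: eq_bigr => j _; rewrite mxE.
by case: eqP => // ->.
Qed.

(** Parallelism reads d_a g = N g + g N^T with [N] the matrix of Christoffel symbols in direction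
    [a]. As g times its adjugate is det g, each summand contributes tr N in Jacobi's formula. *)
Lemma pd_det_parallel A G t x a : relopen A -> smooth2 A t -> A x ->
  (forall b c, nabla2 0 G t x a b c = 0) ->
  has_pd a (fun y => \det (matrix_of t y)) x (2 * trG G x a * \det (matrix_of t x)).
Proof.
move=> oA st Ax pt.
pose N : 'M[R]_n.+1 := \matrix_(b, e) G x a b e.
set g := matrix_of t x.
have -> : 2 * trG G x a * \det g = \tr ((N *m g + g *m N^T) *m \adj g).
  rewrite mulmxDl mxtraceD -mulmxA mul_mx_adj [\tr (_ *m _ *m _)]mxtrace_mulC mulmxA mul_adj_mx.
  have -> : trG G x a = \tr N by apply: eq_bigr => c _; rewrite mxE.
  by rewrite mul_scalar_mx scalar_mxC mul_scalar_mx !mxtraceZ mxtrace_tr; ring.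
apply: has_pd_det => b c.
rewrite (_ : (fun y => _) = fun y => t y b c); last by apply/funext => y; rewrite mxE.
have := smooth_has_pd (a := a) (st b c) Ax.
congr has_pd; have := pt b c; rewrite /nabla2 !mul0r addr0 => /eqP.
rewrite subr_eq0 subr_eq => /eqP ->; rewrite !mxE [RHS]addrC; congr (_ + _).
  by apply: eq_bigr => e _; rewrite !mxE mulrC.
by apply: eq_bigr => e _; rewrite !mxE.
Qed.


End Tensors.

(** * Transformation of the Ricci tensor *)

Section Curvature.
Context {R : realType} {n : nat}.
Local Notation X := (coord_space R n).
Implicit Types (A B : set X) (f g : tensor0 R n) (x y : X) (a b c d e : 'I_n.+1).
Implicit Types (G H : tensor3 R n) (u th : tensor1 R n) (t : tensor2 R n).

Lemma addmx_coord m p (M N : 'M[R]_(m, p)) i j : (M + N) i j = M i j + N i j.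
Proof. by rewrite mxE. Qed.

Lemma oppmx_coord m p (M : 'M[R]_(m, p)) i j : (- M) i j = - M i j.
Proof. by rewrite mxE. Qed.

Lemma mulmx_coord m p q (M : 'M[R]_(m, p)) (N : 'M[R]_(p, q)) i j :
  (M *m N) i j = \sum_k M i k * N k j.
Proof. by rewrite mxE. Qed.

Definition pdm m p a (F : X -> 'M[R]_(m, p)) x : 'M[R]_(m, p) :=
  \matrix_(i, j) pd a (fun y => F y i j) x.

Lemma pdmE m p a (F : X -> 'M[R]_(m, p)) x i j : pdm a F x i j = pd a (fun y => F y i j) x.
Proof. by rewrite mxE. Qed.

Opaque pdm.

Lemma pdmM A m p q a (F : X -> 'M[R]_(m, p)) (K : X -> 'M[R]_(p, q)) x : relopen A -> A x ->
  (forall i j, smooth A (fun y => F y i j)) -> (forall i j, smooth A (fun y => K y i j)) ->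
  pdm a (fun y => F y *m K y) x = pdm a F x *m K x + F x *m pdm a K x.
Proof.
move=> oA Ax sF sK; apply/matrixP => i j; rewrite pdmE mxE [X in X + _]mxE [X in _ + X]mxE -big_split /=.
rewrite (_ : (fun y => _) = fun y => \sum_k F y i k * K y k j); last first.
  by apply/funext => y; rewrite mxE.
apply: has_pdE; first exact: (proj1 oA).
apply: has_pd_sum => k _; rewrite !pdmE.
by apply: has_pdM; [exact: smooth_has_pd (sF i k) Ax|exact: smooth_has_pd (sK k j) Ax].
Qed.

Lemma pdm_local A m p a (F K : X -> 'M[R]_(m, p)) x : relopen A -> A x ->
  (forall y, A y -> F y = K y) -> pdm a F x = pdm a K x.
Proof.
move=> oA Ax FK; apply/matrixP => i j; rewrite !pdmE.
by apply: (pd_local a oA Ax) => y Ay; rewrite FK.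
Qed.

Definition christoffel_mx G x a : 'M[R]_n.+1 := \matrix_(d, c) G x a d c.

(** Rows carry the lower and columns the upper index, so endomorphisms compose in the reverse order
    of the matrix product; hence the signs of the quadratic terms. *)
Definition curvature_mx G x a b : 'M[R]_n.+1 :=
  pdm a (fun y => christoffel_mx G y b) x - pdm b (fun y => christoffel_mx G y a) x
  + christoffel_mx G x b *m christoffel_mx G x a - christoffel_mx G x a *m christoffel_mx G x b.

Lemma ricci_curvature A G x b d : relopen A -> smooth3 A G -> torsion_free A G -> A x ->
  ricci G x b d = \sum_a curvature_mx G x a b d a.
Proof.
move=> oA sG tG Ax.
have -> : ricci G x b d = \sum_a (pd a (fun y => G y b d a) x - pd b (fun y => G y d a a) x
    + \sum_e (G x a e a * G x b d e - G x b e a * G x a d e)).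
  by rewrite /ricci (pd_trG b d oA sG Ax) -sumrB -big_split.
apply: eq_bigr => a _; rewrite /curvature_mx !addmx_coord !oppmx_coord !mulmx_coord !pdmE -[RHS]addrA; congr (_ - _ + _).
- by apply: (pd_local a oA Ax) => y Ay; rewrite mxE.
- by apply: (pd_local b oA Ax) => y Ay; rewrite mxE tG.
- rewrite sumrB; congr (_ - _); apply: eq_bigr => e _; rewrite !mxE mulrC //.
Qed.

(* Read as matrices, the Christoffel symbols transform as a gauge field, so the curvature is
   conjugated by the Jacobian. *)
Lemma ricci_transform A B G (G' : tensor3 R n) (phi : X -> X) x :
  let J y : 'M[R]_n.+1 := \matrix_(a, b) pd a (fun z => phi z ord0 b) y in
  relopen A -> relopen B -> (forall y, A y -> B (phi y)) ->
  (forall b, smooth A (fun y => phi y ord0 b)) ->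
  smooth3 A G -> torsion_free A G -> smooth3 B G' -> torsion_free B G' ->
  (forall y, A y -> forall a b k, \sum_c G y a b c * J y c k =
      pd a (pd b (fun z => phi z ord0 k)) y
      + \sum_l \sum_m G' (phi y) l m k * J y a l * J y b m) ->
  A x -> J x \in unitmx ->
  forall b d, ricci G x b d = \sum_k \sum_l ricci G' (phi x) k l * J x b k * J x d l.
Proof.
move=> J oA oB AB sphi sG tG sG' tG' law Ax uJ b d.
have Ah := proj1 oA.
have JE y i j : J y i j = pd i (fun z => phi z ord0 j) y by rewrite mxE.
clearbody J.
have [g gE] : exists g : X -> 'I_n.+1 -> 'M[R]_n.+1, christoffel_mx G = g by eexists.
have gE' y a i j : g y a i j = G y a i j by rewrite -gE mxE.
(* [gt] is the connection matrix of [G'] pulled back along [phi] as a matrix-valued one-form: only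
   the form index is transformed. *)
have [gt gtE] : exists gt : X -> 'I_n.+1 -> 'M[R]_n.+1,
    forall y a i j, gt y a i j = \sum_l J y a l * G' (phi y) l i j.
  by exists (fun y a => \matrix_(i, j) \sum_l J y a l * G' (phi y) l i j) => y a i j; rewrite mxE.
have sJ i j : smooth A (fun y => J y i j).
  by apply: (smooth_eq oA) (smooth_pd i (sphi j)) => y _; rewrite JE.
have sg a i j : smooth A (fun y => g y a i j).
  by apply: (smooth_eq oA) (sG a i j) => y _; rewrite gE'.
have sGphi l i j : smooth A (fun y => G' (phi y) l i j).
  exact: (smooth_comp (f := fun z => G' z l i j) oA oB AB).
have sgt a i j : smooth A (fun y => gt y a i j).
  apply: (smooth_eq oA (f := fun y => \sum_l J y a l * G' (phi y) l i j)).
    by move=> y _; rewrite gtE.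
  by apply: smooth_sum => // l _; apply: smoothM.
have gauge y a : A y -> g y a *m J y = pdm a J y + J y *m gt y a.
  move=> Ay; apply/matrixP => i k; rewrite addmx_coord !mulmx_coord pdmE.
  rewrite (_ : (fun z => J z i k) = pd i (fun z => phi z ord0 k)); last first.
    by apply/funext => z; rewrite JE.
  under eq_bigr do rewrite gE'.
  rewrite law//; congr (_ + _); rewrite exchange_big /=.
  apply: eq_bigr => m _; rewrite gtE mulr_sumr; apply: eq_bigr => l _; ring.
have sJJ a i j : smooth A (fun y => pdm a J y i j).
  by apply: (smooth_eq oA) (smooth_pd a (sJ i j)) => y _; rewrite pdmE.
have dJ a c : pdm a (pdm c J) x = pdm c (pdm a J) x.
  apply/matrixP => i j; rewrite [LHS]pdmE [RHS]pdmE.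
  transitivity (pd a (pd c (fun y => J y i j)) x).
    by congr (pd a _ x); apply/funext => y; rewrite pdmE.
  rewrite (smooth_pdC a c oA (sJ i j) Ax).
  by congr (pd c _ x); apply/funext => y; rewrite pdmE.
(* The derivative of the gauge relation. In the difference of this identity and the one with [a] and
   [c] exchanged, the second derivatives of [J] drop out by [dJ]. *)
have diff a c : pdm a (fun y => g y c) x *m J x + g x c *m pdm a J x =
    pdm a (pdm c J) x + (pdm a J x *m gt x c + J x *m pdm a (fun y => gt y c) x).
  rewrite -(pdmM a oA Ax (sg c) sJ) -(pdmM a oA Ax sJ (sgt c)).
  rewrite (pdm_local a oA Ax (fun y => gauge y c)).
  apply/matrixP => i j; rewrite addmx_coord !pdmE; apply: has_pdE; first exact: Ah.
  rewrite (_ : (fun y => _) = fun y => pdm c J y i j + (J y *m gt y c) i j); last first.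
    by apply/funext => y; rewrite addmx_coord.
  apply: has_pdD; first exact: smooth_has_pd (sJJ c i j) Ax.
  apply: (smooth_has_pd (A := A)) => //.
  apply: (smooth_eq oA (f := fun y => \sum_k J y i k * gt y c k j)) => [y _|]; first by rewrite mulmx_coord.
  by apply: smooth_sum => // k _; exact: smoothM.
have conj a c : curvature_mx G x a c *m J x = J x *m
   (pdm a (fun y => gt y c) x - pdm c (fun y => gt y a) x + gt x c *m gt x a - gt x a *m gt x c).
  have Da : pdm a J x = g x a *m J x - J x *m gt x a by rewrite gauge// addrK.
  have Dc : pdm c J x = g x c *m J x - J x *m gt x c by rewrite gauge// addrK.
  have := diff a c; have := diff c a; rewrite (dJ c a) Da Dc => E1 E2.
  rewrite /curvature_mx gE.
  have E3 : pdm a (fun y => g y c) x *m J x = pdm a (pdm c J) x +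
     ((g x a *m J x - J x *m gt x a) *m gt x c + J x *m pdm a (fun y => gt y c) x)
     - g x c *m (g x a *m J x - J x *m gt x a) by rewrite -E2 addrK.
  have E4 : pdm c (fun y => g y a) x *m J x = pdm a (pdm c J) x +
     ((g x c *m J x - J x *m gt x c) *m gt x a + J x *m pdm c (fun y => gt y a) x)
     - g x a *m (g x c *m J x - J x *m gt x c) by rewrite -E1 addrK.
  rewrite mulmxBl mulmxDl [(pdm _ _ _ - _) *m _]mulmxBl {}E3 {}E4.
  rewrite !(mulmxDl, mulmxDr, mulNmx, mulmxN) -!mulmxA.
  move: (pdm a (pdm c J) x) (g x a *m (J x *m gt x c)) (g x c *m (J x *m gt x a))
    (g x a *m (g x c *m J x)) (g x c *m (g x a *m J x)) (J x *m (gt x a *m gt x c))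
    (J x *m (gt x c *m gt x a)) (J x *m pdm a _ x) (J x *m pdm c _ x) => T1 T2 T3 T4 T5 T6 T7 T8 T9.
  by apply/matrixP => i j; rewrite !mxE; ring.
(* Exterior derivative commutes with pullback: the derivatives of the coefficients [J] are second
   derivatives of [phi] and cancel by symmetry. *)
have dgt a c : pdm a (fun y => gt y c) x - pdm c (fun y => gt y a) x =
    \sum_l \sum_m (J x a l * J x c m) *: (pdm l (fun z => christoffel_mx G' z m) (phi x)
       - pdm m (fun z => christoffel_mx G' z l) (phi x)).
  have Bphi := AB _ Ax.
  have dG m i j e : has_pd e (fun y => G' (phi y) m i j) x
      (\sum_l J x e l * pd l (fun z => G' z m i j) (phi x)).
    under eq_bigr do rewrite JE.
    apply: (@has_pd_comp R n B (fun z => G' z m i j) (fun l => pd l (fun z => G' z m i j)) phi e x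
      (fun l => pd e (fun z => phi z ord0 l) x)) => //.
    - exact: smooth_cont (sG' m i j).
    - by move=> l z Bz; exact: smooth_has_pd (sG' m i j) Bz.
    - by move=> l; apply: smooth_cont; apply: smooth_pd.
    - exact: Ah.
    - have [r r0 Hr] := proj2 oA x Ax; exists r => // h hr hh.
      by apply: (proj1 oB); apply: AB; apply: Hr => //; rewrite addrC addKr norm_scale_evec.
    - by move=> l; exact: smooth_has_pd (sphi l) Ax.
  have D e p i j : pd e (fun y => gt y p i j) x = \sum_m pd e (fun y => J y p m) x * G' (phi x) m i j
      + \sum_l \sum_m J x e l * J x p m * pd l (fun z => G' z m i j) (phi x).
    rewrite exchange_big -big_split /=.
    rewrite (_ : (fun y => _) = fun y => \sum_m J y p m * G' (phi y) m i j); last first.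
      by apply/funext => y; rewrite gtE.
    apply: has_pdE; first exact: Ah.
    apply: has_pd_sum => m _.
    have := has_pdM (smooth_has_pd (a := e) (sJ p m) Ax) (dG m i j e); congr (has_pd e _ x).
    by congr (_ + _); rewrite mulr_sumr; apply: eq_bigr => l _; ring.
  have JJ e p m : pd e (fun y => J y p m) x = pd p (fun y => J y e m) x.
    rewrite (_ : (fun y => J y p m) = pd p (fun z => phi z ord0 m)); last first.
      by apply/funext => z; rewrite JE.
    rewrite (smooth_pdC e p oA (sphi m) Ax); congr (pd p _ x).
    by apply/funext => z; rewrite JE.
  apply/matrixP => i j; rewrite summxE.
  have -> : (pdm a (gt^~ c) x - pdm c (gt^~ a) x) i j =
      pd a (fun y => gt y c i j) x - pd c (fun y => gt y a i j) x.
    by rewrite addmx_coord oppmx_coord !pdmE.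
  rewrite !D; under [X in _ - (X + _)]eq_bigr do rewrite JJ.
  rewrite [X in _ - (_ + X)]exchange_big opprD addrACA subrr add0r -sumrB.
  apply: eq_bigr => l _; rewrite summxE -sumrB; apply: eq_bigr => m _.
  rewrite [RHS]mxE addmx_coord oppmx_coord !pdmE.
  rewrite (_ : (fun y => christoffel_mx G' y m i j) = fun z => G' z m i j); last first.
    by apply/funext => z; rewrite mxE.
  rewrite (_ : (fun y => christoffel_mx G' y l i j) = fun z => G' z l i j); last first.
    by apply/funext => z; rewrite mxE.
  by ring.
have gtg a : gt x a = \sum_l J x a l *: christoffel_mx G' (phi x) l.
  by apply/matrixP => i j; rewrite gtE summxE; apply: eq_bigr => l _; rewrite !mxE.
have pull a c : curvature_mx G x a c *m J x =
    J x *m \sum_l \sum_m (J x a l * J x c m) *: curvature_mx G' (phi x) l m.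
  rewrite conj; congr (_ *m _); rewrite dgt !gtg !mulmx_suml.
  rewrite -addrA.
  have -> : \sum_l (J x c l *: christoffel_mx G' (phi x) l) *m (\sum_m J x a m *: christoffel_mx G' (phi x) m)
     = \sum_l \sum_m (J x a l * J x c m) *: (christoffel_mx G' (phi x) m *m christoffel_mx G' (phi x) l).
    rewrite exchange_big /=; apply: eq_bigr => m _; rewrite mulmx_sumr; apply: eq_bigr => l _.
    by rewrite -scalemxAl -scalemxAr scalerA mulrC.
  have -> : \sum_l (J x a l *: christoffel_mx G' (phi x) l) *m (\sum_m J x c m *: christoffel_mx G' (phi x) m)
     = \sum_l \sum_m (J x a l * J x c m) *: (christoffel_mx G' (phi x) l *m christoffel_mx G' (phi x) m).
    apply: eq_bigr => l _; rewrite mulmx_sumr; apply: eq_bigr => m _.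
    by rewrite -scalemxAl -scalemxAr scalerA.
  rewrite -sumrB -big_split /=; apply: eq_bigr => l _.
  rewrite -sumrB -big_split /=; apply: eq_bigr => m _.
  by rewrite -scalerBr -scalerDr /curvature_mx addrA.
rewrite (ricci_curvature b d oA sG tG Ax).
(* Conjugation leaves [J] on the left and its inverse on the right; the sum over [a] contracts that
   inverse with the Jacobian of the form index [a]. *)
have E a : curvature_mx G x a b d a = \sum_l \sum_m J x a l * J x b m *
    \sum_p \sum_q J x d p * curvature_mx G' (phi x) l m p q * invmx (J x) q a.
  have -> : curvature_mx G x a b = J x *m
      (\sum_l \sum_m (J x a l * J x b m) *: curvature_mx G' (phi x) l m) *m invmx (J x).
    by rewrite -pull mulmxK.
  rewrite mulmx_sumr mulmx_suml summxE; apply: eq_bigr => l _.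
  rewrite mulmx_sumr mulmx_suml summxE; apply: eq_bigr => m _.
  rewrite -scalemxAr -scalemxAl [LHS]mxE; congr (_ * _).
  rewrite mulmx_coord exchange_big /=; apply: eq_bigr => q _.
  by rewrite mulmx_coord mulr_suml.
transitivity (\sum_m \sum_p J x b m * J x d p *
   \sum_l \sum_q curvature_mx G' (phi x) l m p q * \sum_a invmx (J x) q a * J x a l).
  under eq_bigr do rewrite E.
  have R4 (F : 'I_n.+1 -> 'I_n.+1 -> 'I_n.+1 -> 'I_n.+1 -> 'I_n.+1 -> R) :
    \sum_a \sum_l \sum_m \sum_p \sum_q F a l m p q = \sum_m \sum_p \sum_l \sum_q \sum_a F a l m p q.
    transitivity (\sum_l \sum_m \sum_p \sum_q \sum_a F a l m p q).
      rewrite exchange_big; apply: eq_bigr => l _; rewrite exchange_big; apply: eq_bigr => m _.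
      by rewrite exchange_big; apply: eq_bigr => p _; rewrite exchange_big.
    rewrite exchange_big; apply: eq_bigr => m _; exact: exchange_big.
  transitivity (\sum_a \sum_l \sum_m \sum_p \sum_q
     J x b m * J x d p * (curvature_mx G' (phi x) l m p q * (invmx (J x) q a * J x a l))).
    apply: eq_bigr => a _; apply: eq_bigr => l _; apply: eq_bigr => m _.
    rewrite mulr_sumr; apply: eq_bigr => p _; rewrite mulr_sumr; apply: eq_bigr => q _; ring.
  rewrite R4; apply: eq_bigr => m _; apply: eq_bigr => p _; rewrite mulr_sumr.
  apply: eq_bigr => l _; rewrite mulr_sumr; apply: eq_bigr => q _.
  by rewrite !mulr_sumr.
apply: eq_bigr => m _; apply: eq_bigr => p _.
rewrite (ricci_curvature m p oB sG' tG' (AB _ Ax)) -[RHS]mulrA [RHS]mulrC; congr (_ * _).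
have inv q l : \sum_a invmx (J x) q a * J x a l = (q == l)%:R.
  by rewrite -mulmx_coord mulVmx// mxE.
apply: eq_bigr => l _; under eq_bigr do rewrite inv.
exact: sum_delta'.
Qed.

End Curvature.

(** * Charts *)

Section Manifold.
Context {R : realType} {n : nat} (M : bmanifold R n).
Local Notation X := (coord_space R n).
Implicit Types (W U : set M) (i j k : atlas_index M) (x y : X) (p q : M).

Lemma chart_im_cmap i W p : cdom (charts i) p -> W p -> chart_im i W (cmap (charts i) p).
Proof. by move=> ? ?; exists p. Qed.

Lemma chart_imP i W x : chart_im i W x ->
  [/\ cdom (charts i) (cinv (charts i) x), W (cinv (charts i) x)
    & cmap (charts i) (cinv (charts i) x) = x].
Proof. by move=> [p [ip Wp] <-]; rewrite cmapK. Qed.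

Lemma chart_im_sub i U W : U `<=` W -> chart_im i U `<=` chart_im i W.
Proof. by move=> UW x [p [ip Up] <-]; exists p => //; split=> //; exact: UW. Qed.

Lemma relopen_chart_im i W : open W -> relopen (chart_im i W).
Proof.
move=> oW; have [V oV imV] := cmap_image (charts i).
split=> [x [p [ip _] <-]|x Wx].
  suff : (V `&` halfspace) (cmap (charts i) p) by case.
  by rewrite -imV; exists p.
have [ip Wp xE] := chart_imP Wx.
have imx : (cmap (charts i) @` cdom (charts i)) x by exists (cinv (charts i) x).
have /subspace_continuousP/(_ x imx) := @cinv_continuous _ _ _ (charts i).
have nW : nbhs (cinv (charts i) x) (W `&` cdom (charts i)).
  by apply: open_nbhs_nbhs; split=> //; apply: openI => //; exact: cdom_open.
move=> /(_ _ nW) H0.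
have /nbhs_ballP[r1 /= r10 H1] : nbhs x (fun y => (cmap (charts i) @` cdom (charts i)) y ->
    (W `&` cdom (charts i)) (cinv (charts i) y)) := H0.
have Vx : V x by have : (V `&` halfspace) x; [rewrite -imV|case].
have /nbhs_ballP[r2 /= r20 H2] := open_nbhs_nbhs (conj oV Vx).
exists (Num.min r1 r2); first by rewrite lt_min r10.
move=> y hy; rewrite lt_min => /andP[y1 y2].
have imy : (cmap (charts i) @` cdom (charts i)) y.
  by rewrite imV; split=> //; apply: H2; rewrite -ball_normE /ball_ /= distrC.
have [Wy iy] : (W `&` cdom (charts i)) (cinv (charts i) y).
  by apply: H1 => //; rewrite -ball_normE /ball_ /= distrC.
by exists (cinv (charts i) y) => //; case: imy => q iq <-; rewrite cmapK.
Qed.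

(** Turns half-balls of a chart into open neighbourhoods in the manifold, which include boundary
    points. *)
Lemma open_preimage i (B : set X) : relopen B -> B `<=` chart_im i setT ->
  open (cdom (charts i) `&` [set q | B (cmap (charts i) q)]).
Proof.
move=> oB BT; rewrite openE => p [ip Bp]; rewrite /interior.
have /subspace_continuousP/(_ p ip) := @cmap_continuous _ _ _ (charts i).
have [r r0 Hr] := proj2 oB _ Bp.
have nb : nbhs (cmap (charts i) p) [set y | `|y - cmap (charts i) p| < r].
  by apply/nbhs_ballP; exists r => // y; rewrite -ball_normE /ball_ /= distrC.
move=> /(_ _ nb) H0.
have H : nbhs p (fun q => cdom (charts i) q -> `|cmap (charts i) q - cmap (charts i) p| < r) := H0.
have nd : nbhs p (cdom (charts i)) by apply: open_nbhs_nbhs; split=> //; exact: cdom_open.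
apply: filterS (filterI nd H) => q [iq /(_ iq) Hq]; split=> //.
apply: Hr; last exact: Hq.
have : chart_im i setT (cmap (charts i) q) by exact: chart_im_cmap.
exact: (proj1 (relopen_chart_im i openT)).
Qed.

Lemma transition_id i W x : chart_im i W x -> transition i i x = x.
Proof. by move=> /chart_imP[]. Qed.

Lemma overlap_transition i j W x : overlap i j W x -> overlap j i W (transition i j x).
Proof.
by move=> /chart_imP[ip [jp Wp] _]; apply: chart_im_cmap.
Qed.

Lemma transitionK i j k x : overlap i j setT x ->
  transition j k (transition i j x) = transition i k x.
Proof. by move=> /chart_imP[ip [jp _] _]; rewrite /transition cmapK. Qed.

Lemma smooth_transition i j W b : open W ->
  smooth (overlap i j W) (fun y => transition i j y ord0 b).
Proof.
move=> oW; apply: smooth_sub (charts_smooth i j b).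
  by apply: relopen_chart_im; exact: cdom_open.
by apply: chart_im_sub => p [].
Qed.

Lemma relopen_overlap i j W : open W -> relopen (overlap i j W).
Proof. by move=> oW; apply: relopen_chart_im; apply: openI => //; exact: cdom_open. Qed.

Lemma smooth_transition_comp i j W (f : tensor0 R n) : open W -> smooth (chart_im j W) f ->
  smooth (overlap i j W) (fun y => f (transition i j y)).
Proof.
move=> oW sf; apply: (smooth_comp (B := chart_im j W)) => //.
- exact: relopen_overlap.
- exact: relopen_chart_im.
- move=> x /overlap_transition; apply: chart_im_sub => q [] //.
- by move=> b; exact: smooth_transition.
Qed.

Lemma has_pd_transition i j W (f : tensor0 R n) a x : open W -> smooth (chart_im j W) f ->
  overlap i j W x ->
  has_pd a (fun y => f (transition i j y)) x (\sum_b jac i j x a b * pd b f (transition i j x)).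
Proof.
move=> oW sf Ox.
have oO := relopen_overlap i j oW; have oI := relopen_chart_im j oW.
have OI y : overlap i j W y -> chart_im j W (transition i j y).
  by move=> /overlap_transition; apply: chart_im_sub => q [].
under eq_bigr do rewrite mxE.
apply: (@has_pd_comp R n (chart_im j W) f (fun b => pd b f) _ a x
  (fun b => pd a (fun y => transition i j y ord0 b) x)) => //.
- exact: OI.
- exact: smooth_cont.
- by move=> b z; exact: smooth_has_pd.
- by move=> b; apply: smooth_cont; exact: smooth_pd.
- exact: (proj1 oO).
- have [r r0 Hr] := proj2 oO x Ox; exists r => // h hr hh.
  by apply: (proj1 oI); apply: OI; apply: Hr => //; rewrite addrC addKr norm_scale_evec.
- by move=> b; exact: smooth_has_pd (smooth_transition i j b oW) Ox.
Qed.

Lemma overlap_T i j W x : overlap i j W x -> overlap i j setT x.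
Proof. by apply: chart_im_sub => q []. Qed.

Lemma jac_cocycle i j k x : overlap i j (cdom (charts k)) x ->
  jac i k x = jac i j x *m jac j k (transition i j x).
Proof.
move=> Ox; have ok := cdom_open (charts k); apply/matrixP => a b; rewrite mulmx_coord mxE.
have oO := relopen_overlap i j ok.
rewrite -(pd_local a oO Ox (f := fun y => transition j k (transition i j y) ord0 b)); last first.
  by move=> y /overlap_T/(transitionK k) ->.
have sf : smooth (chart_im j (cdom (charts k))) (fun y => transition j k y ord0 b).
  exact: charts_smooth.
rewrite (has_pdE (proj1 oO _ Ox) (has_pd_transition (a := a) ok sf Ox)).
by apply: eq_bigr => c _; congr (_ * _); rewrite mxE.
Qed.

Lemma jac_id i W x : chart_im i W x -> jac i i x = 1%:M.
Proof.
move=> /(chart_im_sub (@subsetT _ W)) Tx; have oT := relopen_chart_im i (@openT M).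
apply/matrixP => a b; rewrite !mxE.
rewrite (pd_local (g := fun y => y ord0 b) a oT Tx); last by move=> y /transition_id ->.
apply: has_pdE; first exact: (proj1 oT).
apply/has_pdP => e e0; exists 1 => // h _ _.
have -> : (x + h *: evec a) ord0 b = x ord0 b + h * (a == b)%:R.
  by rewrite mxE [X in _ + X]mxE evecE.
rewrite (_ : _ - _ - _ = 0) ?normr0; last by ring.
by rewrite mulr_ge0// ltW.
Qed.

Lemma jacV i j x : overlap i j setT x -> jac i j x *m jac j i (transition i j x) = 1%:M.
Proof.
move=> Ox; rewrite -jac_cocycle; first exact: jac_id Ox.
by move: Ox; rewrite /overlap => -[p [ip [jp _]] <-]; apply: chart_im_cmap.
Qed.

Lemma jac_unit i j x : overlap i j setT x -> jac i j x \in unitmx.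
Proof. by move=> /jacV /mulmx1_unit[]. Qed.

Lemma smooth_jac i j W a b : open W -> smooth (overlap i j W) (fun x => jac i j x a b).
Proof.
move=> oW; apply: (smooth_eq (relopen_overlap i j oW)) (smooth_pd a (smooth_transition i j b oW)).
by move=> y _; rewrite mxE.
Qed.

(* If the point were interior in the second chart, the 0-th coordinate of the transition map would
   have a local minimum there, and its Jacobian would be singular. *)
Lemma bdry_chart i p : cdom (charts i) p -> (bdry M p <-> cmap (charts i) p ord0 ord0 = 0).
Proof.
move=> ip; split; last by move=> E; exists i.
move=> [j jp E]; apply/eqP; case: eqP => // /eqP ne; exfalso.
set x := cmap (charts i) p in ne *.
have oO := relopen_overlap i j (@openT M).
have Ox : overlap i j setT x by apply: chart_im_cmap.
have hx : 0 <= x ord0 ord0 := proj1 oO x Ox.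
have x0 : 0 < x ord0 ord0 by rewrite lt_neqAle eq_sym ne.
have tx : transition i j x ord0 ord0 = 0 by rewrite /transition cmapK.
have Z a : jac i j x a ord0 = 0.
  rewrite mxE; apply: has_pdE => //.
  have /has_pdP H := smooth_has_pd (a := a) (smooth_transition i j ord0 (@openT M)) Ox.
  suff E0 : pd a (fun y => transition i j y ord0 ord0) x = 0.
    by rewrite -E0; exact: smooth_has_pd (smooth_transition i j ord0 (@openT M)) Ox.
  set l := pd _ _ _ in H *.
  apply/eqP; rewrite -normr_le0; apply/ler_addgt0Pl => e e0; rewrite addr0.
  have [d d0 Hd] := H e e0; have [r r0 Hr] := proj2 oO x Ox.
  have [h [h0 hd hr hx']] : exists h : R, [/\ 0 < h, h < d, h < r & h < x ord0 ord0].
    pose m := Num.min d (Num.min r (x ord0 ord0)).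
    have m0 : 0 < m by rewrite !lt_min d0 r0.
    have : m / 2 < m by rewrite ltr_pdivrMr// mulr2n mulrDr mulr1 ltrDl.
    by rewrite [in X in _ < X]/m !lt_min => /and3P[? ? ?]; exists (m / 2); rewrite divr_gt0.
  (* Both [h] and [- h] are admissible since [x] is off the face in chart [i], and the other chart
     has non-negative 0-th coordinate at both points; this forces [|l| <= e]. *)
  have step s : `|s| = h -> `|transition i j (x + s *: evec a) ord0 ord0 - s * l| <= e * h /\
      0 <= transition i j (x + s *: evec a) ord0 ord0.
    move=> sh; have hs : halfspace (x + s *: evec a).
      rewrite /halfspace /= mxE [X in _ + X]mxE evecE.
      have : - h <= s by rewrite -sh lerNl -normrN ler_norm.
      by case: (a == ord0); rewrite ?mulr1 ?mulr0; lra.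
    have := Hd s; rewrite sh => /(_ hd hs); rewrite tx subr0; split=> //.
    have : overlap i j setT (x + s *: evec a).
      by apply: Hr => //; rewrite addrC addKr norm_scale_evec sh.
    by move=> /overlap_transition; exact: (proj1 (relopen_overlap j i (@openT M))).
  have [] := step h (gtr0_norm h0).
  have [] := step (- h) (etrans (normrN h) (gtr0_norm h0)).
  rewrite !ler_norml => /andP[a1 a2] a3 /andP[b1 b2] b3.
  by rewrite -(ler_pM2r h0); case: (lerP 0 l) => l0; nra.
have /jacV := overlap_transition Ox; rewrite (transitionK i Ox) (transition_id (W := setT)); last first.
  exact: chart_im_cmap.
move=> /matrixP/(_ ord0 ord0); rewrite mulmx_coord [RHS]mxE eqxx big1; last by move=> a _; rewrite Z mulr0.
by move=> /eqP; rewrite eq_sym oner_eq0.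
Qed.

Lemma inner_chart i p : cdom (charts i) p -> (inner M p <-> 0 < cmap (charts i) p ord0 ord0).
Proof.
move=> ip; rewrite /inner /setC /= (bdry_chart ip).
have h : 0 <= cmap (charts i) p ord0 ord0.
  by apply: (proj1 (relopen_chart_im i (@openT M))); exact: chart_im_cmap.
split=> [/eqP ne|/lt0r_neq0/eqP//]; by rewrite lt_neqAle eq_sym ne.
Qed.

Lemma chart_im_inner i W : chart_im i (W `&` inner M) = chart_im i W `&` pos_part.
Proof.
apply/seteqP; split=> [_ [p [ip [Wp /(inner_chart ip) pp]] <-]|_ [[p [ip Wp] <-] pp]].
  by split=> //; exact: chart_im_cmap.
by apply: chart_im_cmap => //; split=> //; apply/(inner_chart ip).
Qed.

Lemma chart_im_innerT i : chart_im i (inner M) = chart_im i setT `&` pos_part.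
Proof. by rewrite -chart_im_inner setTI. Qed.

Lemma open_inner : open (inner M).
Proof.
rewrite openE => p ip; have [i di] := charts_cover p.
have oB : relopen (chart_im i setT `&` pos_part).
  by apply: relopenI; [exact/relopen_chart_im/openT|exact: relopen_pos].
have := open_preimage oB (@subIsetl _ _ _); rewrite openE => /(_ p) H.
have /H : (cdom (charts i) `&` [set q | (chart_im i setT `&` pos_part) (cmap (charts i) q)]) p.
  by split=> //; split; [exact: chart_im_cmap|exact/(inner_chart di)].
by apply: filterS => q [iq [_ /(inner_chart iq)]].
Qed.


(** * Connections and one-forms over all charts *)

Lemma proj_change_proj_change (G : tensor3 R n) u v x a b c :
  proj_change (proj_change G u) v x a b c = proj_change G (fun y e => u y e + v y e) x a b c.
Proof. by rewrite !proj_changeE; ring. Qed.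

Lemma is_connection_sub U W G : open W -> U `<=` W -> is_connection W G -> is_connection U G.
Proof.
move=> oW UW [sG tG lG]; split.
- by move=> i a b c; apply: smooth_sub (sG i a b c); [exact: relopen_chart_im|exact: chart_im_sub].
- by move=> i x /(chart_im_sub UW); exact: tG.
- by move=> i j x Ox; apply: lG; apply: chart_im_sub Ox => p [ip /UW].
Qed.

Lemma is_oneform_sub U W u : open W -> U `<=` W -> is_oneform W u -> is_oneform U u.
Proof.
move=> oW UW [su lu]; split.
- by move=> i a; apply: smooth_sub (su i a); [exact: relopen_chart_im|exact: chart_im_sub].
- by move=> i j x Ox; apply: lu; apply: chart_im_sub Ox => p [ip /UW].
Qed.

Lemma is_oneformD W u v : open W -> is_oneform W u -> is_oneform W v ->
  is_oneform W (fun i x a => u i x a + v i x a).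
Proof.
move=> oW [su lu] [sv lv]; split.
- by move=> i a; apply: smoothD => //; exact: relopen_chart_im.
- move=> i j x Ox a; rewrite (lu i j x Ox) (lv i j x Ox) -big_split /=.
  by apply: eq_bigr => b _; rewrite -mulrDl.
Qed.

Lemma is_oneformN W u : open W -> is_oneform W u -> is_oneform W (fun i x a => - u i x a).
Proof.
move=> oW [su lu]; split.
- by move=> i a; apply: smoothN => //; exact: relopen_chart_im.
- move=> i j x Ox a; rewrite (lu i j x Ox) -sumrN.
  by apply: eq_bigr => b _; rewrite mulNr.
Qed.

Lemma proj_change_connection W G u : open W -> is_connection W G -> is_oneform W u ->
  is_connection W (fun i => proj_change (G i) (u i)).
Proof.
move=> oW [sG tG lG] [su lu]; split.
- by move=> i a b c; apply: smooth_proj_change => //; exact: relopen_chart_im.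
- by move=> i x Wx a b c; rewrite !proj_changeE tG//; ring.
- move=> i j x Ox a b k; have L := lG i j x Ox a b k.
  transitivity (\sum_c (G i x a b c * jac i j x c k + u i x a * jac i j x c k * (b == c)%:R
      + u i x b * jac i j x c k * (a == c)%:R)).
    by apply: eq_bigr => c _; rewrite proj_changeE; ring.
  rewrite !big_split /= !sum_delta L -!addrA; congr (_ + _).
  rewrite (lu i j x Ox a) (lu i j x Ox b).
  transitivity (\sum_l (\sum_m G j (transition i j x) l m k * jac i j x a l * jac i j x b m
      + u j (transition i j x) l * jac i j x a l * jac i j x b k
      + (\sum_m u j (transition i j x) m * jac i j x b m) * jac i j x a l * (l == k)%:R)).
    rewrite !big_split /= sum_delta' -mulr_suml -!addrA; congr (_ + (_ + _)).
  apply: eq_bigr => l _.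
  transitivity (\sum_m (G j (transition i j x) l m k * jac i j x a l * jac i j x b m
      + u j (transition i j x) l * jac i j x a l * jac i j x b m * (m == k)%:R
      + u j (transition i j x) m * jac i j x b m * (jac i j x a l * (l == k)%:R))).
    by rewrite !big_split /= sum_delta' -!mulr_suml mulrA.
  by apply: eq_bigr => m _; rewrite proj_changeE; ring.
Qed.

(** A global one-form is a family over the whole atlas. This is the family generated by a single
    representative [v] in chart [i], meaningful on sets inside the domain of that chart. *)
Definition transport i (v : tensor1 R n) j : tensor1 R n :=
  fun x a => \sum_b v (transition j i x) b * jac j i x a b.

Lemma transport_self i W v x a : chart_im i W x -> transport i v i x a = v x a.
Proof.
move=> Wx; rewrite /transport (transition_id Wx) (jac_id Wx).
by under eq_bigr do rewrite mxE; exact: sum_delta.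
Qed.

Lemma overlap_sub i j W : W `<=` cdom (charts j) -> overlap i j W = chart_im i W.
Proof. by move=> Wj; congr chart_im; apply/setIidPr. Qed.

Lemma transport_oneform i W v : open W -> W `<=` cdom (charts i) ->
  smooth1 (chart_im i W) v -> is_oneform W (transport i v).
Proof.
move=> oW Wi sv; split.
- move=> j a; rewrite -(overlap_sub j Wi); have oO := relopen_overlap j i oW.
  apply: smooth_sum => // b _; apply: smoothM => //; last exact: smooth_jac.
  exact: (smooth_transition_comp j oW (sv b)).
- move=> j k x Ox a.
  have Ox' : overlap j k (cdom (charts i)) x by apply: chart_im_sub Ox => p [? /Wi].
  rewrite /transport (transitionK i (overlap_T Ox)).
  transitivity (\sum_c v (transition j i x) c * (jac j k x *m jac k i (transition j k x)) a c).
    by apply: eq_bigr => c _; rewrite -jac_cocycle.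
  under eq_bigr do rewrite mulmx_coord mulr_sumr.
  rewrite exchange_big; apply: eq_bigr => b _; rewrite mulr_suml.
  by apply: eq_bigr => c _; ring.
Qed.

Lemma oneform_ext i W u v : W `<=` cdom (charts i) -> is_oneform W u -> is_oneform W v ->
  (forall x a, chart_im i W x -> u i x a = v i x a) ->
  forall j x a, chart_im j W x -> u j x a = v j x a.
Proof.
move=> Wi [_ lu] [_ lv] E j x a; rewrite -(overlap_sub j Wi) => Ox.
rewrite (lu j i x Ox) (lv j i x Ox); apply: eq_bigr => b _; rewrite E//.
by have := overlap_transition Ox; apply: chart_im_sub => p [].
Qed.

Lemma pd_transport i j W f x a : open W -> W `<=` cdom (charts i) -> smooth (chart_im i W) f ->
  chart_im j W x -> pd a (fun y => f (transition j i y)) x = transport i (fun y b => pd b f y) j x a.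
Proof.
move=> oW Wi sf; rewrite -(overlap_sub j Wi) => Ox.
rewrite (has_pdE _ (has_pd_transition (a := a) oW sf Ox)).
  by apply: eq_bigr => b _; rewrite mulrC.
exact: (proj1 (relopen_overlap j i oW)).
Qed.

Lemma ricci_chart_transform W G i j x : open W -> is_connection W G -> overlap i j W x ->
  forall a b, ricci (G i) x a b =
    \sum_k \sum_l ricci (G j) (transition i j x) k l * jac i j x a k * jac i j x b l.
Proof.
move=> oW [sG tG lG] Ox a b.
have sub k : overlap i j W `<=` chart_im i W by apply: chart_im_sub => p [].
have oI := relopen_chart_im i oW.
apply: (@ricci_transform R n (overlap i j W) (chart_im j W)) => //.
- exact: relopen_overlap.
- exact: relopen_chart_im.
- by move=> y /overlap_transition; apply: chart_im_sub => p [].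
- by move=> c; exact: smooth_transition.
- by move=> c d e; apply: smooth_sub (sG i c d e) => //; exact: sub.
- by move=> y /(sub j) Wy c d e; exact: tG.
- by move=> y Wy c d e; exact: tG.
- by move=> y; exact: lG.
- exact: jac_unit (overlap_T Ox).
Qed.

End Manifold.

(** * Behaviour of the density near a boundary point *)

Section Boundary.
Context {R : realType} {n : nat}.
Local Notation X := (coord_space R n).
Implicit Types (A B : set X) (f g : tensor0 R n) (x y : X) (a b c d e : 'I_n.+1).
Implicit Types (G H : tensor3 R n) (u th : tensor1 R n) (t : tensor2 R n).

Definition preserves_on A G (kappa : tensor0 R n) :=
  [/\ smooth A kappa, forall x, A x -> 0 < kappa x
    & forall x, A x -> forall a, nabla0 (- n.+2%:R) G kappa x a = 0].

Lemma pd_volume A G kappa x a : preserves_on A G kappa -> A x ->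
  pd a kappa x = trG G x a * kappa x.
Proof.
move=> [_ _ /(_ x)H] /H/(_ a)/eqP; rewrite /nabla0 mulNr divff ?pnatr_eq0// mulN1r mulNr subr_eq0.
by move/eqP.
Qed.

Lemma has_pd_powR_volume A G kappa (p : R) x a : preserves_on A G kappa -> A x ->
  has_pd a (fun y => kappa y `^ p) x (p * trG G x a * kappa x `^ p).
Proof.
move=> pk Ax; have [sk k0 _] := pk.
have -> : p * trG G x a * kappa x `^ p = p * kappa x `^ (p - 1) * pd a kappa x.
  have -> : kappa x `^ p = kappa x `^ (p - 1) * kappa x.
    rewrite -[X in _ = _ * X](powRr1 (ltW (k0 x Ax))) -powRD ?subrK//.
    by apply/implyP => _; exact: lt0r_neq0 (k0 x Ax).
  by rewrite (pd_volume a pk Ax); ring.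
apply: (@has_pd_comp1 _ _ (fun s => s `^ p)); last exact: smooth_has_pd sk Ax.
exact/is_derive1_powR/k0.
Qed.

(** The trace equals d log kappa; symmetry of the second derivatives of [kappa] gives closedness. *)
Lemma closed_trG A G kappa : relopen A -> smooth3 A G -> preserves_on A G kappa ->
  closed1 A (trG G).
Proof.
move=> oA sG pk x Ax a b; have [sk k0 _] := pk; have hx := proj1 oA x Ax.
have D c d : pd c (pd d kappa) x = pd c (fun y => trG G y d) x * kappa x + trG G x d * (trG G x c * kappa x).
  rewrite -(pd_volume c pk Ax).
  rewrite (pd_local (g := fun y => trG G y d * kappa y) c oA Ax); last by move=> y /(pd_volume d pk).
  apply: has_pdE => //; apply: has_pdM; last exact: smooth_has_pd sk Ax.
  exact: smooth_has_pd (smooth_trG oA sG d) Ax.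
have := smooth_pdC a b oA sk Ax; rewrite !D => E.
apply: (mulIf (lt0r_neq0 (k0 x Ax))); move: E; rewrite [trG G x b * _]mulrCA => E.
exact: addIr E.
Qed.

(** The two traces differ by (n+2) [th]. *)
Lemma closed_proj_change A G H th : relopen A -> smooth3 A G -> smooth1 A th ->
  (forall x, A x -> forall a b c, H x a b c = proj_change G th x a b c) ->
  closed1 A (trG G) -> closed1 A (trG H) -> closed1 A th.
Proof.
move=> oA sG sth HG cG cH x Ax a b.
have D c d : pd c (fun y => trG H y d) x =
    pd c (fun y => trG G y d) x + n.+2%:R * pd c (fun y => th y d) x.
  rewrite (pd_local (g := fun y => trG G y d + n.+2%:R * th y d) c oA Ax); last first.
    by move=> y Ay; rewrite -trG_proj_change; apply: eq_bigr => e _; exact: HG.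
  apply: has_pdE; first exact: (proj1 oA).
  apply: has_pdD; first exact: smooth_has_pd (smooth_trG oA sG d) Ax.
  by apply: has_pdZ; exact: smooth_has_pd (sth d) Ax.
have n2 : n.+2%:R != 0 :> R by rewrite pnatr_eq0.
by apply: (mulfI n2); have := cH x Ax a b; rewrite !D (cG x Ax a b) => /addrI.
Qed.

(** The power of [kappa] is [H]-parallel, and on weight 2 the two connections differ by 2/(n+2)
    times the difference (n+2) [th] of their traces. *)
Lemma nabla0_density A G H th kappa x a : relopen A -> preserves_on A H kappa ->
  (forall x, A x -> forall a b c, H x a b c = proj_change G th x a b c) -> A x ->
  nabla0 2 G (fun y => kappa y `^ (- 2 / n.+2%:R)) x a =
  - 2 * th x a * kappa x `^ (- 2 / n.+2%:R).
Proof.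
move=> oA pk HG Ax; rewrite /nabla0 (has_pdE (proj1 oA x Ax) (has_pd_powR_volume (a := a) pk Ax)).
have -> : trG H x a = trG G x a + n.+2%:R * th x a.
  by rewrite -trG_proj_change; apply: eq_bigr => c _; exact: HG.
have n2 : n.+2%:R != 0 :> R by rewrite pnatr_eq0.
by move: (_ `^ _) => k; field.
Qed.

(* The density is |det g|^(1/2), written as a power of a positive smooth function. *)
Lemma metric_volume A G t : relopen A -> smooth2 A t ->
  (forall x, A x -> \det (matrix_of t x) != 0) ->
  (forall x, A x -> forall a b c, nabla2 0 G t x a b c = 0) ->
  preserves_on A G (fun x => (\det (matrix_of t x) ^+ 2) `^ 4^-1).
Proof.
move=> oA st d0 pt.
have D0 x : A x -> 0 < \det (matrix_of t x) ^+ 2.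
  by move=> /d0 ne; rewrite lt_neqAle sqr_ge0 eq_sym sqrf_eq0 ne.
have sd : smooth A (fun x => \det (matrix_of t x)).
  apply: smooth_det => // i j; apply: smooth_eq (st i j) => // y _; by rewrite mxE.
split.
- apply: smooth_powR => //.
  by apply: (smooth_eq oA) (smoothM oA sd sd) => y _; rewrite expr2.
- by move=> x /D0; exact: powR_gt0.
- move=> x Ax a; have hx := proj1 oA x Ax.
  have E := pd_det_parallel (a := a) oA st Ax (pt x Ax a).
  have E2 : has_pd a (fun y => \det (matrix_of t y) ^+ 2) x
      (4 * trG G x a * \det (matrix_of t x) ^+ 2).
    have := has_pdM E E; congr (has_pd a _ x); last by rewrite expr2; ring.
  have := has_pd_comp1 (is_derive1_powR 4^-1 (D0 x Ax)) E2 => /(has_pdE hx).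
  rewrite /nabla0 => ->; set D := _ ^+ 2 in D0 *.
  have Dx : 0 < D by exact: D0.
  have -> : D `^ 4^-1 = D `^ (4^-1 - 1) * D.
    rewrite -[X in _ = _ * X](powRr1 (ltW Dx)) -powRD ?subrK//.
    by apply/implyP => _; exact: lt0r_neq0.
  have n2 : n.+2%:R != 0 :> R by rewrite pnatr_eq0.
  by move: (_ `^ _) => k; field.
Qed.

(** In the splitting of the connection itself the form is block diagonal with blocks tau and tau P.
    The unipotent [U] carries out the half of this change of splitting that already makes the matrix
    triangular. *)
Lemma det_tractor (tau : R) (th : 'rV[R]_n.+1) (P : 'M[R]_n.+1) :
  \det (block_mx tau%:M (- tau *: th) (- tau *: th^T) (tau *: (P + th^T *m th)) : 'M[R]_(1 + n.+1))
  = tau ^+ n.+2 * \det P.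
Proof.
set S := block_mx _ _ _ _; pose U : 'M[R]_(1 + n.+1) := block_mx 1%:M 0 th^T 1%:M.
have -> : \det S = \det (U *m S) by rewrite det_mulmx det_lblock !det1 !mul1r.
rewrite mulmx_block !mul1mx !mul0mx !addr0.
have -> : th^T *m tau%:M + - tau *: th^T = 0 by rewrite mul_mx_scalar scaleNr subrr.
have -> : th^T *m (- tau *: th) + tau *: (P + th^T *m th) = tau *: P.
  by rewrite -scalemxAr scalerDr scaleNr addrCA addNr addr0.
by rewrite det_ublock det_scalar1 detZ [tau ^+ n.+2]exprS mulrA.
Qed.


(** All weight terms are multiples of the trace, so the parallel equation, solved for the
    derivatives, is a linear system in the slots. *)
Lemma parallel_trace_free G (s : @s2tractor R n) x :
  (forall a, trG G x a = 0) ->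
  (forall a, nablaS2_top G s x a = 0) -> (forall a b, nablaS2_mid G s x a b = 0) ->
  (forall a b c, nablaS2_bot G s x a b c = 0) ->
  [/\ forall a, pd a (top_slot s) x = 2 * mid_slot s x a,
      forall a b, pd a (fun y => mid_slot s y b) x = \sum_e G x a b e * mid_slot s x e
        - schouten G x a b * top_slot s x + bot_slot s x a b
    & forall a b c, pd a (fun y => bot_slot s y b c) x =
        \sum_e G x a b e * bot_slot s x e c + \sum_e G x a c e * bot_slot s x b e
        - schouten G x a b * mid_slot s x c - schouten G x a c * mid_slot s x b].
Proof.
move=> tr E1 E2 E3; split.
- move=> a; have := E1 a; rewrite /nablaS2_top /nabla0 tr mulr0 mul0r addr0.
  by move/eqP; rewrite subr_eq0 => /eqP.
- move=> a b; have := E2 a b; rewrite /nablaS2_mid /nabla1 tr mulr0 mul0r addr0.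
  set u := pd _ _ _; set v := \sum_e _; set w := _ * _; set z := bot_slot _ _ _ _ => H.
  by lra.
- move=> a b c; have := E3 a b c; rewrite /nablaS2_bot /nabla2 tr mulr0 mul0r addr0.
  set u := pd _ _ _; set v := \sum_e _; set v' := \sum_e _; set w := _ * _; set w' := _ * _ => H.
  by lra.
Qed.

(** Casts the three slot equations into the form of [linear_system_extension]; the coefficients
    involve only [G] and [P], both smooth up to the boundary. *)
Lemma tractor_extension A p (G : tensor3 R n) (P : tensor2 R n)
    (tau : tensor0 R n) (nu : tensor1 R n) (rho : tensor2 R n) :
  relopen A -> A p -> smooth3 A G -> smooth2 A P ->
  smooth (A `&` pos_part) tau -> smooth1 (A `&` pos_part) nu -> smooth2 (A `&` pos_part) rho ->
  (forall x, A x -> pos_part x -> tau x != 0) ->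
  (forall a x, A x -> pos_part x -> pd a tau x = 2 * nu x a) ->
  (forall a b x, A x -> pos_part x -> pd a (fun y => nu y b) x =
     \sum_e G x a b e * nu x e - P x a b * tau x + rho x a b) ->
  (forall a b c x, A x -> pos_part x -> pd a (fun y => rho y b c) x =
     \sum_e G x a b e * rho x e c + \sum_e G x a c e * rho x b e
     - P x a b * nu x c - P x a c * nu x b) ->
  exists (r : R) (taub : tensor0 R n) (nub : tensor1 R n) (rhob : tensor2 R n),
  [/\ 0 < r /\ hball p r `<=` A,
      [/\ smooth (hball p r) taub, smooth1 (hball p r) nub & smooth2 (hball p r) rhob],
      forall x, hball p r x -> pos_part x ->
        [/\ taub x = tau x, forall a, nub x a = nu x a & forall a b, rhob x a b = rho x a b]
    & forall a x, hball p r x -> pd a taub x = 2 * nub x a].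
Proof.
move=> oA Ap sG sP stau snu srho t0 e1 e2 e3.
(* One index type for all unknowns: the value tau, the components nu_b and the components rho_bc. *)
pose K : finType := (unit + 'I_n.+1 + 'I_n.+1 * 'I_n.+1)%type.
pose s (k : K) : tensor0 R n :=
  match k with
  | inl (inl _) => tau
  | inl (inr b) => fun x => nu x b
  | inr (b, c) => fun x => rho x b c
  end.
pose B (a : 'I_n.+1) (k l : K) : tensor0 R n :=
  match k, l with
  | inl (inl _), inl (inr b) => fun x => 2 * (a == b)%:R
  | inl (inr b), inl (inl _) => fun x => - P x a b
  | inl (inr b), inl (inr e) => fun x => G x a b e
  | inl (inr b), inr (c, d) => fun x => (a == c)%:R * (b == d)%:R
  | inr (b, c), inl (inr e) => fun x => - P x a b * (c == e)%:R - P x a c * (b == e)%:R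
  | inr (b, c), inr (d, e) => fun x => G x a b d * (c == e)%:R + G x a c e * (b == d)%:R
  | _, _ => fun x => 0
  end.
have sumK (F : K -> R) : \sum_l F l =
    F (inl (inl tt)) + \sum_b F (inl (inr b)) + \sum_b \sum_c F (inr (b, c)).
  rewrite big_sumType /= big_sumType /= (big_pred1 tt); last by case.
  by rewrite pair_bigA; congr (_ + _); apply: eq_bigr => -[].
have sc (c : R) : smooth A (fun=> c) by exact: smooth_cst.
have sB a k l : smooth A (B a k l).
  case: k => [[[]|b]|[b c]]; case: l => [[[]|e]|[d e]]; try exact: sc.
  - exact: (smoothN oA (sP a b)).
  - exact: sG.
  - apply: (smoothB oA); apply: (smoothM oA) => //; apply: (smoothN oA); exact: sP.
  - apply: (smoothD oA); apply: (smoothM oA) => //; exact: sG.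
have ss k : smooth (A `&` pos_part) (s k).
  by case: k => [[[]|b]|[b c]]; [exact: stau|exact: snu|exact: srho].
have ds a k x : A x -> pos_part x -> pd a (s k) x = \sum_l B a k l x * s l x.
  move=> Ax px; rewrite sumK; case: k => [[[]|b]|[b c]]; rewrite /B /s.
  - rewrite e1// mul0r add0r [X in _ = _ + X]big1 ?addr0; last first.
      by move=> d _; rewrite big1// => e _; rewrite mul0r.
    rewrite -[in LHS](sum_delta (fun e => nu x e)) mulr_sumr.
    by apply: eq_bigr => e _; ring.
  - rewrite e2// -[in LHS](sum_delta (fun c => rho x c b)) mulNr.
    rewrite [\sum_e _ - _]addrC; congr (_ + _); apply: eq_bigr => c _.
    rewrite -[in LHS](sum_delta (fun d => rho x c d)) mulr_suml.
    by apply: eq_bigr => d _; ring.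
  - rewrite e3// mul0r add0r -addrA addrC; congr (_ + _).
      rewrite -[nu x c](sum_delta (fun e => nu x e)) -[nu x b](sum_delta (fun e => nu x e)).
      rewrite -mulNr -mulNr !mulr_sumr -big_split /=; apply: eq_bigr => e _; ring.
    transitivity (\sum_d (G x a b d * (\sum_e rho x d e * (c == e)%:R)
        + (\sum_e G x a c e * rho x d e) * (b == d)%:R)).
      rewrite big_split /= sum_delta; congr (_ + _).
      by apply: eq_bigr => d _; rewrite sum_delta.
    apply: eq_bigr => d _; rewrite mulr_sumr mulr_suml -big_split /=.
    by apply: eq_bigr => e _; ring.
(* The top slot is the nowhere vanishing component that keeps the sum of squares positive. *)
have [r [sb [r0 QA ssb sbE dsb]]] :=
  linear_system_extension (k0 := inl (inl tt) : K) oA Ap sB ss ds t0.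
exists r, (sb (inl (inl tt))), (fun x a => sb (inl (inr a)) x), (fun x a b => sb (inr (a, b)) x).
split=> //.
- by split=> [|a|a b]; exact: ssb.
- by move=> x Qx px; split=> [|a|a b]; rewrite sbE.
- move=> a x Qx; rewrite dsb// sumK /B mul0r add0r [X in _ + X]big1 ?addr0; last first.
    by move=> d _; rewrite big1// => e _; rewrite mul0r.
  rewrite -[in RHS](sum_delta (fun e => sb (inl (inr e)) x)) mulr_sumr.
  by apply: eq_bigr => e _; ring.
Qed.

(* [tau = kappa ^ (-2/(n+2))] and the determinant of L(tau) is the constant
   [tau^(n+2) det P = c kappa^-2 det Ric]. *)
Lemma boundary_density A p (G H : tensor3 R n) th kappa :
  (0 < n)%N -> relopen A -> A p -> smooth3 A G -> torsion_free A G ->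
  (forall x a, trG G x a = 0) ->
  smooth3 (A `&` pos_part) H -> smooth1 (A `&` pos_part) th ->
  (forall x, (A `&` pos_part) x -> forall a b c, H x a b c = proj_change G th x a b c) ->
  preserves_on (A `&` pos_part) H kappa ->
  (forall x, (A `&` pos_part) x -> forall a b c, nabla2 0 H (ricci H) x a b c = 0) ->
  (forall x, (A `&` pos_part) x -> \det (matrix_of (ricci H) x) != 0) ->
  exists (r : R) (taub : tensor0 R n),
  [/\ 0 < r, hball p r `<=` A, smooth (hball p r) taub,
      forall x, hball p r x -> pos_part x -> taub x = kappa x `^ (- 2 / n.+2%:R)
    & taub p = 0 -> exists a, pd a taub p != 0].
Proof.
move=> n0 oA Ap sG tG trG0 sH sth HG pk pR dR.
set Ai := A `&` pos_part in sH sth HG pk pR dR *.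
have oAi : relopen Ai by apply: relopenI => //; exact: relopen_pos.
have AiA : Ai `<=` A by move=> x [].
have Ah := proj1 oA; have n2 : n.+2%:R != 0 :> R by rewrite pnatr_eq0.
have trZ c : (fun z => trG G z c) = fun=> 0 by apply/funext => z; exact: trG0.
have [sk k0 _] := pk.
have cG : closed1 Ai (trG G).
  by move=> y Ay a b; rewrite !trZ !(has_pdE (proj1 oAi y Ay) (has_pd_cst _ _ _)).
have cth : closed1 Ai th.
  apply: (closed_proj_change oAi _ sth HG cG); last exact: closed_trG oAi sH pk.
  by move=> a b c; exact: smooth_sub oA AiA (sG a b c).
have [tau tauE] : exists tau, tau = fun y => kappa y `^ (- 2 / n.+2%:R) by eexists.
have tau0 x : Ai x -> 0 < tau x by move=> /k0 kx; rewrite tauE; exact: powR_gt0.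
have stau : smooth Ai tau by rewrite tauE; exact: smooth_powR.
have [L LE] : exists L, L = splittingL G tau by eexists.
have par x : Ai x -> [/\ forall b, mid_slot L x b = - th x b * tau x,
      forall b c, bot_slot L x b c = tau x * (schouten H x b c + th x b * th x c),
      forall a, nablaS2_top G L x a = 0, forall a b, nablaS2_mid G L x a b = 0
    & forall a b c, nablaS2_bot G L x a b c = 0].
  rewrite LE; apply: (parallel_splittingL (A := Ai) (H := H) (th := th)) => //.
  - by move=> a b c; exact: smooth_sub oA AiA (sG a b c).
  - by move=> y /AiA; exact: tG.
  - by move=> y Aiy a; rewrite tauE; exact: nabla0_density oAi pk HG Aiy.
have topE : top_slot L = tau by rewrite LE.
have smid : smooth1 Ai (mid_slot L).
  move=> b; apply: (smooth_eq oAi (f := fun x => - th x b * tau x)).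
    by move=> y /par[-> _ _ _ _].
  by apply: smoothM => //; apply: smoothN.
have sbot : smooth2 Ai (bot_slot L).
  move=> b c; apply: (smooth_eq oAi (f := fun x => tau x * (schouten H x b c + th x b * th x c))).
    by move=> y /par[_ -> _ _ _].
  apply: smoothM => //; apply: smoothD => //; last exact: smoothM.
  exact: smooth_schouten.
have sys x : Ai x -> _ := fun Aix => let: And5 _ _ q1 q2 q3 := par x Aix in
  parallel_trace_free (trG0 x) q1 q2 q3.
rewrite topE in sys.
have [r [taub [nub [rhob [[r0 QA] [st sn sr] E dt]]]]] :
  exists (r : R) (taub : tensor0 R n) (nub : tensor1 R n) (rhob : tensor2 R n),
  [/\ 0 < r /\ hball p r `<=` A,
      [/\ smooth (hball p r) taub, smooth1 (hball p r) nub & smooth2 (hball p r) rhob],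
      forall x, hball p r x -> pos_part x ->
        [/\ taub x = tau x, forall a, nub x a = mid_slot L x a
          & forall a b, rhob x a b = bot_slot L x a b]
    & forall a x, hball p r x -> pd a taub x = 2 * nub x a].
  apply: (tractor_extension (P := schouten G) oA Ap sG) => //.
  - exact: smooth_schouten.
  - by move=> x Ax px; rewrite lt0r_neq0// tau0.
  - by move=> a x Ax px; have [-> _ _] := sys x (conj Ax px).
  - by move=> a b x Ax px; have [_ -> _] := sys x (conj Ax px).
  - by move=> a b c x Ax px; have [_ _ ->] := sys x (conj Ax px).
exists r, taub; split=> // [x Qx px|tp0]; first by have [-> _ _] := E x Qx px; rewrite tauE.
apply: contrapT => /forallNP dt0.
have Qp : hball p r p by split; [exact: Ah|rewrite subrr normr0].
have nup a : nub p a = 0.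
  have : pd a taub p = 0 by apply/eqP/negPn/negP/dt0.
  by rewrite dt// => /eqP; rewrite mulf_eq0 pnatr_eq0 /= => /eqP.
(* The matrix of the extended form L(tau), defined up to the face; its first row vanishes at [p] if
   tau and d tau do. *)
pose S (x : X) : 'M[R]_(1 + n.+1) := block_mx (taub x)%:M (\row_a nub x a) (\col_a nub x a)
  (\matrix_(a, b) rhob x a b).
pose Qi := hball p r `&` pos_part.
have oQ : @relopen R n (hball p r) := relopen_hball p r.
have QiAi : Qi `<=` Ai by move=> x [/QA].
have sS i j : smooth (hball p r) (fun x => S x i j).
  have sc (c : R) : smooth (hball p r) (fun=> c) by exact: smooth_cst.
  rewrite -(splitK i) -(splitK j); case: (fintype.split i) => i'; case: (fintype.split j) => j' /=.
  - apply: (smooth_eq oQ) st => y _; rewrite block_mxEul mxE (ord1 i') (ord1 j') eqxx mulr1n//.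
  - by apply: (smooth_eq oQ) (sn j') => y _; rewrite block_mxEur mxE.
  - by apply: (smooth_eq oQ) (sn i') => y _; rewrite block_mxEdl mxE.
  - by apply: (smooth_eq oQ) (sr i' j') => y _; rewrite block_mxEdr mxE.
have sD : smooth (hball p r) (fun x => \det (S x)) by exact: smooth_det.
have Dp : \det (S p) = 0.
  rewrite (expand_det_row _ (lshift _ ord0)) big1// => j _.
  rewrite (_ : S p _ j = 0) ?mul0r// -(splitK j); case: (fintype.split j) => j' /=.
    by rewrite /S block_mxEul mxE tp0 (ord1 j') eqxx.
  by rewrite /S block_mxEur mxE.
have DE x : Qi x -> \det (S x) = n%:R^-1 ^+ n.+1 * (kappa x `^ (- 2) * \det (matrix_of (ricci H) x)).
  move=> [Qx px]; have Aix : Ai x by split=> //; exact: QA.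
  have [F1 F2 F3] := E x Qx px; have [m1 m2 _ _ _] := par x Aix.
  have -> : S x = block_mx (tau x)%:M (- tau x *: \row_a th x a) (- tau x *: (\row_a th x a)^T)
      (tau x *: (matrix_of (schouten H) x + (\row_a th x a)^T *m (\row_a th x a))).
    rewrite /S F1; congr block_mx; apply/matrixP => i j; rewrite !mxE.
    - by rewrite F2 m1; ring.
    - by rewrite F2 m1; ring.
    - by rewrite F3 m2 big_ord1 !mxE.
  rewrite det_tractor.
  have -> : matrix_of (schouten H) x = n%:R^-1 *: matrix_of (ricci H) x.
    by apply/matrixP => i j; rewrite !mxE.
  rewrite detZ; have -> : tau x ^+ n.+2 = kappa x `^ (- 2).
    by rewrite tauE -powR_mulrn ?powR_ge0// -powRrM mulfVK.
  by rewrite mulrCA.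
have D0 x : Qi x -> \det (S x) != 0.
  move=> Qx; have Aix := QiAi _ Qx; rewrite DE// mulf_neq0 ?expf_neq0 ?invr_eq0 ?pnatr_eq0 -?lt0n//.
  by rewrite mulf_neq0 ?dR// lt0r_neq0// powR_gt0// k0.
have oQi : relopen Qi by apply: relopenI => //; exact: relopen_pos.
(* The factor kappa^-2 contributes -2 and det Ric contributes +2 times the Christoffel trace of
   [H]. *)
have dD a x : Qi x -> has_pd a (fun y => \det (S y)) x 0.
  move=> Qx; have Aix := QiAi _ Qx.
  apply: (has_pd_local oQi Qx (fun y Qy => esym (DE y Qy))).
  have sR : smooth2 Ai (ricci H) by exact: smooth_ricci.
  have := has_pdZ (k := n%:R^-1 ^+ n.+1) (has_pdM (has_pd_powR_volume (p := - 2) (a := a) pk Aix)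
    (pd_det_parallel (a := a) oAi sR Aix (pR x Aix a))).
  by congr (has_pd a _ x); ring.
have cst x y : Qi x -> Qi y -> \det (S y) = \det (S x).
  move=> Qx Qy; apply/eqP; rewrite -subr_eq0 -normr_le0.
  have := @boxy_lipschitz R n Qi (fun y => \det (S y)) (fun _ _ => 0) 0 (proj1 oQi) (@boxy_hball_pos _ _ p r).
  rewrite mulr0 => /(_ _ _ _ x y Qx Qy); rewrite mul0r; apply=> //.
  - by apply: cont_on_sub (smooth_cont sD) => z [].
  - by move=> _ z _; rewrite normr0.
have near (d : R) : 0 < d -> exists2 x, Qi x & `|x - p| < d.
  move=> d0; pose m := Num.min d r; have m0 : 0 < m by rewrite lt_min d0.
  have : m / 2 < m by rewrite ltr_pdivrMr// mulr2n mulrDr mulr1 ltrDl.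
  rewrite [in X in _ < X]/m lt_min => /andP[md mr]; have m2 : 0 < m / 2 by rewrite divr_gt0.
  have N : `|p + (m / 2) *: evec ord0 - p| = m / 2.
    by rewrite addrC addKr norm_scale_evec gtr0_norm.
  exists (p + (m / 2) *: evec ord0); last by rewrite N.
  split; last by rewrite /pos_part /= !mxE !eqxx /= mulr1 ltr_wpDl//; exact: Ah.
  by split; [apply: halfspace_step; [exact: Ah|exact: ltW]|rewrite N].
have [q Qq _] := near 1 ltr01.
(* Near [p] the determinant is at most half of its constant non-zero absolute value, a
   contradiction. *)
have q0 : 0 < `|\det (S q)| / 2 by rewrite divr_gt0// normr_gt0 D0.
have [d d0 Hd] := smooth_cont sD Qp q0.
have [x Qx xd] := near d d0.
have := Hd x (proj1 Qx) xd; rewrite Dp subr0 (cst q x Qq Qx).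
by rewrite ler_pdivlMr// ger_pMr ?normr_gt0 ?D0// lern1.
Qed.

End Boundary.

(** * The compactification *)

Section SmoothTractors.
Context {R : realType} {n : nat}.
Local Notation X := (coord_space R n).
Implicit Types (A B : set X) (f : tensor0 R n) (x y : X) (a b c d e : 'I_n.+1).

Lemma smooth_nabla0 A (w : R) (G : tensor3 R n) f : relopen A -> smooth3 A G ->
  smooth A f -> smooth1 A (nabla0 w G f).
Proof.
move=> oA sG sf a; apply: (smoothD oA); first exact: smooth_pd.
by apply: (smoothM oA) => //; apply: (smoothM oA); [exact: smooth_cst|exact: smooth_trG].
Qed.

Lemma smooth_nabla1 A (w : R) (G : tensor3 R n) u : relopen A -> smooth3 A G ->
  smooth1 A u -> smooth2 A (nabla1 w G u).
Proof.
move=> oA sG su a b; apply: (smoothD oA); last first.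
  by apply: (smoothM oA) => //; apply: (smoothM oA); [exact: smooth_cst|exact: smooth_trG].
apply: (smoothB oA); first exact/smooth_pd/su.
by apply: smooth_sum => // e _; apply: (smoothM oA); [exact: sG|exact: su].
Qed.

Lemma smooth_nabla2 A (w : R) (G : tensor3 R n) t : relopen A -> smooth3 A G ->
  smooth2 A t -> smooth3 A (nabla2 w G t).
Proof.
move=> oA sG st a b c; apply: (smoothD oA); last first.
  by apply: (smoothM oA) => //; apply: (smoothM oA); [exact: smooth_cst|exact: smooth_trG].
apply: (smoothB oA); last first.
  by apply: smooth_sum => // e _; apply: (smoothM oA); [exact: sG|exact: st].
apply: (smoothB oA); first exact/smooth_pd/st.
by apply: smooth_sum => // e _; apply: (smoothM oA); [exact: sG|exact: st].
Qed.

Lemma smooth_sym2 A (t : tensor2 R n) : relopen A -> smooth2 A t -> smooth2 A (sym2 t).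
Proof.
move=> oA st a b; apply: (smoothM oA); first exact: smooth_cst.
by apply: (smoothD oA); exact: st.
Qed.

Lemma smooth_mid_splittingL A G f : relopen A -> smooth3 A G -> smooth A f ->
  smooth1 A (mid_slot (splittingL G f)).
Proof.
move=> oA sG sf a; apply: (smoothM oA); first exact: smooth_cst.
exact: smooth_nabla0.
Qed.

Lemma smooth_bot_splittingL A G f : relopen A -> smooth3 A G -> smooth A f ->
  smooth2 A (bot_slot (splittingL G f)).
Proof.
move=> oA sG sf a b; apply: (smoothD oA); apply: (smoothM oA) => //.
- exact: smooth_cst.
- by apply: smooth_sym2 => //; apply: smooth_nabla1 => //; exact: smooth_nabla0.
- by apply: smooth_sym2 => //; exact: smooth_schouten.
Qed.

(** Every point of a relatively open set is a limit of its positive part, by steps along the inward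
    normal. *)
Lemma eq0_closure A f : relopen A -> cont_on A f -> (forall x, (A `&` pos_part) x -> f x = 0) ->
  forall x, A x -> f x = 0.
Proof.
move=> oA cf f0 x Ax; apply/eqP; rewrite -normr_le0; apply/ler_addgt0Pl => e e0; rewrite addr0.
have [d d0 Hd] := cf x Ax e e0; have [r r0 Hr] := proj2 oA x Ax.
have hx := proj1 oA x Ax.
pose m := Num.min d r; have m0 : 0 < m by rewrite lt_min d0.
have : m / 2 < m by rewrite ltr_pdivrMr// mulr2n mulrDr mulr1 ltrDl.
rewrite [in X in _ < X]/m lt_min => /andP[md mr]; have m2 : 0 < m / 2 by rewrite divr_gt0.
have N : `|x + (m / 2) *: evec ord0 - x| = m / 2.
  by rewrite addrC addKr norm_scale_evec gtr0_norm.
have hy : halfspace (x + (m / 2) *: evec ord0) by apply: halfspace_step => //; exact: ltW.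
have Ay : A (x + (m / 2) *: evec ord0) by apply: Hr => //; rewrite N.
have := Hd _ Ay; rewrite N => /(_ md); rewrite f0 ?sub0r ?normrN//.
by split=> //; rewrite /pos_part /= !mxE !eqxx /= mulr1 ltr_wpDl.
Qed.

Lemma proj_change_compose (G H : tensor3 R n) u v w x :
  (forall a b c, H x a b c = proj_change G u x a b c) -> (forall d, u x d + v x d = w x d) ->
  forall a b c, proj_change H v x a b c = proj_change G w x a b c.
Proof. by move=> HG E a b c; rewrite !proj_changeE HG proj_changeE -!E; ring. Qed.

(** The identity 1/f = f / f^2 reduces to a positive denominator. *)
Lemma smooth_inv_neq0 A f : relopen A -> (forall x, A x -> f x != 0) ->
  smooth A f -> smooth A (fun x => (f x)^-1).
Proof.
move=> oA f0 sf; apply: (smooth_eq oA (f := fun x => f x * (f x * f x)^-1)).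
  by move=> y Ay; rewrite invfM mulrA mulfV ?mul1r// f0.
apply: (smoothM oA) => //; apply: smooth_inv => // [x Ax|]; last exact: smoothM.
by rewrite -expr2 lt_neqAle sqr_ge0 eq_sym sqrf_eq0 f0.
Qed.

End SmoothTractors.

(** * The two descriptions of the connection *)

Section Einstein.
Context {R : realType} {n : nat} (M : bmanifold R n).
Implicit Types (W U : set M) (i j k : atlas_index M).

Lemma preserves_volume_on W G kappa i : preserves_volume W G kappa ->
  preserves_on (chart_im i W) (G i) (kappa i).
Proof.
by move=> [[sk _] k0 pk]; split; [exact: sk|exact: k0|move=> x Wx a; exact: pk].
Qed.

Lemma levi_civita_special W g G : open W -> is_metric W g -> is_levi_civita W g G ->
  is_special W G.
Proof.
move=> oW [sg tg dg lg] pg.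
pose kappa i (x : coord_space R n) := (\det (matrix_of (g i) x) ^+ 2) `^ 4^-1.
have pk i : preserves_on (chart_im i W) (G i) (kappa i).
  apply: metric_volume; first exact: relopen_chart_im.
  - by move=> a b; exact: sg.
  - by move=> x Wx; exact: dg.
  - by move=> x Wx a b c; exact: pg.
exists kappa; split.
- split; first by move=> i; have [] := pk i.
  move=> i j x Ox; have OT := overlap_T Ox.
  have n2 : n.+2%:R != 0 :> R by rewrite pnatr_eq0.
  rewrite opprK divff// powRr1// /kappa.
  have -> : matrix_of (g i) x =
      jac i j x *m matrix_of (g j) (transition i j x) *m (jac i j x)^T.
    apply/matrixP => a b; rewrite [LHS]mxE (lg i j x Ox) mulmx_coord exchange_big.
    apply: eq_bigr => l _; rewrite mulmx_coord mulr_suml; apply: eq_bigr => k _.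
    by rewrite [matrix_of _ _ _ _]mxE [(_^T) _ _]mxE; ring.
  rewrite !det_mulmx det_tr; set D := \det (jac _ _ _); set E := \det _.
  have -> : (D * E * D) ^+ 2 = (E ^+ 2) * (`|D| `^ 4).
    rewrite powR_mulrn//.
    have -> : `|D| ^+ 4 = (`|D| ^+ 2) ^+ 2 by rewrite -exprM.
    by rewrite real_normK ?num_real//; ring.
  rewrite powRM ?sqr_ge0 ?powR_ge0// -powRrM divff ?powRr1//.
- by move=> i x; have [_ k0 _] := pk i; exact: k0.
- by move=> i x Wx a; have [_ _ H] := pk i; exact: H.
Qed.

(** Forward, the metric volume is parallel and Ric is a non-zero multiple of the metric. Backward,
    Ric itself is the metric, with Einstein constant 1; it is symmetric because a parallel volume
    exists. *)
Lemma einstein_iff W G : open W -> is_connection W G ->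
  is_nonflat_einstein_connection W G <->
  [/\ is_special W G, ricci_parallel W G & ricci_nondegenerate W G].
Proof.
move=> oW cG; have [sG tG lG] := cG; split.
- move=> [g [lam [mg pg l0 Rg]]]; have [sg _ dg _] := mg; split.
  + exact: levi_civita_special mg pg.
  + move=> i x Wx a b c; have oA := relopen_chart_im i oW.
    have := pg i x Wx a b c; rewrite /nabla2 !mul0r !addr0 => E.
    rewrite (pd_local (g := fun y => lam * g i y b c) a oA Wx); last by move=> y Wy; exact: Rg.
    rewrite (has_pdE (proj1 oA x Wx) (has_pdZ (k := lam) (smooth_has_pd (a := a) (sg i b c) Wx))).
    transitivity (lam * (pd a (fun y => g i y b c) x - \sum_e G i x a b e * g i x e c
        - \sum_e G i x a c e * g i x b e)); last by rewrite E mulr0.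
    rewrite !mulrBr !mulr_sumr; congr (_ - _ - _).
      by apply: eq_bigr => e _; rewrite Rg//; ring.
    by apply: eq_bigr => e _; rewrite Rg//; ring.
  + move=> i x Wx; have -> : matrix_of (ricci (G i)) x = lam *: matrix_of (g i) x.
      by apply/matrixP => a b; rewrite !mxE Rg.
    by rewrite detZ mulf_neq0 ?expf_neq0 ?dg.
- move=> [[kappa pk] pR dR]; exists (fun i => ricci (G i)), 1; split=> //; last first.
  + by move=> i x _ a b; rewrite mul1r.
  split.
  + by move=> i; apply: smooth_ricci; [exact: relopen_chart_im|exact: sG].
  + move=> i x Wx a b; have oA := relopen_chart_im i oW.
    apply: (ricci_sym a b oA) Wx; first exact: tG.
    by apply: closed_trG (preserves_volume_on i pk) => //; exact: sG.
  + by move=> i x; exact: dR.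
  + by move=> i j x; exact: ricci_chart_transform.
Qed.

End Einstein.

(** * The density extended by zero and its properties *)

Section Compactification.
Context {R : realType} {n : nat} (M : bmanifold R n).
Variables (G0 nab : atlas_index M -> tensor3 R n) (u : atlas_index M -> tensor1 R n).
Variable kappa : atlas_index M -> tensor0 R n.
Hypotheses (hn : (0 < n)%N) (cG : is_connection setT G0) (cnab : is_connection (inner M) nab).
Hypotheses (ou : is_oneform (inner M) u).
Hypothesis eu : conn_eq (inner M) nab (fun i => proj_change (G0 i) (u i)).
Hypothesis pk : preserves_volume (inner M) nab kappa.
Hypotheses (pR : ricci_parallel (inner M) nab) (dR : ricci_nondegenerate (inner M) nab).
Hypothesis nx : nowhere_extendible nab.
Implicit Types (W U : set M) (i j k : atlas_index M) (p q : M) (x y : coord_space R n).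

Definition weight2 i : tensor0 R n := fun x => kappa i x `^ (- 2 / n.+2%:R).

Let oT : open [set: M] := openT.
Let oI : open (inner M) := @open_inner R n M.

(** Solved for [u], this is u = - d tau / (2 tau) - trG G0 / (n+2), the form in which both the
    extension and the compactness arguments use it. *)
Lemma pd_weight2 i x a : chart_im i (inner M) x ->
  has_pd a (weight2 i) x (- 2 * (u i x a + n.+2%:R^-1 * trG (G0 i) x a) * weight2 i x).
Proof.
move=> Ix; have := has_pd_powR_volume (a := a) (p := - 2 / n.+2%:R) (preserves_volume_on i pk) Ix.
congr (has_pd a _ x); rewrite -/(weight2 i x).
have -> : trG (nab i) x a = trG (G0 i) x a + n.+2%:R * u i x a.
  by rewrite -trG_proj_change; apply: eq_bigr => c _; exact: eu.
have n2 : n.+2%:R != 0 :> R by rewrite pnatr_eq0.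
by move: (weight2 i x) => k; field.
Qed.

Lemma weight2_gt0 i x : chart_im i (inner M) x -> 0 < weight2 i x.
Proof. by move=> Ix; have [_ k0 _] := pk; apply: powR_gt0; exact: k0. Qed.

Lemma smooth_weight2 i : smooth (chart_im i (inner M)) (weight2 i).
Proof.
have [sk k0 _] := preserves_volume_on i pk.
by apply: smooth_powR => //; exact: relopen_chart_im.
Qed.

(** An extension of [u] in one chart suffices: transported to the other charts it still agrees with
    [u] on the interior, since both are one-forms. *)
Lemma conn_eq_transport i W v : open W -> W `<=` cdom (charts i) ->
  smooth1 (chart_im i W) v ->
  (forall x a, chart_im i (W `&` inner M) x -> u i x a = v x a) ->
  extends_to W nab.
Proof.
move=> oW Wi sv uv; have oWI := openI oW oI.
exists (fun j => proj_change (G0 j) (transport i v j)).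
  apply: proj_change_connection => //; first exact: is_connection_sub oT (@subsetT _ W) cG.
  exact: transport_oneform.
move=> j x Wx a b c; have Ix : chart_im j (inner M) x by apply: chart_im_sub Wx => p [].
rewrite (eu Ix).
have E : forall d, u j x d = transport i v j x d.
  move=> d; apply: (oneform_ext (i := i) (W := W `&` inner M)) Wx => //.
  - by move=> p [/Wi].
  - by apply: is_oneform_sub oI _ ou => p [].
  - by apply: (is_oneform_sub oW); [move=> p []|exact: transport_oneform].
  - by move=> y e Wy; rewrite (transport_self _ _ Wy); exact: uv.
by rewrite !proj_changeE !E.
Qed.

(** For a nowhere vanishing extension [f] of the density, the expression of [u] through d log tau is
    smooth up to the boundary. *)
Lemma extends_of_density i W f : open W -> W `<=` cdom (charts i) ->
  smooth (chart_im i W) f -> (forall x, chart_im i W x -> f x != 0) ->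
  (forall x, chart_im i (W `&` inner M) x -> f x = weight2 i x) -> extends_to W nab.
Proof.
move=> oW Wi sf f0 fw; have oWI := openI oW oI.
have oA := relopen_chart_im i oW; have [sG _ _] := cG.
apply: (conn_eq_transport (i := i)
  (v := fun x a => - (n.+2%:R^-1 * trG (G0 i) x a) - 2^-1 * (pd a f x * (f x)^-1))) => //.
- have sGW : smooth3 (chart_im i W) (G0 i).
    by move=> a b c; apply: smooth_sub (sG i a b c); [exact: relopen_chart_im|exact: chart_im_sub].
  move=> a; apply: (smoothB oA).
    by apply: (smoothN oA); apply: (smoothM oA); [exact: smooth_cst|exact: smooth_trG].
  apply: (smoothM oA); first exact: smooth_cst.
  by apply: (smoothM oA); [exact: smooth_pd|exact: smooth_inv_neq0].
- move=> x a Wx; have Ix : chart_im i (inner M) x by apply: chart_im_sub Wx => p [].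
  have -> : pd a f x = - 2 * (u i x a + n.+2%:R^-1 * trG (G0 i) x a) * weight2 i x.
    have oB := relopen_chart_im i oWI.
    rewrite (pd_local (g := weight2 i) a oB Wx fw); apply: has_pdE; first exact: (proj1 oB).
    exact: pd_weight2.
  rewrite (fw x Wx) mulfK ?lt0r_neq0 ?weight2_gt0//; field.
  by rewrite -natrD pnatr_eq0.
Qed.

(** Here non-extendibility enters: a non-zero boundary value stays non-zero on a small
    neighbourhood, over which [nab] would then extend. *)
Lemma boundary_value0 i p (r : R) f : bdry M p -> cdom (charts i) p -> 0 < r ->
  hball (cmap (charts i) p) r `<=` chart_im i setT -> smooth (hball (cmap (charts i) p) r) f ->
  (forall x, hball (cmap (charts i) p) r x -> pos_part x -> f x = weight2 i x) ->
  f (cmap (charts i) p) = 0.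
Proof.
move=> bp ip r0 QT sf fw; set x0 := cmap (charts i) p in QT sf fw *.
apply: contrapT => /eqP fp0.
have hx0 : halfspace x0.
  by apply: (proj1 (relopen_chart_im i oT)); exact: chart_im_cmap.
have Qp : hball x0 r x0 by split=> //; rewrite subrr normr0.
have e0 : 0 < `|f x0| / 2 by rewrite divr_gt0// normr_gt0.
have [d d0 Hd] := smooth_cont sf Qp e0.
have [s [s0 sd sr]] : exists s, [/\ 0 < s, s <= d & s <= r].
  by exists (Num.min d r); rewrite lt_min d0 r0 !ge_min !lexx ?orbT.
have Qsr : hball x0 s `<=` hball x0 r.
  by move=> y [hy ys]; split=> //; exact: lt_le_trans sr.
pose W := cdom (charts i) `&` [set q | hball x0 s (cmap (charts i) q)].
have oW : open W.
  by apply: open_preimage; [exact: relopen_hball|move=> y /Qsr/QT].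
have imW : chart_im i W `<=` hball x0 s by move=> y [q [iq [_ ?]] <-].
apply: (nx bp oW); first by split=> //; split=> //; rewrite subrr normr0.
apply: (extends_of_density (i := i) (f := f)) => //.
- by move=> q [].
- by apply: smooth_sub sf; [exact: relopen_hball|move=> y /imW/Qsr].
- move=> y /imW Qy; have := Hd y (Qsr _ Qy) (lt_le_trans (proj2 Qy) sd).
  apply: contraTneq => ->; rewrite sub0r normrN -ltNge ltr_pdivrMr//.
  by rewrite mulr2n mulrDr mulr1 ltrDl normr_gt0.
- move=> y Wy; apply: fw; first by apply: Qsr; apply: imW; apply: chart_im_sub Wy => q [].
  by move: Wy; rewrite chart_im_inner => -[].
Qed.

(** Extension by the explicit value 0 on the face, so that no local extensions have to be glued;
    smoothness follows by identifying it with each of them. *)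
Definition defining_density i : tensor0 R n :=
  fun x => if 0 < x ord0 ord0 then weight2 i x else 0.

Lemma defining_density_inner i x : chart_im i (inner M) x ->
  defining_density i x = weight2 i x.
Proof. by rewrite chart_im_innerT /defining_density => -[_ ->]. Qed.

Lemma defining_density_local i p : bdry M p -> cdom (charts i) p ->
  exists (r : R), [/\ 0 < r, hball (cmap (charts i) p) r `<=` chart_im i setT,
    smooth (hball (cmap (charts i) p) r) (defining_density i)
  & exists a, pd a (defining_density i) (cmap (charts i) p) != 0].
Proof.
move=> bp ip; set x0 := cmap (charts i) p.
have [sG tG _] := cG; have oA := relopen_chart_im i oT.
have Ap : chart_im i setT x0 by exact: chart_im_cmap.
pose v x a := - n.+2%:R^-1 * trG (G0 i) x a.
have sv : smooth1 (chart_im i setT) v.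
  by move=> a; apply: (smoothM oA); [exact: smooth_cst|exact: smooth_trG].
have sGi : smooth3 (chart_im i setT) (G0 i) by move=> a b c; exact: sG.
have [r [tb [r0 QT stb tbE dtb]]] : exists (r : R) (tb : tensor0 R n),
  [/\ 0 < r, hball x0 r `<=` chart_im i setT, smooth (hball x0 r) tb,
      forall x, hball x0 r x -> pos_part x -> tb x = weight2 i x
    & tb x0 = 0 -> exists a, pd a tb x0 != 0].
  have [sn _ _] := cnab; have [su _] := ou.
  apply: (boundary_density (G := proj_change (G0 i) v) (H := nab i)
    (th := fun x a => u i x a - v x a)) => //; rewrite -?chart_im_innerT.
  - exact: smooth_proj_change.
  - by move=> x Ax a b c; rewrite !proj_changeE tG//; ring.
  - exact: proj_change_trace_free.
  - by move=> a b c; exact: sn.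
  - move=> a; apply: smoothB; [exact: relopen_chart_im|exact: su|].
    by apply: smooth_sub oA _ (sv a); exact: chart_im_sub.
  - by move=> x Ix a b c; rewrite (eu Ix) proj_change_proj_change !proj_changeE; ring.
  - exact: preserves_volume_on.
  - by move=> x Ix a b c; exact: pR.
  - by move=> x Ix; exact: dR.
(* [boundary_value0] is applied at every boundary point of the half-ball, not only at [p], so the
   local extension vanishes on the whole face. *)
have tbD y : hball x0 r y -> tb y = defining_density i y.
  move=> Qy; rewrite /defining_density; case: ifPn => y0; first exact: tbE.
  have [q iq qy] : exists2 q, cdom (charts i) q & cmap (charts i) q = y.
    by have [q [iq _] <-] := QT _ Qy; exists q.
  have bq : bdry M q.
    apply/(bdry_chart iq); rewrite qy; apply/le_anti; rewrite -leNgt in y0.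
    by rewrite y0; exact: (proj1 Qy).
  have [s s0 Hs] := proj2 (relopen_hball x0 r) y Qy.
  have sub : hball (cmap (charts i) q) s `<=` hball x0 r.
    by rewrite qy => z [hz zs]; exact: Hs.
  rewrite -qy; apply: (boundary_value0 bq iq s0) => //.
  - by move=> z /sub/QT.
  - by apply: smooth_sub stb => //; exact: relopen_hball.
  - by move=> z /sub; exact: tbE.
have oQ : @relopen R n (hball x0 r) := relopen_hball x0 r.
have Q0 : hball x0 r x0 by split; [exact: (proj1 oA)|rewrite subrr normr0].
exists r; split=> //; first exact: smooth_eq oQ tbD stb.
have [a da] := dtb (boundary_value0 bp ip r0 QT stb tbE).
by exists a; rewrite -(pd_local a oQ Q0 tbD).
Qed.

Lemma smooth_defining_density i : smooth (chart_im i setT) (defining_density i).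
Proof.
have oA := relopen_chart_im i oT.
apply: smooth_local => [|x [p [ip _] <-]]; first exact: (proj1 oA).
have [bp|Ip] := pselect (bdry M p).
  have [r [r0 _ sr _]] := defining_density_local bp ip.
  exists (hball (cmap (charts i) p) r); split=> //; first exact: relopen_hball.
  by split; [apply: (proj1 oA); exact: chart_im_cmap|rewrite subrr normr0].
exists (chart_im i (inner M)); split; [exact: relopen_chart_im|exact: chart_im_cmap|].
apply: smooth_eq (smooth_weight2 i); first exact: relopen_chart_im.
by move=> y /defining_density_inner.
Qed.

Lemma defining_density_ge0 i p : cdom (charts i) p -> 0 <= defining_density i (cmap (charts i) p).
Proof. by move=> _; rewrite /defining_density; case: ifP => // _; exact: powR_ge0. Qed.

Lemma defining_density_eq0 i p : cdom (charts i) p ->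
  (defining_density i (cmap (charts i) p) = 0 <-> bdry M p).
Proof.
move=> ip; split=> [|/(bdry_chart ip)]; last by rewrite /defining_density => ->; rewrite ltxx.
move=> E; apply: contrapT => Ip; move: E; rewrite defining_density_inner; last exact: chart_im_cmap.
by apply/eqP/lt0r_neq0/weight2_gt0; exact: chart_im_cmap.
Qed.

Lemma is_density_defining_density : is_density setT 2 defining_density.
Proof.
split=> [i|i j x Ox]; first exact: smooth_defining_density.
have [p [ip [jp _]] xE] := Ox; rewrite -xE in Ox *.
have -> : transition i j (cmap (charts i) p) = cmap (charts j) p by rewrite /transition cmapK.
have [bp|Ip] := pselect (bdry M p).
  by rewrite (proj2 (defining_density_eq0 ip) bp) (proj2 (defining_density_eq0 jp) bp) mul0r.
have n2 : n.+2%:R != 0 :> R by rewrite pnatr_eq0.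
rewrite !defining_density_inner; try exact: chart_im_cmap.
have [[_ lk] k0 _] := pk; rewrite /weight2 (lk i j) ?opprK; last exact: chart_im_cmap.
rewrite divff// powRr1// powRM//; last first.
  by rewrite /transition cmapK// ltW// k0//; exact: chart_im_cmap.
by rewrite /transition cmapK.
Qed.

Lemma defining_function i : is_defining_function (cdom (charts i))
  (fun q => defining_density i (cmap (charts i) q)).
Proof.
have oi := cdom_open (charts i).
have si : smooth (chart_im i (cdom (charts i))) (defining_density i).
  apply: smooth_sub (smooth_defining_density i); first exact: relopen_chart_im.
  exact: chart_im_sub.
split=> //.
- move=> j; rewrite -(overlap_sub j (@subset_refl _ (cdom (charts i)))).
  exact: (smooth_transition_comp j oi si).
- exact: defining_density_ge0.
- exact: defining_density_eq0.
- move=> j p ip bp jp; have [r [_ _ _ [b db]]] := defining_density_local bp ip.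
  apply: contrapT => /forallNP H.
  have jx : chart_im j (cdom (charts i)) (cmap (charts j) p) by exact: chart_im_cmap.
  have tE : transition j i (cmap (charts j) p) = cmap (charts i) p by rewrite /transition cmapK.
  (* The differential in chart [j] is the Jacobian applied to the differential [v] in chart [i]; the
     Jacobian is invertible and [v] is non-zero. *)
  pose v : 'cV[R]_n.+1 := \col_c pd c (defining_density i) (cmap (charts i) p).
  have uJ : jac j i (cmap (charts j) p) \in unitmx by apply: jac_unit; exact: chart_im_cmap.
  have Jv : jac j i (cmap (charts j) p) *m v = 0.
    apply/matrixP => a k; rewrite mulmx_coord [RHS]mxE.
    transitivity (pd a (fun y => defining_density i (transition j i y)) (cmap (charts j) p)).
      rewrite (pd_transport a oi (@subset_refl _ _) si jx) /transport tE.
      by apply: eq_bigr => c _; rewrite [v c k]mxE mulrC.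
    by apply/eqP/negPn/negP; exact: H.
  have : v = 0 by rewrite -(mulKmx uJ v) Jv mulmx0.
  by move=> /matrixP/(_ b ord0); rewrite !mxE => E; rewrite E eqxx in db.
Qed.

(** The defining function is the representative of tau in one fixed chart [i]; adding half of its
    logarithmic differential to [u] leaves - trG G0 / (n+2), smooth up to the boundary. In the other
    charts this one-form is transported, because their own representatives of tau differ by a power
    of the Jacobian determinant. *)
Lemma is_projectively_compact : projectively_compact 2 nab.
Proof.
split=> // p bp; have [i ip] := charts_cover p.
pose U := cdom (charts i); have oU : open U := cdom_open (charts i).
have sU : smooth (chart_im i U) (defining_density i).
  apply: smooth_sub (smooth_defining_density i); first exact: relopen_chart_im.
  exact: chart_im_sub.
exists U, (fun q => defining_density i (cmap (charts i) q)); split=> //; first exact: defining_function.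
have [sG _ _] := cG; have oUI := openI oU oI.
(* What remains of [u] once the singular term is compensated. *)
pose v x a := - (n.+2%:R^-1 * trG (G0 i) x a).
have sv : smooth1 (chart_im i U) v.
  have oA := relopen_chart_im i oU.
  move=> a; apply: (smoothN oA); apply: (smoothM oA); first exact: smooth_cst.
  apply: smooth_trG => // b c d.
  by apply: smooth_sub (sG i b c d); [exact: relopen_chart_im|exact: chart_im_sub].
pose dl (x : coord_space R n) a := pd a (defining_density i) x / (2 * defining_density i x).
have sdl : smooth1 (chart_im i (U `&` inner M)) dl.
  have oA := relopen_chart_im i oUI.
  have sD : smooth (chart_im i (U `&` inner M)) (defining_density i).
    by apply: smooth_sub sU; [exact: relopen_chart_im|apply: chart_im_sub => q []].
  move=> a; apply: (smoothM oA); first exact: smooth_pd.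
  apply: smooth_inv => //; last by apply: (smoothM oA) => //; exact: smooth_cst.
  move=> x Wx; have Ix : chart_im i (inner M) x by apply: chart_im_sub Wx => q [].
  by rewrite mulr_gt0// defining_density_inner// weight2_gt0.
exists (fun j => proj_change (G0 j) (transport i v j)).
  apply: proj_change_connection => //; first exact: is_connection_sub oT (@subsetT _ U) cG.
  by apply: transport_oneform.
move=> j x Wx a b c; have Ix : chart_im j (inner M) x by apply: chart_im_sub Wx => q [].
have Ux : chart_im j U x by apply: chart_im_sub Wx => q [].
have [jx ix _] := chart_imP Ux.
have E d : u j x d + pd d (fun y => defining_density i (transition j i y)) x /
    (2 * defining_density i (transition j i x)) = transport i v j x d.
  rewrite (pd_transport d oU (@subset_refl _ _) sU Ux).
  transitivity (u j x d + transport i dl j x d).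
    congr (_ + _); rewrite /transport mulr_suml; apply: eq_bigr => e _.
    by rewrite /dl; ring.
  apply: (@oneform_ext R n M i (U `&` inner M) (fun j x d => u j x d + transport i dl j x d)
    (transport i v)) Wx => //.
  - apply: is_oneformD => //; first by apply: is_oneform_sub oI _ ou => q [].
    by apply: transport_oneform => // q [].
  - by apply: (is_oneform_sub oU); [move=> q []|exact: transport_oneform].
  - move=> y e Wy; rewrite !(transport_self _ _ Wy) /dl /v.
    have Iy : chart_im i (inner M) y by apply: chart_im_sub Wy => q [].
    have oB := relopen_chart_im i oI.
    rewrite (pd_local (g := weight2 i) e oB Iy (@defining_density_inner i)).
    rewrite (has_pdE (proj1 oB y Iy) (pd_weight2 (a := e) Iy)) defining_density_inner//.
    have := lt0r_neq0 (weight2_gt0 Iy); move: (weight2 i y) => w w0; field.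
    by rewrite w0 -natrD pnatr_eq0.
have {}E d : u j x d + pd d ((fun q => defining_density i (cmap (charts i) q)) \o cinv (charts j)) x /
    (2 * defining_density i (cmap (charts i) (cinv (charts j) x))) = transport i v j x d := E d.
exact: (proj_change_compose (eu Ix) E).
Qed.

Lemma is_defining_density_defining_density : is_defining_density 2 defining_density.
Proof.
split; [exact: is_density_defining_density|exact: defining_density_eq0|].
move=> i p bp ip; exists (cdom (charts i)), 1; split=> //; first by left.
have := defining_function i; congr is_defining_function.
by apply/funext => q; rewrite mul1r.
Qed.

(** The one-form [w] relating [G] to [nab] exists only over the interior, whereas every component of
    L(tau) built from [G] is smooth up to the boundary; so the identities are proved inside and
    vanish at the boundary as limits. *)
Lemma parallel_defining_density W G w : open W -> is_connection W G -> is_special W G ->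
  is_oneform (W `&` inner M) w ->
  conn_eq (W `&` inner M) nab (fun i => proj_change (G i) (w i)) ->
  forall i x, chart_im i W x ->
  [/\ forall a, nablaS2_top (G i) (splittingL (G i) (defining_density i)) x a = 0,
      forall a b, nablaS2_mid (G i) (splittingL (G i) (defining_density i)) x a b = 0
    & forall a b c, nablaS2_bot (G i) (splittingL (G i) (defining_density i)) x a b c = 0].
Proof.
move=> oW [sG tG _] [kG pG] ow ew i x Wx.
have oWI := openI oW oI; have oA := relopen_chart_im i oW; have oB := relopen_chart_im i oWI.
have BA : chart_im i (W `&` inner M) `<=` chart_im i W by apply: chart_im_sub => q [].
have BI : chart_im i (W `&` inner M) `<=` chart_im i (inner M) by apply: chart_im_sub => q [].
have [sn _ _] := cnab; have [sw _] := ow.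
have sGi : smooth3 (chart_im i W) (G i) by move=> a b c; exact: sG.
have sD : smooth (chart_im i W) (defining_density i).
  by apply: smooth_sub (smooth_defining_density i); [exact: relopen_chart_im|exact: chart_im_sub].
have cGi : closed1 (chart_im i W) (trG (G i)) by exact: closed_trG (preserves_volume_on i pG).
have cGB : closed1 (chart_im i (W `&` inner M)) (trG (G i)) by move=> y /BA; exact: cGi.
have cnB : closed1 (chart_im i (W `&` inner M)) (trG (nab i)).
  move=> y /BI Iy; apply: (closed_trG _ _ (preserves_volume_on i pk)) Iy => //.
  exact: relopen_chart_im.
have sGB : smooth3 (chart_im i (W `&` inner M)) (G i).
  by move=> a b c; exact: smooth_sub oA BA (sGi a b c).
have H y : chart_im i (W `&` inner M) y ->
  [/\ forall a, nablaS2_top (G i) (splittingL (G i) (defining_density i)) y a = 0,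
      forall a b, nablaS2_mid (G i) (splittingL (G i) (defining_density i)) y a b = 0
    & forall a b c, nablaS2_bot (G i) (splittingL (G i) (defining_density i)) y a b c = 0].
  move=> By.
  have [] := @parallel_splittingL R n (chart_im i (W `&` inner M)) (G i) (nab i) (w i)
    (defining_density i) hn oB sGB _ cGB (sw i) _ _ _ _ _ y By => //.
  - by move=> z /BA Wz a b c; exact: tG.
  - by apply: (closed_proj_change (H := nab i) oB sGB (sw i) _ cGB cnB) => z Bz a b c; exact: ew.
  - by move=> z Bz a b c; exact: ew.
  - exact: smooth_sub oA BA sD.
  - move=> z Bz a; have pB : preserves_on (chart_im i (W `&` inner M)) (nab i) (kappa i).
      have [sk k0 pk'] := preserves_volume_on i pk; split.
      + by apply: smooth_sub BI sk; exact: relopen_chart_im.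
      + by move=> t /BI; exact: k0.
      + by move=> t /BI; exact: pk'.
    have := @nabla0_density R n _ (G i) (nab i) (w i) (kappa i) z a oB pB (ew i) Bz.
    rewrite -/(weight2 i z) -(defining_density_inner (BI _ Bz)) => <-; rewrite /nabla0.
    rewrite -/(weight2 i z) (defining_density_inner (BI _ Bz)); congr (_ + _).
    by apply: (pd_local a oB Bz) => t /BI/defining_density_inner.
  - by move=> z /BI Iz a b c; exact: pR.
have K (F : tensor0 R n) : smooth (chart_im i W) F ->
    (forall y, chart_im i (W `&` inner M) y -> F y = 0) -> F x = 0.
  move=> sF F0; apply: (eq0_closure oA (smooth_cont sF)) Wx => y.
  by rewrite -chart_im_inner; exact: F0.
have sM := smooth_mid_splittingL oA sGi sD; have sBt := smooth_bot_splittingL oA sGi sD.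
have sP := smooth_schouten oA sGi.
split.
- move=> a; apply: (K (fun y => nablaS2_top (G i) (splittingL (G i) (defining_density i)) y a)).
    apply: (smoothB oA); first exact: (smooth_nabla0 2 oA sGi sD).
    by apply: (smoothM oA); [exact: smooth_cst|exact: sM].
  by move=> y /H[].
- move=> a b; apply: (K (fun y => nablaS2_mid (G i) (splittingL (G i) (defining_density i)) y a b)).
    apply: (smoothB oA); last exact: sBt.
    apply: (smoothD oA); first exact: smooth_nabla1.
    by apply: (smoothM oA); [exact: sP|exact: sD].
  by move=> y /H[].
- move=> a b c; apply: (K (fun y => nablaS2_bot (G i) (splittingL (G i) (defining_density i)) y a b c)).
    apply: (smoothD oA); last by apply: (smoothM oA); [exact: sP|exact: sM].
    apply: (smoothD oA); last by apply: (smoothM oA); [exact: sP|exact: sM].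
    exact: smooth_nabla2.
  by move=> y /H[].
Qed.

End Compactification.

Theorem theorem3p5 (R : realType) (n : nat) (hn : (1 <= n)%N) (M : bmanifold R n)
    (P : set (atlas_index M -> tensor3 R n)) (hP : is_projective_structure P)
    (nab : atlas_index M -> tensor3 R n) (hnab : in_class_on P (inner M) nab) :
  (is_nonflat_einstein_connection (inner M) nab <->
     [/\ is_special (inner M) nab,
         ricci_parallel (inner M) nab
       & ricci_nondegenerate (inner M) nab])
  /\
  (forall kappa : atlas_index M -> tensor0 R n,
     preserves_volume (inner M) nab kappa ->
     ricci_parallel (inner M) nab ->
     ricci_nondegenerate (inner M) nab ->
     nowhere_extendible nab ->
     projectively_compact 2 nab /\
     exists tau : atlas_index M -> tensor0 R n,
       [/\ is_density setT 2 tau,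
           forall i x, chart_im i (inner M) x ->
             tau i x = kappa i x `^ (- 2 / n.+2%:R),
           forall i x, chart_im i (bdry M) x -> tau i x = 0,
           is_defining_density 2 tau
         & is_normal_solution P tau]).
Proof.
have [cnab [G0 PG0 [u ou eu]]] := hnab.
have [G00 cG00 PE] := hP; have oI := @open_inner R n M.
have [cG0 [u1 ou1 eu1]] : is_connection setT G0 /\ proj_equiv setT G00 G0 by rewrite PE in PG0.
split; first exact: einstein_iff.
move=> kappa pk pR dR nx.
have cpt := is_projectively_compact hn cG0 cnab ou eu pk pR dR nx.
have dd := is_defining_density_defining_density hn cG0 cnab ou eu pk pR dR nx.
split=> //; exists (defining_density kappa).
have par : is_parallel_L P (defining_density kappa).
  move=> W G oW [cG [G2 PG2 [w ow ew]]] spG i x Wx.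
  have [cG2 [u2 ou2 eu2]] : is_connection setT G2 /\ proj_equiv setT G00 G2 by rewrite PE in PG2.
  have oWI := openI oW oI.
  have subT U : is_oneform setT U -> is_oneform (W `&` inner M) U.
    by apply: is_oneform_sub; [exact: openT|].
  (* Both connections are compared with the base connection [G00] of the class: [nab] is its change
     by u1 + u and [G] its change by u2 + w, so the difference of the two sums takes [G] to
     [nab]. *)
  apply: (parallel_defining_density hn cG0 cnab ou eu pk pR dR nx
    (w := fun j x a => u1 j x a + u j x a + - (u2 j x a + w j x a))) Wx => //.
    apply: is_oneformD => //.
      by apply: is_oneformD => //; [exact: subT|apply: is_oneform_sub oI _ ou => q []].
    apply: is_oneformN => //.
    by apply: is_oneformD => //; [exact: subT|apply: is_oneform_sub oW _ ow => q []].
  move=> j y Wy a b c.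
  have Iy : chart_im j (inner M) y by apply: chart_im_sub Wy => q [].
  have Ty : chart_im j setT y by apply: chart_im_sub Wy.
  have WWy : chart_im j W y by apply: chart_im_sub Wy => q [].
  rewrite (eu _ _ Iy) !proj_changeE (eu1 _ _ Ty) (ew _ _ WWy) !proj_changeE (eu2 _ _ Ty) !proj_changeE.
  ring.
split=> //.
- by have [] := dd.
- by move=> i x Ix; rewrite defining_density_inner.
- move=> i _ [p [ip bp] <-]; exact/(defining_density_eq0 pk ip).
(* The BGG operator symmetrizes the third slot, which is already zero. *)
- split=> // W G oW cl sp i x Wx a b c.
  by have [_ _ H] := par W G oW cl sp i x Wx; rewrite /sym3 !H !addr0 mulr0.
Qed.
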